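(* Let $X$ be a real or complex Banach space, let $T=(T(t))_{t\ge 0}$ be a holomorphic $C_0$-semigroup on $X$ with generator $-A$, and let $\tau>0$. Let $1<p<\infty$ and let $\Phi\colon \mathrm{tr}_p\to \mathrm{tr}_p$ be linear. Then the following statements are equivalent. (i) $A$ satisfies maximal regularity, and $I-\Phi T(\tau)\colon \mathrm{tr}_p\to \mathrm{tr}_p$ is bijective. (ii) The problem $\mathcal P_\Phi$ satisfies maximal $L^p$-regularity.
   Context: $D(A)$ carries the graph norm. $\mathrm{MR}_p:=W^{1,p}(0,\tau;X)\cap L^p(0,\tau;D(A))$ and $\mathrm{tr}_p:=\{w(0): w\in \mathrm{MR}_p\}$ is its trace space; since $T$ is holomorphic, $\mathrm{tr}_p=(X,D(A))_{1/p',p}$ with $\frac1p+\frac1{p'}=1$ and $\mathrm{tr}_p=\{x\in X: AT(\cdot)x\in L^p(0,\tau;X)\}$, and $T(\tau)X\subset D(A)\subset \mathrm{tr}_p$. $A$ satisfies maximal regularity (written $A\in\mathcal{MR}(X)$) if for all $f\in L^p(0,\tau;X)$ the function $(T*f)(t):=\int_0^tT(t-s)f(s)\,ds$ belongs to $W^{1,p}(0,\tau;X)$ (equivalently to $\mathrm{MR}_p$); this property does not depend on $p\in(1,\infty)$ or $\tau\in(0,\infty)$. For $f\in L^p(0,\tau;X)$, a strong $L^p$-solution of $\dot u+Au=f$ is a function $u\in W^{1,p}(0,\tau;X)$ such that $u(t)\in D(A)$ a.e. and $\dot u+Au=f$ a.e. on $(0,\tau)$. The problem $\mathcal P_\Phi$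 (that is, $\dot u+Au=f$, $u(0)=\Phi u(\tau)$) satisfies maximal $L^p$-regularity if for all $f\in L^p(0,\tau;X)$ there exists a unique strong $L^p$-solution $u$ of $\dot u+Au=f$ satisfying $u(0)=\Phi u(\tau)$. *)

(* Defs.v *)
From HB Require Import structures.
From mathcomp Require Import all_boot all_order all_algebra.
From mathcomp Require Import complex.
From mathcomp Require Import all_classical all_reals all_analysis.

Set Implicit Arguments.
Unset Strict Implicit.
Unset Printing Implicit Defensive.

Import Order.TTheory GRing.Theory Num.Theory.
Import numFieldNormedType.Exports.

Local Open Scope classical_set_scope.
Local Open Scope ring_scope.

(* A real or complex Banach space is a [completeNormedModType (field_of R s)].
   Its library norm takes values in the scalar field, so [rnorm] is the same
   norm with values in [R]. *)
Variant scalars := Reals | Complexes.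

Definition C (R : realType) : numFieldType := complex R.

Definition field_of (R : realType) (s : scalars) : numFieldType :=
  match s with Reals => R | Complexes => C R end.

Definition of_real (R : realType) (s : scalars) : R -> field_of R s :=
  match s with Reals => fun r => r | Complexes => fun r => Complex r 0 end.

Definition to_real (R : realType) (s : scalars) : field_of R s -> R :=
  match s with Reals => fun r => r | Complexes => fun z => complex.Re z end.

Definition rnorm (R : realType) (s : scalars)
  (X : normedModType (field_of R s)) (x : X) : R := to_real `|x|.

Section Bochner.
Context {R : realType} {s : scalars} {X : normedModType (field_of R s)}.
Implicit Types (D : set R) (f : R -> X).

Definition simple f :=
  finite_set (range f) /\ forall x, measurable (f @^-1` [set x]).

Definition simple_integral D f : X :=
  \sum_(x \in range f)
    of_real s (fine (lebesgue_measure (D `&` f @^-1` [set x]))) *: x.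

(* For [D] of finite measure: integrability of the simple functions is not
   required. All domains below are bounded intervals. *)
Definition has_bochner_integral D f (v : X) :=
  exists fn : nat -> R -> X,
    [/\ forall n, simple (fn n),
        {ae lebesgue_measure, forall t, D t -> fn n t @[n --> \oo] --> f t},
        (\int[lebesgue_measure]_(t in D) (rnorm (f t - fn n t))%:E)%E
          @[n --> \oo] --> 0%E
      & simple_integral D (fn n) @[n --> \oo] --> v].

(* 0 if [f] is not Bochner integrable on [D] *)
Definition bochner D f : X := xget 0 [set v | has_bochner_integral D f v].

(* [E] is the carrier of a linear subspace of [X] on which [N] is a norm:
   [E = setT], [N = rnorm] for L^p(0,tau;X), and [E = D(A)], [N] the graph norm
   for L^p(0,tau;D(A)). *)
Definition strongly_measurable (E : set X) (N : X -> R) D f :=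
  exists fn : nat -> R -> X,
    [/\ forall n, simple (fn n),
        forall n t, E (fn n t)
      & {ae lebesgue_measure, forall t, D t ->
           E (f t) /\ N (f t - fn n t) @[n --> \oo] --> (0 : R)}].

Definition Lp_in (E : set X) (N : X -> R) (p tau : R) f :=
  strongly_measurable E N `]0, tau[ f /\
  (\int[lebesgue_measure]_(t in `]0%R, tau[) ((N (f t)) `^ p)%:E < +oo)%E.

Definition Lp (p tau : R) f := Lp_in setT (@rnorm R s X) p tau f.

(* C^1 functions with compact support in ]0, tau[; they define the same weak
   derivatives as C^oo ones. *)
Definition test_function (tau : R) (phi : R -> R) :=
  [/\ forall t : R, derivable phi t 1,
      continuous (derive1 phi)
    & exists a b : R, [/\ 0 < a, b < tau
        & forall t, ~ (a <= t <= b) -> phi t = 0]].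

Definition weak_derivative (tau : R) (u v : R -> X) :=
  forall phi, test_function tau phi ->
    bochner `]0, tau[ (fun t => of_real s (derive1 phi t) *: u t) =
    - bochner `]0, tau[ (fun t => of_real s (phi t) *: v t).

(* Elements of W^{1,p}(0,tau;X) are given by their continuous representatives
   on [0,tau], so that [u 0] and [u tau] are the boundary values; [v] is a
   representative of the weak derivative. *)
Definition W1p_with (p tau : R) (u v : R -> X) :=
  [/\ {within `[0, tau], continuous u}, Lp p tau u, Lp p tau v
    & weak_derivative tau u v].

Definition W1p (p tau : R) (u : R -> X) := exists v, W1p_with p tau u v.

End Bochner.

Section Semigroup.
Context {R : realType} {s : scalars} {X : normedModType (field_of R s)}.
Implicit Type T : R -> X -> X.

Definition C0_semigroup T :=
  [/\ forall t : R, 0 <= t -> linear (T t) /\ continuous (T t),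
      forall x, T 0 x = x,
      forall (t r : R) x, 0 <= t -> 0 <= r -> T (t + r) x = T t (T r x)
    & forall x, T t x @[t --> 0^'+] --> x].

Definition diff_quotient T (x : X) (t : R) : X :=
  of_real s t^-1 *: (T t x - x).

(* The generator of [T] is - A, and [domA T] = D(A). *)
Definition domA T : set X := [set x | cvg (diff_quotient T x t @[t --> 0^'+])].

Definition opA T (x : X) : X := - lim (diff_quotient T x t @[t --> 0^'+]).

Definition graph_norm T (x : X) : R := rnorm x + rnorm (opA T x).

End Semigroup.

Definition sector (R : realType) (theta : R) : set (C R) :=
  [set z | exists r a : R,
     [/\ 0 < r, `|a| < theta & z = Complex (r * cos a) (r * sin a)]].

(* [act] is the multiplication by complex scalars on [Y]; [sector theta] is
   the open sector of half-angle [theta]. The values of [S] on the sector are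
   bounded complex-linear operators, complex differentiable in the strong
   operator topology (equivalently, in operator norm). *)
Definition has_holomorphic_extension (R : realType) (K : numFieldType)
  (Y : normedModType K) (act : C R -> Y -> Y) (T : R -> Y -> Y) :=
  exists (theta : R) (S : C R -> Y -> Y), 0 < theta <= pi / 2 /\
    [/\ forall t : R, 0 < t -> S (Complex t 0) = T t,
        forall z, sector theta z -> continuous (S z) /\
          forall c x y, S z (act c x + y) = act c (S z x) + S z y,
        forall z w x, sector theta z -> sector theta w ->
          S (z + w) x = S z (S w x),
        forall z x, sector theta z ->
          cvg (act h^-1 (S (z + h) x - S z x) @[h --> (0 : C R)^'])
      & forall (theta' : R) x, 0 < theta' < theta ->
          S z x @[z --> within (sector theta') (nbhs (0 : C R))] --> x].

(* multiplication by complex scalars on the complexification X + iX *)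
Definition cplx_act (R : realType) (X : normedModType R) (c : C R)
  (x : X * X) : X * X :=
  (complex.Re c *: x.1 - complex.Im c *: x.2,
   complex.Im c *: x.1 + complex.Re c *: x.2).

(* On a real space, holomorphy means holomorphy of the complexified
   semigroup. *)
Definition holomorphic_semigroup (R : realType) (s : scalars) :
    forall X : normedModType (field_of R s), (R -> X -> X) -> Prop :=
  match s with
  | Reals => fun X T =>
      has_holomorphic_extension (@cplx_act R X)
        (fun t (x : X * X) => (T t x.1, T t x.2))
  | Complexes => fun X T =>
      has_holomorphic_extension (fun (c : C R) (x : X) => c *: x) T
  end.

Section MaximalRegularity.
Context {R : realType} {s : scalars} {X : normedModType (field_of R s)}.
Variables (T : R -> X -> X) (p tau : R).
Implicit Types f u w : R -> X.

Definition MRp w :=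
  W1p p tau w /\ Lp_in (domA T) (graph_norm T) p tau w.

Definition trp : set X := [set x | exists2 w, MRp w & w 0 = x].

Definition convolution f (t : R) : X :=
  bochner `]0, t[ (fun r => T (t - r) (f r)).

Definition maximal_regularity := forall f, Lp p tau f -> W1p p tau (convolution f).

Definition strong_solution f u := exists v, W1p_with p tau u v /\
  {ae lebesgue_measure, forall t, t \in `]0, tau[ ->
     domA T (u t) /\ v t + opA T (u t) = f t}.

(* Uniqueness is uniqueness of the continuous representative on [0,tau]. *)
Definition maximal_Lp_regularity (Phi : X -> X) := forall f, Lp p tau f ->
  exists u, (strong_solution f u /\ u 0 = Phi (u tau)) /\
    forall u', strong_solution f u' -> u' 0 = Phi (u' tau) ->
      forall t, 0 <= t <= tau -> u' t = u t.

End MaximalRegularity.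

(* Main.v *)
(* In (i) => (ii) the solution is T(.)x + T * f, where x - Phi T(tau) x =
   Phi ((T * f)(tau)).  In (ii) => (i), T * f = u - T(.)u(0) for the solution u;
   injectivity is uniqueness for f = 0, and surjectivity at y comes from
   f = tau^-1 T(.)y, for which (T * f)(tau) = T(tau) y.  Both directions rest on
   two facts.  First, tr_p is the set of initial values, and by the reflection
   t |-> tau - t also of final values, of strong solutions.  Second, T(.)x is a
   strong solution for x in tr_p: if u is a strong solution with u(0) = x, then
   A T(t) x = A T(t) (x - u(t)) + T(t) A u(t), where |A T(t)| <= C / t by a
   Cauchy estimate, |x - u(t)| is at most the integral of |u'| over ]0, t[, and
   Hardy's inequality applies.  Complex spaces are treated as real ones by
   restriction of scalars. *)

Require Import Defs.
From HB Require Import structures.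
From mathcomp Require Import all_boot all_order all_algebra.
From mathcomp Require Import complex finmap.
From mathcomp Require Import all_classical all_reals all_analysis.
From mathcomp Require Import measurable_realfun.
From mathcomp Require Import ring lra.

Set Implicit Arguments.
Unset Strict Implicit.
Unset Printing Implicit Defensive.

Import Order.TTheory GRing.Theory Num.Theory.
Import numFieldNormedType.Exports.

Local Open Scope classical_set_scope.
Local Open Scope ring_scope.

(** Most of the work lies between the definitions and pointwise calculus. Membership in W^{1,p} is
    stated with test functions; it is traded for [u s - u r = bint r s v], which allows products
    with operator families such as [r |-> T (t - r)]. The generator is a limit at 0+, so the
    calculus rests on right-hand derivatives. Maximal regularity only puts T * f in W^{1,p}; that
    its values lie in D(A) and solve the equation is read off at right Lebesgue points. Elements of
    MR_p are approximated by simple functions in the graph norm, which a strong solution does not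
    provide directly; integrating the orbits over a short time supplies them. Holomorphy enters the
    equivalence through two consequences only: T(t) maps X into D(A) for t > 0, and |A T(t)| <= C /
    t. Both are proved on a real space with an operator [J] that plays the role of i, so that
    complex spaces and complexifications share one argument. There the semigroup law turns one
    derivative near 0 into bounded first and second derivatives further on, so that the contour
    argument needs only integrals of continuous functions over circles. *)

Local Notation mu := lebesgue_measure.

(** * The Bochner integral *)

Section SimpleFunctions.
Context {R : realType}.

(** The notion [simple] for an arbitrary codomain, since pairs and truth values of simple functions
    occur on the way; on a normed space the two are convertible. *)
Definition fsimple (U : Type) (f : R -> U) :=
  finite_set (range f) /\ forall x, measurable (f @^-1` [set x]).

Lemma fsimple_measurable (U : Type) (f : R -> U) (S : set U) :
  fsimple f -> measurable (f @^-1` S).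
Proof.
move=> [ff mf].
rewrite (_ : f @^-1` S = \bigcup_(x in range f `&` S) (f @^-1` [set x])).
  by apply: fin_bigcup_measurable => //; exact: finite_setIl.
apply/seteqP; split=> [t St|t [x [_ Sx] /= ->//]].
by exists (f t) => //; split => //; exists t.
Qed.

Lemma fsimple_comp2 (U W Z : Type) (h : U -> W -> Z) (f : R -> U) (g : R -> W) :
  fsimple f -> fsimple g -> fsimple (fun t => h (f t) (g t)).
Proof.
move=> sf sg; have [ff mf] := sf; have [fg mg] := sg; split.
  exact: finite_image11.
move=> z; rewrite (_ : _ @^-1` _ = \bigcup_(x in range f)
    (f @^-1` [set x] `&` g @^-1` [set w | h x w = z])).
  apply: fin_bigcup_measurable => // x _.
  by apply: measurableI => //; exact: fsimple_measurable.
apply/seteqP; split=> [t <-|t [x _ /= [-> ->]]//].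
by exists (f t) => //; exists t.
Qed.

Lemma fsimple_cst (U : Type) (c : U) : fsimple (fun _ : R => c).
Proof.
split=> [|x].
  by apply: (sub_finite_set _ (finite_set1 c)) => _ [t _ <-].
have [<-|cx] := pselect (c = x).
  by rewrite (_ : _ @^-1` _ = setT)//; apply/seteqP; split.
by rewrite (_ : _ @^-1` _ = set0)//; apply/seteqP; split.
Qed.

Lemma fsimple_comp (U Z : Type) (h : U -> Z) (f : R -> U) :
  fsimple f -> fsimple (h \o f).
Proof. by move=> sf; exact: (fsimple_comp2 (fun x _ => h x) sf sf). Qed.

Lemma fsimple_indic (A : set R) : measurable A -> fsimple (fun t => `[< A t >]).
Proof.
move=> mA; split=> [|[]]; first exact: finite_finset.
  rewrite (_ : _ @^-1` _ = A)//; apply/seteqP.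
  by split=> t /=; [move/asboolP|move=> ?; exact/asboolP].
rewrite (_ : _ @^-1` _ = ~` A); first exact: measurableC.
apply/seteqP.
by split=> t /=; [move/negbT/asboolPn|move=> ?; apply/negbTE/asboolPn].
Qed.

Import HBSimple.
Lemma sfun_fsimple (f : {sfun R >-> R}) : fsimple (f : R -> R).
Proof.
split; first exact: (fimfunP f).
by move=> x; exact: (measurable_funPTI f).
Qed.

Lemma measure_partition (U : choiceType) (pi : R -> U) (D : set R) (P : {pred U}) (s : seq U) :
  fsimple pi -> measurable D -> (mu D < +oo)%E -> uniq s ->
  fine (mu (D `&` pi @^-1` [set u | u \in s /\ P u])) =
  \sum_(u <- s | P u) fine (mu (D `&` pi @^-1` [set u])).
Proof.
move=> spi mD Doo; have fin S : mu (D `&` pi @^-1` S) \is a fin_num.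
  rewrite ge0_fin_numE//; apply: le_lt_trans Doo; apply: le_measure.
  - by rewrite inE; apply: measurableI => //; exact: fsimple_measurable.
  - by rewrite inE.
  - by move=> x [].
elim: s => [_|u s IH /= /andP[us us']].
  rewrite big_nil (_ : D `&` _ = set0) ?measure0//.
  by apply/seteqP; split=> // t [_ []].
rewrite big_cons -IH//; case: ifPn => [Pu|nPu].
  rewrite -fineD//; congr fine.
  rewrite -measureU//; last 3 first.
  - by apply: measurableI => //; exact: fsimple_measurable.
  - by apply: measurableI => //; exact: fsimple_measurable.
  - apply/seteqP; split=> // t [[_ /= tu] [_ [+ _]]].
    by rewrite tu => uin; rewrite uin in us.
  congr (mu _); apply/seteqP; split=> t /=.
    move=> [Dt []]; rewrite inE => /orP[/eqP ->|ts] Pt; [left|right] => //.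
  move=> [[Dt ->]|[Dt [ts Pt]]]; split=> //; split=> //; first exact: mem_head.
  by rewrite inE ts orbT.
congr (fine (mu _)); apply/seteqP; split=> t /=.
  move=> [Dt []]; rewrite inE => /orP[/eqP ->|ts] Pt //.
  by rewrite Pt in nPu.
by move=> [Dt [ts Pt]]; split=> //; split=> //; rewrite inE ts orbT.
Qed.

End SimpleFunctions.

Section SimpleIntegral.
Context {R : realType} {V : completeNormedModType R}.
Local Notation SI := (@simple_integral R Reals V).
Implicit Types (f g : R -> V) (D : set R).

(** Each fibre of [c \o pi] is a finite disjoint union of fibres of [pi]. With [pi] the pair of two
    simple functions, both are integrated over a common partition, and linearity becomes a termwise
    identity. *)
Lemma simple_integral_partition (U : choiceType) (pi : R -> U) (c : U -> V) D :
  fsimple pi -> measurable D -> (mu D < +oo)%E ->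
  SI D (c \o pi) =
  \sum_(u <- fset_set (range pi)) fine (mu (D `&` pi @^-1` [set u])) *: c u.
Proof.
move=> spi mD Doo; rewrite /simple_integral /=.
have scpi : fsimple (c \o pi) by exact: fsimple_comp.
rewrite fsbig_finite; last by case: scpi.
set r := fset_set (range pi).
under eq_bigr => x _.
  rewrite (_ : D `&` (c \o pi) @^-1` [set x] =
      D `&` pi @^-1` [set u | u \in (r : seq U) /\ c u == x]); last first.
    apply/seteqP; split=> t /= [Dt].
      by move=> <-; split=> //; split => //; rewrite in_fset_set ?inE; [exists t|case: spi].
    by move=> [_ /eqP].
  rewrite (measure_partition (fun u => c u == x))// scaler_suml.
  over.
(* After the exchange each [u] contributes to exactly one value, [x = c u]. *)
rewrite /= (exchange_big_dep xpredT)//=.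
apply: eq_big_seq => u ur; rewrite -big_filter.
rewrite (_ : [seq _ <- _ | _] = [:: c u]) ?big_seq1//.
rewrite (eq_filter (a2 := pred1 (c u))); last by move=> x; rewrite /= eq_sym.
apply: filter_pred1_uniq; first exact: fset_uniq.
rewrite in_fset_set; last by case: scpi.
move: ur; rewrite in_fset_set; last by case: spi.
by rewrite !inE => -[t _ <-]; exists t.
Qed.

Lemma simple_integralD_scale D f g (k : R) : fsimple f -> fsimple g ->
  measurable D -> (mu D < +oo)%E ->
  SI D (fun t => f t + k *: g t) = SI D f + k *: SI D g.
Proof.
move=> sf sg mD Doo; pose pi t := (f t, g t).
have spi : fsimple pi by exact: fsimple_comp2.
rewrite (_ : (fun t => _) = (fun p => p.1 + k *: p.2) \o pi)//.
rewrite simple_integral_partition//.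
rewrite -[SI D f]/(SI D (fst \o pi)) -[SI D g]/(SI D (snd \o pi)).
rewrite !simple_integral_partition// scaler_sumr -big_split /=.
by apply: eq_bigr => u _; rewrite scalerDr !scalerA (mulrC k).
Qed.

Lemma fsimple_measurable_fun (U : Type) (f : R -> U) (h : U -> R) :
  fsimple f -> measurable_fun setT (fun t => h (f t)).
Proof.
by move=> sf _ B mB; rewrite setTI; exact: (@fsimple_measurable _ _ f (h @^-1` B)).
Qed.

Lemma integral_norm_fsimple D f : fsimple f -> measurable D -> (mu D < +oo)%E ->
  (\int[mu]_(t in D) (`|f t|)%:E)%E =
  (\sum_(u <- fset_set (range f)) fine (mu (D `&` f @^-1` [set u])) * `|u|)%:E.
Proof.
move=> sf mD Doo; set r := fset_set (range f).
rewrite (eq_integral (fun t : measurableTypeR R =>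
    (\sum_(u <- r) `|u|%:E * (\1_(f @^-1` [set u]) t)%:E)%E)); last first.
  move=> t _; have tr : f t \in (r : seq V).
    by rewrite in_fset_set ?inE; [exists t|case: sf].
  rewrite (bigD1_seq (f t)) ?fset_uniq//= big1 ?adde0.
    by rewrite indicE (mem_set (_ : (f @^-1` [set f t]) t))// mule1.
  move=> u; rewrite indicE => /eqP uf; rewrite memNset ?mule0//=.
  by move=> fu; apply: uf.
have m1 u : measurable_fun D (EFin \o (\1_(f @^-1` [set u]) : measurableTypeR R -> R)).
  apply/measurable_EFinP/measurable_realfun.measurable_indic.
  by case: sf => _ /(_ u).
rewrite ge0_integral_sum//; last first.
  by move=> u; exact: (measurable_funeM _ (m1 u)).
rewrite -sumEFin; apply: eq_bigr => u _.
rewrite ge0_integralZl_EFin//; last exact: (m1 u).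
rewrite integral_indic//; last by case: sf => _; apply.
rewrite EFinM [RHS]muleC setIC fineK// ge0_fin_numE//.
apply: le_lt_trans Doo; apply: le_measure.
- by rewrite inE; apply: measurableI => //; case: sf => _; apply.
- by rewrite inE.
- by move=> x [].
Qed.

Lemma le_norm_simple_integral D f : fsimple f -> measurable D -> (mu D < +oo)%E ->
  (`|SI D f|%:E <= \int[mu]_(t in D) (`|f t|)%:E)%E.
Proof.
move=> sf mD Doo; rewrite integral_norm_fsimple// lee_fin.
rewrite (_ : f = id \o f)// simple_integral_partition//.
apply: le_trans (ler_norm_sum _ _ _) _; apply: ler_sum => u _.
by rewrite normrZ ger0_norm// fine_ge0.
Qed.

End SimpleIntegral.

#[export] Instance ae_lebesgue_filter (R : realType) :
  Filter (almost_everywhere (@lebesgue_measure R)) := ae_filter_ringOfSetsType _.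

(** * Comparison of integrals without measurability *)

Section LowerIntegral.
Context {R : realType}.
Implicit Types (D : set R) (f h : R -> \bar R).
Import HBNNSimple.

(* No measurability: on a non-measurable integrand the library integral is a
   lower integral, which still ignores null sets. *)
Lemma le_integral_ae D f h :
  measurable D -> (forall t, D t -> (0 <= f t)%E) -> (forall t, D t -> (0 <= h t)%E) ->
  {ae mu, forall t, D t -> (f t <= h t)%E} ->
  (\int[mu]_(t in D) f t <= \int[mu]_(t in D) h t)%E.
Proof.
move=> mD f0 h0 [N [mN N0 fhN]]; rewrite !ge0_integralE//.
apply: ge_ereal_sup => _ [g gf <-].
have mNc : measurable (~` N) by exact: measurableC.
rewrite (_ : sintegral mu g = sintegral mu (proj_nnsfun g mNc)).
  apply: ereal_sup_ubound; exists (proj_nnsfun g mNc) => // t.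
  have := gf t; rewrite /= /patch mindicE; case: ifPn => [|_]; last first.
    move=> gt0; rewrite (le_trans _ gt0)// lee_fin.
    by case: (t \in _); rewrite ?mulr1 ?mulr0// .
  rewrite inE => Dt gft; case: (boolP (t \in ~` N)) => tN.
    rewrite mulr1; apply: le_trans gft _; apply: contrapT => nfh.
    by move: tN; rewrite inE; apply; apply: fhN => /=; apply: contra_not nfh; exact.
  by rewrite mulr0 h0.
rewrite -!integralT_nnsfun; apply: ae_eq_integral => //.
- exact/measurable_EFinP.
- exact/measurable_EFinP.
exists N; split => // t /= ntN; apply: contrapT => Nt; apply: ntN => _.
by rewrite mindicE /= mem_set// mulr1.
Qed.

Lemma eq_integral_ae D f h :
  measurable D -> (forall t, D t -> (0 <= f t)%E) -> (forall t, D t -> (0 <= h t)%E) ->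
  {ae mu, forall t, D t -> f t = h t} ->
  (\int[mu]_(t in D) f t = \int[mu]_(t in D) h t)%E.
Proof.
move=> mD f0 h0 fh; apply/eqP; rewrite eq_le; apply/andP; split;
  apply: le_integral_ae => //; apply: filterS fh => t fht Dt; by rewrite fht.
Qed.

End LowerIntegral.

(** * Pointwise limits of simple functions *)

Section BorelFunctions.
Context {R : realType} {V : completeNormedModType R}.
Local Notation simple := (@simple R Reals V).
Implicit Types (f g : R -> V) (D : set R).

(** The convergence is required at every point, so the norm is Borel measurable and integrals of
    norms are additive. Strongly measurable functions, which are limits only almost everywhere on
    [D], are replaced by such representatives through [strongly_measurableP]. *)
Definition borel_strong f := exists fn : nat -> R -> V,
  (forall n, fsimple (fn n)) /\ forall t, fn n t @[n --> \oo] --> f t.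

Lemma borel_strong_norm f : borel_strong f ->
  measurable_fun setT (fun t => `|f t|).
Proof.
move=> [fn [sfn fnf]].
apply: (@measurable_fun_cvg _ _ _ _ (fun n t => `|fn n t|)) => [n|t _].
  exact: (fsimple_measurable_fun (fun x : V => `|x|)).
exact: cvg_norm.
Qed.

Lemma borel_strongDZ f g (k : R) : borel_strong f -> borel_strong g ->
  borel_strong (fun t => f t + k *: g t).
Proof.
move=> [fn [sf ff]] [gn [sg gg]]; exists (fun n t => fn n t + k *: gn n t); split.
  by move=> n; apply: (fsimple_comp2 (fun x y => x + k *: y)).
by move=> t; apply: cvgD => //; apply: cvgZr.
Qed.

Lemma borel_strong_cst (x : V) : borel_strong (fun=> x).
Proof. by exists (fun _ _ => x); split=> [n|t]; [exact: fsimple_cst|exact: cvg_cst]. Qed.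

Lemma borel_strongB f g : borel_strong f -> borel_strong g ->
  borel_strong (fun t => f t - g t).
Proof.
move=> bf bg; have := borel_strongDZ (-1) bf bg.
by under eq_fun do rewrite scaleN1r.
Qed.

Import HBSimple.
Lemma borel_strongZ f (phi : R -> R) : measurable_fun setT phi -> borel_strong f ->
  borel_strong (fun t => phi t *: f t).
Proof.
move=> mphi [fn [sf ff]].
have mphi' : measurable_fun setT (EFin \o phi) by exact/measurable_EFinP.
have [g gphi] := approximation_sfun measurableT mphi'.
exists (fun n t => g n t *: fn n t); split => [n|t].
  exact: (fsimple_comp2 (fun (a : R) (x : V) => a *: x) (sfun_fsimple (g n)) (sf n)).
apply: cvgZ => //.
have := gphi t Logic.I; exact: fine_cvg.
Qed.

Local Notation smeas := (@strongly_measurable R Reals V setT (@rnorm R Reals V)).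

Lemma strongly_measurableP D f : measurable D ->
  smeas D f <-> exists2 g, borel_strong g & {ae mu, forall t, D t -> f t = g t}.
Proof.
move=> mD; split.
  move=> [fn [sf _ [N [mN N0 ff]]]].
  have mDN : measurable (D `\` N) by exact: measurableD.
  (* Setting the limit and its approximations to 0 outside [D] and on the null set [N] turns
     convergence almost everywhere on [D] into convergence everywhere. *)
  exists (fun t => if `[< (D `\` N) t >] then f t else 0); last first.
    exists N; split=> // t /= nt; apply: contrapT => Nt; apply: nt => Dt.
    by case: asboolP => // -[].
  exists (fun n t => if `[< (D `\` N) t >] then fn n t else 0); split => [n|t].
    exact: (fsimple_comp2 (fun (b : bool) x => if b then x else 0) (fsimple_indic mDN) (sf n)).
  case: asboolP => [[Dt Nt]|_]; last exact: cvg_cst.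
  have /(_ Dt)[_ ] : D t -> setT (f t) /\ @rnorm R Reals V (f t - fn n t) @[n --> \oo] --> (0 : R).
    by apply: contrapT => ?; apply: Nt; apply: ff.
  move=> /norm_cvg0P fn0; apply/cvgrPdist_lt => e e0.
  move/cvgrPdist_lt : fn0 => /(_ _ e0); apply: filterS => n.
  by rewrite sub0r normrN.
move=> [g [gn [sg gg]] fg]; exists gn; split => //.
apply: filterS fg => t fg Dt; split => //; rewrite fg//.
apply/norm_cvg0P/cvgrPdist_lt => e e0.
move/cvgrPdist_lt : (gg t) => /(_ _ e0); apply: filterS => n.
by rewrite sub0r normrN.
Qed.

End BorelFunctions.

(** * Existence and uniqueness of the Bochner integral *)

Section BochnerIntegral.
Context {R : realType}.

Lemma cvge0P (u : nat -> \bar R) : (forall n, (0 <= u n)%E) ->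
  (u n @[n --> \oo] --> 0%E) <->
  (forall e, 0 < e -> \forall n \near \oo, (u n < e%:E)%E).
Proof.
move=> u0; split.
  move=> /fine_cvgP[fu] /cvgrPdist_lt cu e e0; have := cu _ e0.
  apply: filterS2 fu => n fin; rewrite sub0r normrN ger0_norm ?fine_ge0//.
  by move=> ue; rewrite -(fineK fin) lte_fin.
move=> cu; have fin : \forall n \near \oo, u n \is a fin_num.
  apply: filterS (cu _ ltr01) => n un; rewrite ge0_fin_numE//.
  exact: lt_trans un (ltry _).
apply/fine_cvgP; split => //; apply/cvgrPdist_lt => e e0.
apply: filterS2 fin (cu _ e0) => n fin un.
rewrite sub0r normrN ger0_norm ?fine_ge0//.
by rewrite -lte_fin fineK.
Qed.

Context {V : completeNormedModType R}.
Local Notation SI := (@simple_integral R Reals V).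
Local Notation boch := (@bochner R Reals V).
Local Notation HB := (@has_bochner_integral R Reals V).
Local Notation smeas := (@strongly_measurable R Reals V setT (@rnorm R Reals V)).
Implicit Types (f g h : R -> V) (D : set R) (v w : V).

Definition intnorm D f : \bar R := (\int[mu]_(t in D) (`|f t|)%:E)%E.

Lemma intnorm_ge0 D f : (0 <= intnorm D f)%E.
Proof. by apply: integral_ge0 => t _; rewrite lee_fin. Qed.

Lemma intnorm_ae D f g : measurable D -> {ae mu, forall t, D t -> f t = g t} ->
  intnorm D f = intnorm D g.
Proof.
move=> mD fg; apply: eq_integral_ae => //.
by apply: filterS fg => t fg Dt; rewrite fg.
Qed.

Lemma borel_strong_EFin D f : borel_strong f ->
  measurable_fun D (fun t => (`|f t|)%:E).
Proof.
move=> bf; apply/measurable_EFinP; apply: measurable_funTS.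
exact: borel_strong_norm.
Qed.

Lemma intnormD D f g : measurable D -> borel_strong f -> borel_strong g ->
  (intnorm D (fun t => (f t + g t)%R) <= intnorm D f + intnorm D g)%E.
Proof.
move=> mD bf bg; rewrite /intnorm -ge0_integralD//; try exact: borel_strong_EFin.
apply: le_integral_ae => //.
  by move=> t _; rewrite adde_ge0// lee_fin.
by apply: nearW => t _; rewrite lee_fin ler_normD.
Qed.

Lemma intnormZ D f (k : R) : measurable D -> borel_strong f ->
  intnorm D (fun t => k *: f t) = (`|k|%:E * intnorm D f)%E.
Proof.
move=> mD bf; rewrite /intnorm -ge0_integralZl_EFin//; try exact: borel_strong_EFin.
by apply: eq_integral => t _; rewrite normrZ EFinM.
Qed.

Lemma fsimple_borel f : fsimple f -> borel_strong f.
Proof. by move=> sf; exists (fun _ => f); split => // t; exact: cvg_cst. Qed.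

Lemma intnorm_triangle D f g h : measurable D ->
  borel_strong f -> borel_strong g -> borel_strong h ->
  (intnorm D (fun t => (g t - h t)%R) <=
   intnorm D (fun t => (f t - g t)%R) + intnorm D (fun t => (f t - h t)%R))%E.
Proof.
move=> mD bf bg bh; have bfg := borel_strongB bf bg; have bfh := borel_strongB bf bh.
have -> : intnorm D (fun t => f t - g t) = intnorm D (fun t => g t - f t).
  by apply: eq_integral => t _; rewrite distrC.
apply: le_trans (intnormD mD (borel_strongB bg bf) bfh).
rewrite (_ : (fun t => g t - h t) = (fun t => g t - f t + (f t - h t)))//.
by apply/funext => t; rewrite subrKA.
Qed.

Lemma simple_integral_dist D f g : measurable D -> (mu D < +oo)%E ->
  fsimple f -> fsimple g ->
  (`|SI D f - SI D g|%:E <= intnorm D (fun t => (f t - g t)%R))%E.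
Proof.
move=> mD Doo sf sg; rewrite -scaleN1r -simple_integralD_scale//.
under [X in intnorm D X]eq_fun do rewrite -scaleN1r.
apply: le_norm_simple_integral => //.
exact: (fsimple_comp2 (fun x y => x + -1 *: y)).
Qed.

Lemma has_bochner_integral_ae D f g v : measurable D ->
  {ae mu, forall t, D t -> f t = g t} -> HB D f v -> HB D g v.
Proof.
move=> mD fg [fn [sf ff If Sf]]; exists fn; split => //.
  by apply: filterS2 fg ff => t fg ff Dt; rewrite -fg//; exact: ff.
rewrite (_ : (fun n => _) = (fun n => intnorm D (fun t => f t - fn n t)))//.
apply/funext => n; apply: (@intnorm_ae D (fun t => g t - fn n t) (fun t => f t - fn n t)) => //.
by apply: filterS fg => t fg Dt; rewrite fg.
Qed.

Lemma has_bochner_integral_smeas D f v : HB D f v -> smeas D f.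
Proof.
move=> [fn [sf ff _ _]]; exists fn; split=> //.
apply: filterS ff => t ff Dt; split=> //.
apply/norm_cvg0P/cvgrPdist_lt => e e0.
move/cvgrPdist_lt : (ff Dt) => /(_ _ e0); apply: filterS => n.
by rewrite sub0r normrN.
Qed.

(** Integrals of simple functions differ by at most the L^1 distance of the functions, so every L^1
    approximation of [f] has the limit that the defining one has. This yields uniqueness of the
    value, and lets one sequence compute the integrals over several subdomains. *)
Lemma approx_simple_integral D f v (gn : nat -> R -> V) : measurable D -> (mu D < +oo)%E ->
  HB D f v -> (forall n, fsimple (gn n)) ->
  intnorm D (fun t => f t - gn n t) @[n --> \oo] --> 0%E ->
  SI D (gn n) @[n --> \oo] --> v.
Proof.
move=> mD Doo Hf sg Ig.
have /(strongly_measurableP _ mD)[g bg fg] := has_bochner_integral_smeas Hf.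
have [fn [sf _ If Sf]] := has_bochner_integral_ae mD fg Hf.
have {}Ig : intnorm D (fun t => g t - gn n t) @[n --> \oo] --> 0%E.
  rewrite (_ : (fun n => _) = (fun n => intnorm D (fun t => f t - gn n t)))//.
  apply/funext => n; apply: intnorm_ae => //.
  by apply: filterS fg => t fg Dt; rewrite fg.
apply/cvgrPdist_lt => e e0.
have e3 : 0 < e / 3 by rewrite divr_gt0.
move/(cvge0P (fun n => intnorm_ge0 _ _)) : Ig => /(_ _ e3) Ig.
move/(cvge0P (fun n => intnorm_ge0 _ _)) : If => /(_ _ e3) If.
move/cvgrPdist_lt : Sf => /(_ _ e3) Sf.
apply: filterS3 Ig If Sf => n Ig If Sf.
have d : `|SI D (fn n) - SI D (gn n)| < e / 3 + e / 3.
  rewrite -lte_fin EFinD; apply: le_lt_trans (simple_integral_dist mD Doo (sf n) (sg n)) _.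
  have bs n' (u : nat -> R -> V) : (forall n, fsimple (u n)) -> borel_strong (u n').
    by move=> su; exact: fsimple_borel.
  apply: le_lt_trans (intnorm_triangle mD bg (bs n _ sf) (bs n _ sg)) _.
  by rewrite lteD.
rewrite -(subrKA (SI D (fn n))); apply: le_lt_trans (ler_normD _ _) _.
rewrite [ltRHS](_ : e = e / 3 + (e / 3 + e / 3)); first exact: ltrD.
by field.
Qed.

Lemma has_bochner_integral_unique D f v w : measurable D -> (mu D < +oo)%E ->
  HB D f v -> HB D f w -> v = w.
Proof.
move=> mD Doo Hv [fn [sf ff If Sf]].
have Hl := approx_simple_integral mD Doo Hv sf If.
by rewrite -(cvg_lim (@norm_hausdorff _ _) Hl); exact: cvg_lim.
Qed.

Lemma has_bochner_integralP D f v : measurable D -> (mu D < +oo)%E ->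
  HB D f v -> boch D f = v.
Proof.
move=> mD Doo Hf; rewrite /bochner; case: xgetP => [w _ Hw|/(_ v)//].
exact: has_bochner_integral_unique Hw Hf.
Qed.

Lemma bochner_ae D f g : measurable D -> {ae mu, forall t, D t -> f t = g t} ->
  boch D f = boch D g.
Proof.
move=> mD fg; rewrite /bochner; congr xget; apply/seteqP; split=> v /=.
  exact: has_bochner_integral_ae.
by apply: has_bochner_integral_ae => //; apply: filterS fg => t fg Dt; rewrite fg.
Qed.

Lemma cvge0_sub (u w : nat -> \bar R) : (forall n, (0 <= u n)%E) -> (forall n, (u n <= w n)%E) ->
  w n @[n --> \oo] --> 0%E -> u n @[n --> \oo] --> 0%E.
Proof.
move=> u0 uw; have w0 n : (0 <= w n)%E by exact: le_trans (uw n).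
move=> /(cvge0P w0) cw; apply/cvge0P => // e e0.
by apply: filterS (cw _ e0) => n; apply: le_lt_trans.
Qed.

Lemma has_bochner_integralDZ D f g (k : R) v w : measurable D ->
  (mu D < +oo)%E -> HB D f v -> HB D g w ->
  HB D (fun t => f t + k *: g t) (v + k *: w).
Proof.
move=> mD Doo Hf Hg.
have /(strongly_measurableP _ mD)[f' bf ff'] := has_bochner_integral_smeas Hf.
have /(strongly_measurableP _ mD)[g' bg gg'] := has_bochner_integral_smeas Hg.
apply: (@has_bochner_integral_ae D (fun t => f' t + k *: g' t)) => //.
  by apply: filterS2 ff' gg' => t e1 e2 Dt; rewrite e1// e2.
have [fn [sf cf If Sf]] := has_bochner_integral_ae mD ff' Hf.
have [gn [sg cg Ig Sg]] := has_bochner_integral_ae mD gg' Hg.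
exists (fun n t => fn n t + k *: gn n t); split.
- by move=> n; exact: (fsimple_comp2 (fun x y => x + k *: y) (sf n) (sg n)).
- by apply: filterS2 cf cg => t cf cg Dt; apply: cvgD; [exact: cf|apply: cvgZr; exact: cg].
- apply: (@cvge0_sub _ (fun n => intnorm D (fun t => (f' t - fn n t)%R) +
     `|k|%:E * intnorm D (fun t => (g' t - gn n t)%R))%E).
  + by move=> n; exact: intnorm_ge0.
  + move=> n; have b1 := borel_strongB bf (fsimple_borel (sf n)).
    have b2 := borel_strongB bg (fsimple_borel (sg n)).
    rewrite -intnormZ//.
    have b3 : borel_strong (fun t => k *: (g' t - gn n t)).
      by apply: borel_strongZ => //; exact: measurable_cst.
    apply: le_trans (intnormD mD b1 b3).
    rewrite le_eqVlt; apply/orP; left; apply/eqP.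
    by apply: eq_integral => t _; rewrite /rnorm /= opprD addrACA scalerBr.
  + rewrite -[0%E]adde0; apply: cvgeD => //.
    have h := @cvgeZl _ _ _ _ _ `|k|%:E erefl Ig.
    by rewrite mule0 in h.
- rewrite (_ : (fun n => _) = (fun n => SI D (fn n) + k *: SI D (gn n))); last first.
    by apply/funext => n; exact: (simple_integralD_scale k (sf n) (sg n) mD Doo).
  by apply: cvgD => //; apply: cvgZr.
Qed.

Lemma has_bochner_integral_norm D f v : measurable D -> (mu D < +oo)%E ->
  HB D f v -> (`|v|%:E <= intnorm D f)%E.
Proof.
move=> mD Doo Hf.
have /(strongly_measurableP _ mD)[g bg fg] := has_bochner_integral_smeas Hf.
rewrite (intnorm_ae mD fg).
have [gn [sg cg Ig Sg]] := has_bochner_integral_ae mD fg Hf.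
apply/lee_addgt0Pr => e e0.
move/(cvge0P (fun n => intnorm_ge0 _ _)) : Ig => Ig.
have e2 : 0 < e / 2 by rewrite divr_gt0.
have [n [In Sn]] : exists n, (intnorm D (fun t => (g t - gn n t)%R) < (e / 2)%:E)%E /\ `|v - SI D (gn n)| < e / 2.
  move/cvgrPdist_lt : Sg => /(_ _ e2) Sg; have [n [? ?]] := filter_ex (filterI (Ig _ e2) Sg).
  by exists n.
have h1 : (`|SI D (gn n)|%:E <= intnorm D g + (e / 2)%:E)%E.
  apply: le_trans (le_norm_simple_integral (sg n) mD Doo) _.
  have b1 : borel_strong (fun t => gn n t - g t).
    exact: borel_strongB (fsimple_borel (sg n)) bg.
  apply: (@le_trans _ _ (intnorm D g + intnorm D (fun t => (gn n t - g t)%R))%E).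
    apply: le_trans (intnormD mD bg b1).
    rewrite le_eqVlt; apply/orP; left; apply/eqP.
    by apply: eq_integral => t _; rewrite subrKC.
  rewrite leeD2l// ltW//; apply: le_lt_trans In.
  rewrite le_eqVlt; apply/orP; left; apply/eqP.
  by apply: eq_integral => t _; rewrite distrC.
rewrite (splitr e) EFinD addeA; apply: (@le_trans _ _ (`|SI D (gn n)|%:E + (e / 2)%:E)%E).
  rewrite -EFinD lee_fin -lerBlDl; apply: le_trans (lerB_dist _ _) _; exact: ltW.
by rewrite leeD2r.
Qed.

Lemma borel_strong_bochner D f : measurable D -> (mu D < +oo)%E ->
  borel_strong f -> (intnorm D f < +oo)%E -> exists v, HB D f v.
Proof.
move=> mD Doo bf Ifoo; have [gn [sg cg]] := bf.
(* Cutting [gn n] off where it exceeds [2 * |f|] makes [3 * |f|] dominate the error. Pointwise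
   convergence survives: where [f t] is nonzero the cut is eventually inactive, and where [f t = 0]
   it leaves only the value 0. *)
pose A n := [set t | `|gn n t| <= 2 * `|f t|].
have mA n : measurable (A n).
  rewrite (_ : A n = setT `&` [set t | `|gn n t| <= 2 * `|f t|]); last by rewrite setTI.
  apply: measurable_fun_le => //.
    exact: (fsimple_measurable_fun (fun x : V => `|x|)).
  by apply: measurable_funM => //; exact: borel_strong_norm.
pose hn n t := if `[< A n t >] then gn n t else 0.
have sh n : fsimple (hn n).
  exact: (fsimple_comp2 (fun (b : bool) x => if b then x else 0) (fsimple_indic (mA n)) (sg n)).
have hle n t : `|hn n t| <= 2 * `|f t|.
  by rewrite /hn; case: asboolP => // _; rewrite normr0 mulr_ge0.
have ch t : hn n t @[n --> \oo] --> f t.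
  have [ft0|ft0] := eqVneq (f t) 0.
    rewrite ft0 (_ : (fun n => _) = fun=> 0); first exact: cvg_cst.
    apply/funext => n; have := hle n t; rewrite ft0 normr0 mulr0 normr_le0.
    by move/eqP.
  apply/cvgrPdist_lt => e e0.
  have fgt : 0 < `|f t| by rewrite normr_gt0.
  move/cvgrPdist_lt : (cg t) => ct; apply: filterS2 (ct _ e0) (ct _ fgt) => n.
  move=> l1 l2; rewrite /hn; case: asboolP => //; case.
  rewrite /A /= mulr_natl mulr2n -lerBlDl; apply: le_trans (lerB_dist _ _) _.
  by rewrite distrC ltW.
have If : mu.-integrable D (fun t => (3 * `|f t|)%:E).
  apply/integrableP; split.
    apply/measurable_EFinP; apply: measurable_funM => //.
    by apply: measurable_funTS; exact: borel_strong_norm.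
  under eq_integral do rewrite gee0_abs ?lee_fin ?mulr_ge0// EFinM.
  rewrite ge0_integralZl_EFin//; last exact: borel_strong_EFin.
  by rewrite lte_mul_pinfty.
have bh n : borel_strong (hn n) by exact: fsimple_borel.
have I0 : intnorm D (fun t => f t - hn n t) @[n --> \oo] --> 0%E.
  rewrite (_ : 0%E = (\int[mu]_(t in D) 0)%E :> \bar R); last by rewrite integral0.
  have /= [] := @dominated_convergence _ _ _ mu D mD (fun n t => (`|f t - hn n t|)%:E)
    (cst 0%E) (fun t => (3 * `|f t|)%:E) => //.
  - by move=> n; apply: borel_strong_EFin; exact: borel_strongB.
  - apply: nearW => t _; apply/(@fine_cvgP _ _ _ _ (fun n => (`|f t - hn n t|)%:E)).
    split; first exact: nearW.
    apply/norm_cvg0P/cvgrPdist_lt => e e0; move/cvgrPdist_lt : (ch t) => /(_ _ e0).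
    by apply: filterS => n; rewrite sub0r normrN.
  - apply: nearW => t n _; rewrite /= lee_fin normr_id.
    apply: le_trans (ler_normB _ _) _.
    by rewrite (_ : 3 = 1 + 2 :> R)// mulrDl mul1r lerD2l.
have c : cauchy (SI D (hn n) @[n --> \oo]).
  apply/cauchy_ballP => e e0.
  have e2 : 0 < e / 2 by rewrite divr_gt0.
  move/(cvge0P (fun n => intnorm_ge0 _ _)) : I0 => /(_ _ e2) [N _ I0].
  exists (SI D @` (hn @` [set n | (N <= n)%N]), SI D @` (hn @` [set n | (N <= n)%N])).
    by split; exists N => // n Nn; exists (hn n) => //; exists n.
  move=> [_ _] /= [[_ [n Nn <-] <-] [_ [m Nm <-] <-]].
  rewrite -ball_normE /= -lte_fin.
  apply: le_lt_trans (simple_integral_dist mD Doo (sh n) (sh m)) _.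
  apply: le_lt_trans (intnorm_triangle mD bf (bh n) (bh m)) _.
  by rewrite (splitr e) EFinD lteD// I0.
have /cvg_ex[v Sv] : cvg (SI D (hn n) @[n --> \oo]) by exact: cauchy_cvg.
exists v, hn; split => //.
by apply: nearW => t _.
Qed.

End BochnerIntegral.

Section BochnerIntegrable.
Context {R : realType} {V : completeNormedModType R}.
Local Notation SI := (@simple_integral R Reals V).
Local Notation HB := (@has_bochner_integral R Reals V).
Local Notation boch := (@bochner R Reals V).
Local Notation smeas := (@strongly_measurable R Reals V setT (@rnorm R Reals V)).
Implicit Types (f g h : R -> V) (D : set R) (v w : V).

Definition bochner_integrable D f := smeas D f /\ (intnorm D f < +oo)%E.
Local Notation BI := bochner_integrable.

Lemma smeas_ae D f g : measurable D -> {ae mu, forall t, D t -> f t = g t} ->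
  smeas D f -> smeas D g.
Proof.
move=> mD fg /(strongly_measurableP _ mD)[f' bf ff'].
apply/(strongly_measurableP _ mD); exists f' => //.
by apply: filterS2 fg ff' => t e1 e2 Dt; rewrite -e1// e2.
Qed.

Lemma smeas_sub D E f : E `<=` D -> smeas D f -> smeas E f.
Proof.
move=> ED [fn [sf fT ff]]; exists fn; split => //.
by apply: filterS ff => t h Et; apply: h; exact: ED.
Qed.

Lemma borel_smeas D f : measurable D -> borel_strong f -> smeas D f.
Proof.
by move=> mD bf; apply/(strongly_measurableP _ mD); exists f => //; exact: nearW.
Qed.

Lemma smeas_cst D v : smeas D (fun=> v).
Proof.
exists (fun _ _ => v); split => [n||]; [exact: fsimple_cst|by []|].
apply: nearW => t _; split=> //; rewrite subrr /rnorm /= normr0; exact: cvg_cst.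
Qed.

Lemma bochner_integrable_ae D f g : measurable D ->
  {ae mu, forall t, D t -> f t = g t} -> BI D f -> BI D g.
Proof.
by move=> mD fg [sf If]; split; [exact: smeas_ae fg sf|rewrite -(intnorm_ae mD fg)].
Qed.

Lemma bochnerP D f : measurable D -> (mu D < +oo)%E -> BI D f -> HB D f (boch D f).
Proof.
move=> mD Doo [/(strongly_measurableP _ mD)[g bg fg] If].
rewrite (bochner_ae mD fg).
have Ig : (intnorm D g < +oo)%E by rewrite -(intnorm_ae mD fg).
have [v Hv] := borel_strong_bochner mD Doo bg Ig.
rewrite (has_bochner_integralP mD Doo Hv).
by apply: has_bochner_integral_ae Hv => //; apply: filterS fg => t fg Dt; rewrite fg.
Qed.

Lemma bochner_integrableDZ D f g (k : R) : measurable D -> BI D f -> BI D g ->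
  BI D (fun t => f t + k *: g t).
Proof.
move=> mD [/(strongly_measurableP _ mD)[f' bf ff'] If] [/(strongly_measurableP _ mD)[g' bg gg'] Ig].
have E : {ae mu, forall t, D t -> f' t + k *: g' t = f t + k *: g t}.
  by apply: filterS2 ff' gg' => t e1 e2 Dt; rewrite e1// e2.
apply: (bochner_integrable_ae mD E); split.
  by apply: borel_smeas => //; exact: borel_strongDZ.
have bkg : borel_strong (fun t => k *: g' t).
  by apply: borel_strongZ => //; exact: measurable_cst.
apply: le_lt_trans (intnormD mD bf bkg) _.
rewrite -(intnorm_ae mD ff') intnormZ// -(intnorm_ae mD gg') lte_add_pinfty//.
by rewrite lte_mul_pinfty.
Qed.

Lemma bochnerDZ D f g (k : R) : measurable D -> (mu D < +oo)%E -> BI D f -> BI D g ->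
  boch D (fun t => f t + k *: g t) = boch D f + k *: boch D g.
Proof.
move=> mD Doo Bf Bg; apply: has_bochner_integralP => //.
by apply: has_bochner_integralDZ => //; exact: bochnerP.
Qed.

Lemma bochner_norm D f : measurable D -> (mu D < +oo)%E -> BI D f ->
  (`|boch D f|%:E <= intnorm D f)%E.
Proof. by move=> mD Doo Bf; apply: has_bochner_integral_norm => //; exact: bochnerP. Qed.

Lemma intnorm_sub D E f : measurable D -> measurable E -> E `<=` D -> smeas D f ->
  (intnorm E f <= intnorm D f)%E.
Proof.
move=> mD mE ED /(strongly_measurableP _ mD)[g bg fg].
have fg' : {ae mu, forall t, E t -> f t = g t}.
  by apply: filterS fg => t h Et; apply: h; exact: ED.
rewrite (intnorm_ae mD fg) (intnorm_ae mE fg').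
apply: ge0_subset_integral => //; exact: borel_strong_EFin.
Qed.

Lemma bochner_integrable_sub D E f : measurable D -> measurable E -> E `<=` D ->
  BI D f -> BI E f.
Proof.
move=> mD mE ED [sf If]; split; first exact: smeas_sub sf.
exact: le_lt_trans (intnorm_sub mD mE ED sf) If.
Qed.

Lemma bochner_integrable_le (W : completeNormedModType R) D f (h : R -> W) : measurable D -> smeas D f ->
  (intnorm D h < +oo)%E ->
  {ae mu, forall t, D t -> `|f t| <= `|h t|} -> BI D f.
Proof.
move=> mD sf Ih fh; split => //; apply: le_lt_trans Ih.
exact: le_integral_ae.
Qed.

(* The two pieces may miss a null set of [D]. *)
Lemma bochner_split D A B f : measurable D -> measurable A -> measurable B ->
  (mu D < +oo)%E -> A `<=` D -> B `<=` D -> A `&` B = set0 ->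
  mu (D `\` (A `|` B)) = 0%E -> BI D f ->
  boch D f = boch A f + boch B f.
Proof.
move=> mD mA mB Doo AD BD AB DAB Bf.
have ltoo E : measurable E -> E `<=` D -> (mu E < +oo)%E.
  by move=> mE ED; apply: le_lt_trans Doo; apply: le_measure; rewrite ?inE.
have := bochnerP mD Doo Bf => -[fn [sf ff If Sf]].
have smf : smeas D f by case: Bf.
have part E : measurable E -> E `<=` D -> SI E (fn n) @[n --> \oo] --> boch E f.
  move=> mE ED; apply: (approx_simple_integral mE (ltoo _ mE ED)
      (bochnerP mE (ltoo _ mE ED) (bochner_integrable_sub mD mE ED Bf)) sf).
  apply: (@cvge0_sub _ _ (fun n => intnorm D (fun t => f t - fn n t))) If => n.
    exact: intnorm_ge0.
  apply: intnorm_sub => //.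
  have := smf => /(strongly_measurableP _ mD)[g bg fg].
  apply/(strongly_measurableP _ mD); exists (fun t => g t - fn n t).
    exact: borel_strongB bg (fsimple_borel (sf n)).
  by apply: filterS fg => t fg Dt; rewrite fg.
have S n : SI D (fn n) = SI A (fn n) + SI B (fn n).
  rewrite /simple_integral /= !fsbig_finite//; try by case: (sf n).
  rewrite -big_split /=; apply: eq_bigr => x _.
  rewrite -scalerDl; congr (_ *: _).
  have mx : measurable (fn n @^-1` [set x]) by case: (sf n).
  have fin E : measurable E -> E `<=` D -> mu (E `&` fn n @^-1` [set x]) \is a fin_num.
    move=> mE ED; rewrite ge0_fin_numE//; apply: le_lt_trans Doo; apply: le_measure.
    - by rewrite inE; exact: measurableI.
    - by rewrite inE.
    - by move=> t [/ED].
  rewrite -fineD; [|exact: fin..]; congr fine.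
  rewrite -measureU; [|exact: measurableI|exact: measurableI|]; last first.
    by rewrite setIACA setIid AB set0I.
  rewrite -setIUl; apply/eqP; rewrite eq_le; apply/andP; split; last first.
    apply: le_measure; rewrite ?inE.
    - by apply: measurableI => //; exact: measurableU.
    - exact: measurableI.
    - by apply: setSI => t [/AD|/BD].
  rewrite -[leRHS]adde0 -DAB.
  have mDAB : measurable (D `\` (A `|` B)) by apply: measurableD => //; exact: measurableU.
  have mAB : measurable ((A `|` B) `&` fn n @^-1` [set x]).
    by apply: measurableI => //; exact: measurableU.
  apply: (@le_trans _ _ (mu (((A `|` B) `&` fn n @^-1` [set x]) `|` (D `\` (A `|` B))))); last first.
    exact: measureU2.
  apply: le_measure; rewrite ?inE.
  - exact: measurableI.
  - exact: measurableU.
  - move=> t [Dt tx]; have [ABt|nAB] := pselect ((A `|` B) t); first by left.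
    by right.
have h1 := part D mD (@subset_refl _ D).
have h2 : SI D (fn n) @[n --> \oo] --> boch A f + boch B f.
  rewrite (_ : (fun n => _) = (fun n => SI A (fn n) + SI B (fn n))); last exact/funext.
  by apply: cvgD; exact: part.
by rewrite -(cvg_lim (@norm_hausdorff _ _) h2) -(cvg_lim (@norm_hausdorff _ _) h1).
Qed.

End BochnerIntegrable.

(** * Invariance under reflections of the line *)

Section Reflection.
Context {R : realType}.

(** The codomain names its measurable structure, so that the instance of measurable function below
    can be attached. *)
Definition mirror (c t : R) : measurableTypeR R := c - t.

Lemma measurable_reflect (c : R) :
  measurable_fun setT (mirror c : measurableTypeR R -> measurableTypeR R).
Proof. exact: measurable_funB. Qed.

HB.instance Definition _ (c : R) := isMeasurableFun.Build _ _
  (measurableTypeR R) (measurableTypeR R) (mirror c) (measurable_reflect c).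

Lemma reflect_itv (c a b : R) (l r : bool) :
  mirror c @^-1` [set` Interval (BSide l a) (BSide r b)] =
  [set` Interval (BSide (~~ r) (c - b)) (BSide (~~ l) (c - a))].
Proof.
apply/seteqP; split=> t; rewrite /mirror /= !in_itv /=; case: l; case: r => /=;
  move=> /andP[? ?]; apply/andP; split; lra.
Qed.

(** The image measure agrees with Lebesgue measure on intervals, which determine it. Other
    substitutions are derived from this one: a translation is a product of two reflections, and time
    reversal on [[0, tau]] is a reflection. *)
Lemma lebesgue_measure_reflect (c : R) (A : set R) : measurable A ->
  mu (mirror c @^-1` A) = mu A.
Proof.
move=> mA; rewrite -[LHS]/(pushforward mu (mirror c) A).
apply/esym/lebesgue_measure_unique => //=; first exact: measurable_reflect.
move=> _ _ [[a b]] _ <-.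
rewrite /pushforward reflect_itv !lebesgue_measure_itv /= !lte_fin ltrD2l ltrN2.
by case: ifP => // _; rewrite -!EFinB; congr _%:E; ring.
Qed.

Lemma integral_reflect (c : R) (D : set R) (f : R -> \bar R) : measurable D ->
  measurable_fun D f -> (forall t, D t -> (0 <= f t)%E) ->
  (\int[mu]_(t in mirror c @^-1` D) f (mirror c t) = \int[mu]_(t in D) f t)%E.
Proof.
move=> mD mf f0.
have := @ge0_integral_pushforward _ _ (measurableTypeR R) (measurableTypeR R) R (mirror c) (measurable_reflect c) (@lebesgue_measure R) D f mD mf.
rewrite /= => <-; last by move=> t; rewrite inE => /f0.
apply: eq_measure_integral; first exact: measurable_reflect.
by move=> mr A mA _; exact: lebesgue_measure_reflect.
Qed.

Lemma ae_reflect (c : R) (P : R -> Prop) : {ae mu, forall t, P t} ->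
  {ae mu, forall t, P (c - t)}.
Proof.
move=> [N [mN N0 PN]]; exists (mirror c @^-1` N); split.
- by rewrite -[X in measurable X]setTI; exact: measurable_reflect.
- by rewrite lebesgue_measure_reflect.
- by move=> t /= nP; exact: PN.
Qed.

Lemma measurable_preimage_reflect (c : R) (D : set R) :
  measurable D -> measurable (mirror c @^-1` D).
Proof. by move=> mD; have := @measurable_reflect c measurableT D mD; rewrite setTI. Qed.

Lemma fsimple_reflect (U : Type) (c : R) (h : R -> U) :
  fsimple h -> fsimple (fun t => h (c - t)).
Proof.
move=> [fin mh]; split=> [|x].
  by apply: sub_finite_set fin => _ [t _ <-]; exists (c - t).
exact: (measurable_preimage_reflect c (mh x)).
Qed.

End Reflection.

(** * Bounded operators and composition under the integral *)

Section BochnerOperations.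
Context {R : realType} {V : completeNormedModType R}.
Local Notation SI := (@simple_integral R Reals V).
Local Notation HB := (@has_bochner_integral R Reals V).
Local Notation boch := (@bochner R Reals V).
Local Notation smeas := (@strongly_measurable R Reals V setT (@rnorm R Reals V)).
Local Notation BI := bochner_integrable.
Implicit Types (f g h : R -> V) (D : set R) (v w : V).

Lemma smeas_reflect (c : R) D f : measurable D -> smeas D f ->
  smeas (mirror c @^-1` D) (fun t => f (c - t)).
Proof.
move=> mD [fn [sf _ ff]]; exists (fun n t => fn n (c - t)); split=> //.
- by move=> n; exact: (fsimple_reflect c (sf n)).
- exact: (ae_reflect c ff).
Qed.

Lemma intnorm_reflect (c : R) D f : measurable D -> smeas D f ->
  intnorm (mirror c @^-1` D) (fun t => f (c - t)) = intnorm D f.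
Proof.
move=> mD /(strongly_measurableP _ mD)[g bg fg].
have mD' := measurable_preimage_reflect c mD.
rewrite (intnorm_ae mD fg) (@intnorm_ae _ _ _ _ (fun t => g (c - t)))//; last first.
  exact: (ae_reflect c fg).
by rewrite /intnorm -(integral_reflect c mD)//; exact: borel_strong_EFin.
Qed.

Lemma bochner_integrable_reflect (c : R) D f : measurable D -> BI D f ->
  BI (mirror c @^-1` D) (fun t => f (c - t)).
Proof.
by move=> mD [sf If]; split; [exact: smeas_reflect|rewrite intnorm_reflect].
Qed.

Lemma bochner_reflect (c : R) D f : measurable D -> (mu D < +oo)%E -> BI D f ->
  boch (mirror c @^-1` D) (fun t => f (c - t)) = boch D f.
Proof.
move=> mD Doo Bf; apply: has_bochner_integralP.
- exact: measurable_preimage_reflect.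
- by rewrite lebesgue_measure_reflect.
have [fn [sf ff If Sf]] := bochnerP mD Doo Bf.
exists (fun n t => fn n (c - t)); split=> //.
- by move=> n; exact: (fsimple_reflect c (sf n)).
- exact: (ae_reflect c ff).
- rewrite (_ : (fun n => _) = (fun n => intnorm D (fun t => f t - fn n t)))//.
  apply/funext => n; rewrite -(intnorm_reflect c)//.
  case: Bf => /(strongly_measurableP _ mD)[g bg fg] _.
  apply/(strongly_measurableP _ mD); exists (fun t => g t - fn n t).
    exact: borel_strongB bg (fsimple_borel (sf n)).
  by apply: filterS fg => t fg Dt; rewrite fg.
- rewrite (_ : (fun n => _) = (fun n => SI D (fn n)))//; apply/funext => n.
  rewrite /simple_integral.
  rewrite (_ : range (fun t => fn n (c - t)) = range (fn n)); last first.
    apply/seteqP; split=> _ [t _ <-]; first by exists (c - t).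
    by exists (c - t) => //; rewrite subKr.
  apply: eq_fsbigr => x _; congr (of_real _ _ *: _); congr fine.
  rewrite -[LHS](@lebesgue_measure_reflect _ c); last first.
    apply: measurableI; first exact: measurable_preimage_reflect.
    apply: (measurable_preimage_reflect c (D := fn n @^-1` [set x])).
    by case: (sf n).
  congr (mu _); apply/seteqP; split=> t /=; rewrite /mirror /=; by rewrite subKr.
Qed.

Lemma bochner_op (W : completeNormedModType R) (L : V -> W) (M : R) D f :
  (forall x y, L (x + y) = L x + L y) -> (forall k x, L (k *: x) = k *: L x) ->
  (forall x, `|L x| <= M * `|x|) ->
  measurable D -> (mu D < +oo)%E -> BI D f ->
  bochner_integrable D (L \o f) /\ @bochner R Reals W D (L \o f) = L (boch D f).
Proof.
move=> LD LZ LM mD Doo Bf.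
have L0 : L 0 = 0 by rewrite -(scale0r 0) LZ scale0r.
have LB x y : L (x - y) = L x - L y by rewrite LD -scaleN1r LZ scaleN1r.
have Lsum (I : Type) (r : seq I) (F : I -> V) : L (\sum_(i <- r) F i) = \sum_(i <- r) L (F i).
  by elim: r => [|i r IH]; rewrite ?big_nil// !big_cons LD IH.
(* On a trivial space the given constant may be negative, whence the maximum with 0. *)
have M0 : 0 <= Num.max M 0 by rewrite le_max lexx orbT.
have LM' x : `|L x| <= Num.max M 0 * `|x|.
  by apply: le_trans (LM x) _; rewrite ler_wpM2r// le_max lexx.
have Lcvg (un : nat -> V) u : un n @[n --> \oo] --> u -> L (un n) @[n --> \oo] --> L u.
  move=> uu; apply/cvgrPdist_lt => e e0.
  have d0 : 0 < e / (Num.max M 0 + 1) by rewrite divr_gt0// ltr_wpDl.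
  move/cvgrPdist_lt : uu => /(_ _ d0); apply: filterS => n.
  rewrite ltr_pdivlMr ?ltr_wpDl// => un'; rewrite -LB.
  apply: le_lt_trans (LM' _) _; apply: le_lt_trans un'.
  by rewrite mulrC ler_wpM2l// lerDl.
have [fn [sf ff If Sf]] := bochnerP mD Doo Bf.
have Bf' := Bf; case: Bf' => smf Iff.
have /(strongly_measurableP _ mD)[g bg fg] := smf.
have bLg h : borel_strong h -> borel_strong (L \o h).
  move=> [hn [sh hh]]; exists (fun n => L \o hn n); split=> [n|t].
    exact: fsimple_comp.
  exact: Lcvg.
have bd h : borel_strong h -> (intnorm D (L \o h) <= (Num.max M 0)%:E * intnorm D h)%E.
  move=> bh; rewrite -[X in (X%:E * _)%E]ger0_norm// -intnormZ//.
  apply: le_integral_ae => //; apply: nearW => t _.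
  by rewrite lee_fin normrZ (ger0_norm M0); exact: LM'.
have sL : @strongly_measurable R Reals W setT (@rnorm R Reals W) D (L \o f).
  apply/(strongly_measurableP _ mD); exists (L \o g); first exact: bLg.
  by apply: filterS fg => t fg Dt; rewrite /= fg.
split.
  split => //; rewrite (@intnorm_ae _ _ _ _ (L \o g))//; last first.
    by apply: filterS fg => t fg Dt; rewrite /= fg.
  apply: le_lt_trans (bd _ bg) _; rewrite lte_mul_pinfty//.
  by rewrite -(intnorm_ae mD fg).
apply: has_bochner_integralP => //; exists (fun n => L \o fn n); split.
- by move=> n; exact: (fsimple_comp L (sf n)).
- by apply: filterS ff => t ff Dt; apply: Lcvg; exact: ff.
- apply: (@cvge0_sub _ _ (fun n => (Num.max M 0)%:E * intnorm D (fun t => (f t - fn n t)%R)))%E.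
  + by move=> n; exact: (@intnorm_ge0 _ W D (fun t => L (f t) - L (fn n t))).
  + move=> n; rewrite (@intnorm_ae _ _ _ (fun t => f t - fn n t) (fun t => g t - fn n t))//; last first.
      by apply: filterS fg => t fg Dt; rewrite fg.
    apply: le_trans (bd _ (borel_strongB bg (fsimple_borel (sf n)))).
    apply: le_integral_ae => //; first by move=> t _; rewrite lee_fin /rnorm /=.
    by apply: filterS fg => t fg Dt; rewrite lee_fin /rnorm /= fg// LB.
  + have h := @cvgeZl _ _ _ _ _ (Num.max M 0)%:E erefl If.
    by rewrite mule0 in h.
- rewrite (_ : (fun n => _) = (fun n => L (SI D (fn n)))); first exact: Lcvg.
  apply/funext => n; rewrite simple_integral_partition//; last exact: (sf n).
  rewrite -[SI D (fn n)]/(SI D (id \o fn n)) simple_integral_partition//; last exact: (sf n).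
  by rewrite Lsum; apply: eq_bigr => x _; rewrite LZ.
Qed.

Lemma smeas_comp2 (W : completeNormedModType R) (U : completeNormedModType R) D
    (h : V -> W -> U) f (g : R -> W) :
  (forall (xn : nat -> V) (yn : nat -> W) x y, xn n @[n --> \oo] --> x ->
    yn n @[n --> \oo] --> y -> h (xn n) (yn n) @[n --> \oo] --> h x y) ->
  measurable D -> smeas D f -> @strongly_measurable R Reals W setT (@rnorm R Reals W) D g ->
  @strongly_measurable R Reals U setT (@rnorm R Reals U) D (fun t => h (f t) (g t)).
Proof.
move=> hc mD /(strongly_measurableP _ mD)[f' [fn [sf ff]] ff'].
move=> /(strongly_measurableP _ mD)[g' [gn [sg gg]] gg'].
apply/(strongly_measurableP _ mD); exists (fun t => h (f' t) (g' t)).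
  exists (fun n t => h (fn n t) (gn n t)); split=> [n|t]; first exact: fsimple_comp2.
  exact: hc.
by apply: filterS2 ff' gg' => t e1 e2 Dt; rewrite e1// e2.
Qed.

Lemma smeas_norm D f : measurable D -> smeas D f ->
  @strongly_measurable R Reals R setT (@rnorm R Reals R) D (fun t => `|f t|).
Proof.
move=> mD sf; apply: (@smeas_comp2 _ _ D (fun x _ => `|x|) f f) => //.
by move=> xn yn x y xx _; exact: cvg_norm.
Qed.

Import HBSimple.
(* [G] is only evaluated at points of the interval, at which it is jointly
   sequentially continuous. *)
Lemma smeas_continuous_comp (W : completeNormedModType R) (a b : R) (G : R -> W -> V) (f : R -> W) :
  (forall (rn : nat -> R) (xn : nat -> W) t x, (forall n, a < rn n < b) -> a < t < b ->
    rn n @[n --> \oo] --> t -> xn n @[n --> \oo] --> x ->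
    G (rn n) (xn n) @[n --> \oo] --> G t x) ->
  @strongly_measurable R Reals W setT (@rnorm R Reals W) `]a, b[ f ->
  smeas `]a, b[ (fun t => G t (f t)).
Proof.
move=> Gc; have mD : measurable (`]a, b[%classic : set R) by [].
move=> /(strongly_measurableP _ mD)[f' [fn [sf ff]] ff'].
have [ab|ba] := ltP a b; last first.
  exists (fun _ _ => 0); split=> [n||]; [exact: fsimple_cst|by []|].
  apply: nearW => t /=; rewrite in_itv /= => /andP[h1 h2].
  by have := lt_le_trans (lt_trans h1 h2) ba; rewrite ltxx.
have mid : measurable_fun setT (EFin \o (id : R -> R)) by exact/measurable_EFinP.
(* The identity is itself approximated by simple functions, because [G] applied to two simple
   functions is simple. Their values may leave the interval, where nothing is known of [G]; [proj]
   sends such values to the midpoint. *)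
have [g gid] := approximation_sfun measurableT mid.
pose proj (r : R) := if a < r < b then r else (a + b) / 2.
have projP r : a < proj r < b.
  by rewrite /proj; case: ifP => // _; rewrite midf_lt//= midf_lt.
suff : smeas `]a, b[ (fun t => G t (f' t)).
  by apply: smeas_ae => //; apply: filterS ff' => t e Dt; rewrite e.
exists (fun n t => G (proj (g n t)) (fn n t)); split => //.
  move=> n; apply: (fsimple_comp2 (fun r x => G (proj r) x) (sfun_fsimple (g n)) (sf n)).
apply: nearW => t; rewrite /= in_itv /= => tab; split=> //.
have c : G (proj (g n t)) (fn n t) @[n --> \oo] --> G t (f' t).
  apply: Gc => //.
  have gcv : g n t @[n --> \oo] --> t by have := gid t Logic.I; exact: fine_cvg.
  apply: (cvg_trans _ gcv); apply: near_eq_cvg.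
  have : \forall n \near \oo, a < g n t < b.
    have [ta tb] := andP tab.
    have ga : \forall n \near \oo, a < g n t by exact: (cvgr_gt t gcv _ ta).
    have gb : \forall n \near \oo, g n t < b by exact: (cvgr_lt t gcv _ tb).
    by apply: filterS2 ga gb => n -> ->.
  by apply: filterS => n; rewrite /proj => ->.
apply/norm_cvg0P/cvgrPdist_lt => e e0; move/cvgrPdist_lt : c => /(_ _ e0).
by apply: filterS => n; rewrite sub0r normrN.
Qed.

End BochnerOperations.

(** * Integrals over bounded open intervals *)

Section IntervalIntegral.
Context {R : realType} {V : completeNormedModType R}.
Local Notation boch := (@bochner R Reals V).
Local Notation smeas := (@strongly_measurable R Reals V setT (@rnorm R Reals V)).
Implicit Types (f g h : R -> V) (a b c : R).

Definition intg a b f := bochner_integrable `]a, b[ f.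
Definition bint a b f : V := boch `]a, b[ f.
(** The L^1 norm as a real number; [fine] turns an infinite value into 0, so that it is meaningful
    under [intg], through [nintE]. *)
Definition nint a b f : R := fine (intnorm `]a, b[ f).

Let mI a b : measurable (`]a, b[%classic : set R).
Proof. by []. Qed.

Lemma mu_itvoo a b : (mu (`]a, b[%classic : set R) < +oo)%E.
Proof. by rewrite lebesgue_measure_itv; case: ifP => //= _; exact: ltry. Qed.

Lemma itvoo_sub a b a' b' : a <= a' -> b' <= b ->
  (`]a', b'[ `<=` `]a, b[)%classic.
Proof. by move=> aa bb t /=; rewrite !in_itv /= => /andP[? ?]; apply/andP; split; lra. Qed.

Lemma itvoo0 a b : b <= a -> `]a, b[%classic = set0 :> set R.
Proof. by move=> ba; apply/seteqP; split => // t /=; rewrite in_itv /= => /andP[? ?]; lra. Qed.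

Lemma intg_sub a b a' b' f : a <= a' -> b' <= b -> intg a b f -> intg a' b' f.
Proof. by move=> aa bb; apply: bochner_integrable_sub => //; exact: itvoo_sub. Qed.

Lemma nintE a b f : intg a b f -> intnorm `]a, b[ f = (nint a b f)%:E.
Proof. by move=> [_ If]; rewrite fineK// ge0_fin_numE// intnorm_ge0. Qed.

Lemma nint_ge0 a b f : 0 <= nint a b f.
Proof. by apply: fine_ge0; exact: intnorm_ge0. Qed.

Lemma bint_norm a b f : intg a b f -> `|bint a b f| <= nint a b f.
Proof.
by move=> If; rewrite -lee_fin -nintE//; apply: bochner_norm => //; exact: mu_itvoo.
Qed.

Lemma bint_ae a b f g : {ae mu, forall t, a < t < b -> f t = g t} -> bint a b f = bint a b g.
Proof.
move=> fg; exact: bochner_ae.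
Qed.

Lemma bint_eq a b f g : (forall t, a < t < b -> f t = g t) -> bint a b f = bint a b g.
Proof. by move=> fg; apply: bint_ae; exact: nearW. Qed.

Lemma nint_ae a b f g : {ae mu, forall t, a < t < b -> f t = g t} -> nint a b f = nint a b g.
Proof.
move=> fg; congr fine; exact: intnorm_ae.
Qed.

Lemma intg_ae a b f g : {ae mu, forall t, a < t < b -> f t = g t} -> intg a b f -> intg a b g.
Proof.
move=> fg; exact: bochner_integrable_ae.
Qed.

Lemma intg_eq a b f g : (forall t, a < t < b -> f t = g t) -> intg a b f -> intg a b g.
Proof. by move=> fg; apply: intg_ae; exact: nearW. Qed.

Lemma intnorm_cst a b (x : V) : a <= b -> intnorm `]a, b[ (fun=> x) = (`|x| * (b - a))%:E.
Proof.
move=> ab; rewrite /intnorm integral_cst//= lebesgue_measure_itv /= lte_fin EFinM.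
congr (_ * _)%E; case: ifP => // /negbT; rewrite -leNgt => ba.
by have -> : b - a = 0 by lra.
Qed.

Lemma intg_cst a b (x : V) : intg a b (fun=> x).
Proof.
split; first exact: smeas_cst.
have [ab|ba] := leP a b; first by rewrite intnorm_cst// ltry.
by rewrite itvoo0 1?ltW// /intnorm integral_set0.
Qed.

Lemma intg_bounded a b f (M : R) : smeas `]a, b[ f ->
  {ae mu, forall t, a < t < b -> `|f t| <= M} -> intg a b f.
Proof.
move=> sf fM; have [_ IM] : bochner_integrable `]a, b[ (fun=> M : R).
  split; first exact: smeas_cst.
  by rewrite /intnorm integral_cst// lte_mul_pinfty// mu_itvoo.
apply: (bochner_integrable_le _ sf IM) => //.
apply: filterS fM => t fM /=; rewrite in_itv /= => tab.
by apply: le_trans (fM tab) (ler_norm _).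
Qed.

Lemma nint_bound a b f (M : R) : a <= b ->
  {ae mu, forall t, a < t < b -> `|f t| <= M} -> nint a b f <= M * (b - a).
Proof.
move=> ab fM.
have le : (intnorm `]a, b[ f <= (M * (b - a))%:E)%E.
  have [eab|neab] := eqVneq a b.
    by rewrite -eab itvoo0// /intnorm integral_set0 subrr mulr0.
  have M0 : 0 <= M.
    rewrite leNgt; apply/negP => M0.
    have [N [mN N0 HN]] := fM.
    have : (mu (`]a, b[%classic : set R) <= mu N)%E.
      apply: le_measure; rewrite ?inE// => t /= tab; apply: HN => /= H.
      by have := le_lt_trans (H tab) M0; rewrite normr_lt0.
    rewrite lebesgue_measure_itv /= lte_fin lt_neqAle neab ab /= [mu N]N0 -EFinB lee_fin.
    by move=> ba; case/eqP: neab; lra.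
  apply: (@le_trans _ _ (\int[mu]_(t in `]a, b[) M%:E)%E).
    by apply: le_integral_ae.
  rewrite integral_cst//= lebesgue_measure_itv /= lte_fin lt_neqAle neab ab /=.
  by rewrite -EFinB -EFinM.
rewrite -lee_fin fineK//.
by rewrite ge0_fin_numE ?intnorm_ge0//; apply: le_lt_trans le (ltry _).
Qed.

Lemma intgDZ a b f g (k : R) : intg a b f -> intg a b g -> intg a b (fun t => f t + k *: g t).
Proof. exact: bochner_integrableDZ. Qed.

Lemma bintDZ a b f g (k : R) : intg a b f -> intg a b g ->
  bint a b (fun t => f t + k *: g t) = bint a b f + k *: bint a b g.
Proof. by apply: bochnerDZ => //; exact: mu_itvoo. Qed.

Lemma intgB a b f g : intg a b f -> intg a b g -> intg a b (fun t => f t - g t).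
Proof. by move=> f1 g1; have := intgDZ (-1) f1 g1; apply: intg_eq => t _; rewrite scaleN1r. Qed.

Lemma bintB a b f g : intg a b f -> intg a b g ->
  bint a b (fun t => f t - g t) = bint a b f - bint a b g.
Proof.
move=> f1 g1; rewrite -[in RHS]scaleN1r -(bintDZ _ f1 g1).
by apply: bint_eq => t _; rewrite scaleN1r.
Qed.

Lemma intgD a b f g : intg a b f -> intg a b g -> intg a b (fun t => f t + g t).
Proof. by move=> f1 g1; have := intgDZ 1 f1 g1; apply: intg_eq => t _; rewrite scale1r. Qed.

Lemma bintD a b f g : intg a b f -> intg a b g ->
  bint a b (fun t => f t + g t) = bint a b f + bint a b g.
Proof.
move=> f1 g1; rewrite -[in RHS](scale1r (bint a b g)) -(bintDZ _ f1 g1).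
by apply: bint_eq => t _; rewrite scale1r.
Qed.

Lemma bint0 a b : bint a b (fun=> 0) = 0.
Proof.
apply/normr0_eq0/le_anti; rewrite normr_ge0 andbT.
apply: le_trans (bint_norm (intg_cst _ _ _)) _.
rewrite /nint /intnorm normr0 integral0 //.
Qed.

Lemma intgZ a b f (k : R) : intg a b f -> intg a b (fun t => k *: f t).
Proof.
by move=> f1; have := intgDZ k (intg_cst a b 0) f1; apply: intg_eq => t _; rewrite add0r.
Qed.

Lemma bintZ a b f (k : R) : intg a b f -> bint a b (fun t => k *: f t) = k *: bint a b f.
Proof.
move=> f1; rewrite -[RHS]add0r -(bint0 a b) -(bintDZ _ (intg_cst _ _ _) f1).
by apply: bint_eq => t _; rewrite add0r.
Qed.

Lemma bint_empty a b f : b <= a -> bint a b f = 0.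
Proof.
move=> ba; rewrite -(bint0 a b); apply: bint_eq => t /andP[h1 h2].
by have := lt_le_trans (lt_trans h1 h2) ba; rewrite ltxx.
Qed.

Lemma bint_split a b c f : a <= b -> b <= c -> intg a c f ->
  bint a c f = bint a b f + bint b c f.
Proof.
move=> ab bc If; apply: bochner_split => //.
- exact: mu_itvoo.
- exact: itvoo_sub.
- exact: itvoo_sub.
- by apply/seteqP; split=> // t []; rewrite /= !in_itv /= => /andP[? ?] /andP[? ?]; lra.
apply/eqP; rewrite -measure_le0 -(lebesgue_measure_set1 b); apply: le_measure.
- by rewrite inE; apply: measurableD => //; exact: measurableU.
- by rewrite inE.
move=> t [/=]; rewrite !in_itv /= => /andP[? ?] /not_orP[h1 h2].
by apply/eqP; rewrite eq_le !leNgt; apply/andP; split; apply/negP => ?;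
  [apply: h2|apply: h1]; apply/andP.
Qed.

Lemma nint_split a b c f : a <= b -> b <= c -> intg a c f ->
  nint a c f = nint a b f + nint b c f.
Proof.
move=> ab bc If; have [/(strongly_measurableP _ (mI a c))[g bg fg] _] := If.
have fg' a' b' : a <= a' -> b' <= c -> {ae mu, forall t, a' < t < b' -> f t = g t}.
  move=> aa bb; apply: filterS fg => t /=; rewrite in_itv /= => fg /andP[? ?]; apply: fg.
  by apply/andP; split; lra.
have Ig := intg_ae (fg' a c (lexx _) (lexx _)) If.
rewrite !(nint_ae (fg' _ _ _ _))//; apply: EFin_inj; rewrite EFinD -!nintE//; last 2 first.
- exact: intg_sub Ig.
- exact: intg_sub Ig.
have [eab|ltab] := eqVneq a b.
  by rewrite -eab (@itvoo0 a a)// /intnorm integral_set0 add0e.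
have [ebc|ltbc] := eqVneq b c.
  by rewrite -ebc (@itvoo0 b b)// /intnorm integral_set0 adde0.
have {}ltab : a < b by rewrite lt_neqAle ltab.
have {}ltbc : b < c by rewrite lt_neqAle ltbc.
rewrite /intnorm (@itv_bndbnd_setU _ _ _ (BLeft b)); last 2 first.
- by rewrite bnd_simp.
- by rewrite bnd_simp.
rewrite ge0_integral_setU//; last 2 first.
- exact: borel_strong_EFin.
- by apply/disj_setPS => t []; rewrite /= !in_itv /= => /andP[? ?] /andP[? ?]; lra.
rewrite -integral_itv_obnd_cbnd//; exact: borel_strong_EFin.
Qed.

Lemma nint_subset a b a' b' f : a <= a' -> a' <= b' -> b' <= b -> intg a b f ->
  nint a' b' f <= nint a b f.
Proof.
move=> h1 h2 h3 If; rewrite (@nint_split a a' b)//; last exact: le_trans h3.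
rewrite (@nint_split a' b' b)//; last exact: intg_sub If.
by rewrite addrCA lerDl addr_ge0// nint_ge0.
Qed.

Lemma nint_triangle a b f g : intg a b f -> intg a b g ->
  nint a b (fun t => f t + g t) <= nint a b f + nint a b g.
Proof.
move=> If Ig.
have [/(strongly_measurableP _ (mI a b))[f' bf ff] _] := If.
have [/(strongly_measurableP _ (mI a b))[g' bg gg] _] := Ig.
have Ifg := intgD If Ig.
rewrite -lee_fin EFinD -!nintE// (intnorm_ae _ ff)// (intnorm_ae _ gg)//.
rewrite (@intnorm_ae _ _ _ (fun t => f t + g t) (fun t => f' t + g' t))//.
  exact: intnormD.
by apply: filterS2 ff gg => t e1 e2 tab; rewrite e1// e2.
Qed.

Lemma intg_reflect c a b f : intg a b f -> intg (c - b) (c - a) (fun t => f (c - t)).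
Proof.
move=> If; have := bochner_integrable_reflect c (mI a b) If.
by rewrite reflect_itv.
Qed.

Lemma bint_reflect c a b f : intg a b f -> bint (c - b) (c - a) (fun t => f (c - t)) = bint a b f.
Proof.
move=> If; have := bochner_reflect c (mI a b) (mu_itvoo a b) If.
by rewrite reflect_itv.
Qed.

Lemma bint_shift (h : R) a b f : intg (a + h) (b + h) f ->
  bint a b (fun t => f (t + h)) = bint (a + h) (b + h) f.
Proof.
move=> If; rewrite -(bint_reflect h If) -(bint_reflect 0 (intg_reflect h If)).
rewrite (_ : 0 - (h - (a + h)) = a); last by ring.
rewrite (_ : 0 - (h - (b + h)) = b); last by ring.
by apply: bint_eq => t _; congr f; ring.
Qed.

Lemma bint_cst a b (x : V) : a <= b -> bint a b (fun=> x) = (b - a) *: x.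
Proof.
move=> ab; apply: has_bochner_integralP => //; first exact: mu_itvoo.
exists (fun _ _ => x); split.
- by move=> n; exact: fsimple_cst.
- by apply: nearW => t _; exact: cvg_cst.
- rewrite (_ : (fun n => _) = (fun=> 0%E)); first exact: cvg_cst.
  apply/funext => n; rewrite /= subrr /rnorm /= normr0; exact: integral0.
- rewrite (_ : (fun n => _) = (fun=> (b - a) *: x)); first exact: cvg_cst.
  apply/funext => _; rewrite /simple_integral.
  have -> : range (fun _ : R => x) = [set x].
    by apply/seteqP; split=> [_ [t _ <-]//|_ ->]; exists 0.
  rewrite fsbig_set1 (_ : _ @^-1` _ = setT) ?setIT; last exact/seteqP.
  rewrite lebesgue_measure_itv /= lte_fin; case: ifP => // /negbT; rewrite -leNgt => ba.
  by have -> : b - a = 0 by lra.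
Qed.

(** Absolute continuity of the integral: [f] is within [e / 2] in L^1 of a simple function, which is
    bounded by some [M] and so contributes at most [M] times the length. The length [d] is
    independent of the position of the subinterval. *)
Lemma nint_small a b f : intg a b f -> forall e, 0 < e ->
  exists2 d, 0 < d & forall a' b', a <= a' -> a' <= b' -> b' <= b -> b' - a' < d -> nint a' b' f < e.
Proof.
move=> If e e0; have e2 : 0 < e / 2 by rewrite divr_gt0.
have [fn [sf ff Iff Sf]] := bochnerP (mI a b) (mu_itvoo a b) If.
move/(cvge0P (fun n => intnorm_ge0 _ (fun t => (f t - fn n t)%R))) : Iff => /(_ _ e2) Iff.
have [n In] := filter_ex Iff.
have [M M0 fM] : exists2 M, 0 < M & forall t, `|fn n t| <= M.
  have [r rE] : exists r : seq V, range (fn n) = [set` r].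
    by apply/finite_seqP; case: (sf n).
  exists (1 + \sum_(x <- r) `|x|) => [|t]; first by rewrite ltr_pwDl// sumr_ge0.
  have : fn n t \in r by rewrite -[is_true _]/([set` r] (fn n t)) -rE; exists t.
  elim: r {rE} => // x r IH; rewrite inE big_cons => /orP[/eqP->|/IH h].
    by rewrite addrCA lerDl addr_ge0// sumr_ge0.
  by rewrite addrCA; apply: le_trans h _; rewrite lerDr.
exists (e / 2 / M) => [|a' b' aa ab bb d]; first by rewrite divr_gt0.
have Ifn : intg a b (fn n).
  by apply: (@intg_bounded _ _ _ M); [exact: borel_smeas (fsimple_borel (sf n))|exact: nearW].
have Isub := intgB If Ifn.
have -> : nint a' b' f = nint a' b' (fun t => fn n t + (f t - fn n t)).
  by apply: nint_ae; apply: nearW => t _; rewrite subrKC.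
apply: le_lt_trans (nint_triangle (intg_sub aa bb Ifn) (intg_sub aa bb Isub)) _.
rewrite (splitr e) ltr_leD//.
  apply: le_lt_trans (nint_bound (M := M) ab _) _; first exact: nearW.
  by move: d; rewrite ltr_pdivlMr// mulrC.
apply: le_trans (nint_subset aa ab bb Isub) _.
by rewrite -lee_fin -nintE// ltW.
Qed.

End IntervalIntegral.

Section IntervalIntegralMaps.
Context {R : realType} {V W : completeNormedModType R}.
Local Notation smeas := (@strongly_measurable R Reals V setT (@rnorm R Reals V)).
Implicit Types (f g : R -> V) (a b c : R).

Lemma bintE a b f : bint a b f = @bochner R Reals V `]a, b[ f.
Proof. by []. Qed.

Lemma intgP a b f : intg a b f <-> smeas `]a, b[ f /\ (intnorm `]a, b[ f < +oo)%E.
Proof. by []. Qed.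

Lemma intg_smeas a b f : intg a b f -> smeas `]a, b[ f.
Proof. by case. Qed.

Lemma intg_le a b f (h : R -> W) : smeas `]a, b[ f -> intg a b h ->
  {ae mu, forall t, a < t < b -> `|f t| <= `|h t|} -> intg a b f.
Proof. by move=> sf [_ Ih] fh; apply: (bochner_integrable_le _ sf Ih). Qed.

Lemma nint_le a b f (h : R -> W) : intg a b h ->
  {ae mu, forall t, a < t < b -> `|f t| <= `|h t|} -> nint a b f <= nint a b h.
Proof.
move=> [_ Ih] fh; have le : (intnorm `]a, b[ f <= intnorm `]a, b[ h)%E.
  exact: le_integral_ae.
have Ih' : intnorm `]a, b[ h \is a fin_num by rewrite ge0_fin_numE// intnorm_ge0.
apply: fine_le => //; rewrite ge0_fin_numE ?intnorm_ge0//.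
exact: le_lt_trans Ih.
Qed.

Lemma nintZ a b f (k : R) : intg a b f -> nint a b (fun t => k *: f t) = `|k| * nint a b f.
Proof.
move=> If; have mI : measurable (`]a, b[%classic : set R) by [].
have [/(strongly_measurableP _ mI)[g bg fg] _] := If.
have E : intnorm `]a, b[ (fun t => k *: f t) = (`|k|%:E * intnorm `]a, b[ f)%E.
  rewrite (intnorm_ae _ fg)// (@intnorm_ae _ _ _ _ (fun t => k *: g t)) ?intnormZ//.
  by apply: filterS fg => t fg tab; rewrite fg.
by apply: EFin_inj; rewrite EFinM -(nintE If) -E -nintE//; exact: intgZ.
Qed.

Lemma bint_op (L : V -> W) (M : R) a b f :
  (forall x y, L (x + y) = L x + L y) -> (forall k x, L (k *: x) = k *: L x) ->
  (forall x, `|L x| <= M * `|x|) -> intg a b f ->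
  intg a b (fun t => L (f t)) /\ bint a b (fun t => L (f t)) = L (bint a b f).
Proof. by move=> LD LZ LM If; apply: (bochner_op (M := M)) => //; exact: mu_itvoo. Qed.

Lemma weak_derivativeP tau f g : @weak_derivative R Reals V tau f g <->
  forall phi, test_function tau phi ->
  bint 0 tau (fun t => derive1 phi t *: f t) = - bint 0 tau (fun t => phi t *: g t).
Proof. by []. Qed.

End IntervalIntegralMaps.

Opaque bint nint intg.

(** * Calculus for vector-valued functions *)

Section Calculus.
Context {R : realType} {V : completeNormedModType R}.
Local Notation smeas := (@strongly_measurable R Reals V setT (@rnorm R Reals V)).
Implicit Types (f g u v : R -> V) (a b c : R).

Definition cts a b f := forall t, a <= t <= b -> forall e, 0 < e ->
  exists2 d, 0 < d & forall s, a <= s <= b -> `|s - t| < d -> `|f s - f t| < e.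

Lemma ctsP a b f : {within `[a, b], continuous f} <-> cts a b f.
Proof.
rewrite subspace_continuousP; split=> H t tab.
  have := H t; rewrite /= in_itv /= => /(_ tab) /cvgrPdist_lt c e e0.
  have := c e e0; rewrite /prop_near1 /within /= => /nbhs_ballP[d /= d0 hd].
  exists d => // s sab st; rewrite distrC; apply: hd.
    by rewrite -ball_normE /= distrC.
  by rewrite /= in_itv.
apply/cvgrPdist_lt => e e0; move: tab; rewrite /= in_itv /= => tab.
have [d d0 hd] := H t tab e e0.
rewrite /prop_near1 /within /=; apply/nbhs_ballP; exists d => //= s.
by rewrite -ball_normE /= in_itv /= => st sab; rewrite distrC; apply: hd => //; rewrite distrC.
Qed.

Lemma cts_sub a b a' b' f : a <= a' -> b' <= b -> cts a b f -> cts a' b' f.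
Proof.
move=> aa bb cf t tab e e0.
have [|d d0 hd] := cf t _ e e0; first by lra.
by exists d => // s sab; apply: hd; lra.
Qed.

Lemma cts_eq a b f g : (forall t, a <= t <= b -> f t = g t) -> cts a b f -> cts a b g.
Proof.
move=> fg cf t tab e e0; have [d d0 hd] := cf t tab e e0.
by exists d => // s sab st; rewrite -!fg//; exact: hd.
Qed.

Lemma cts_bounded a b f : cts a b f -> exists2 M, 0 <= M & forall t, a <= t <= b -> `|f t| <= M.
Proof.
move=> /ctsP cf.
have := compact_bounded (continuous_compact cf (@segment_compact _ a b)).
move=> [M [Mr HM]]; exists (`|M| + 1); first by rewrite addr_ge0.
move=> t tab; apply: (HM (`|M| + 1)); first by rewrite (le_lt_trans (ler_norm M))// ltrDl.
by exists t => //=; rewrite in_itv.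
Qed.

Lemma cts_seq a b f (rn : nat -> R) t : cts a b f -> (forall n, a <= rn n <= b) ->
  a <= t <= b -> rn n @[n --> \oo] --> t -> f (rn n) @[n --> \oo] --> f t.
Proof.
move=> cf rnab tab rnt; apply/cvgrPdist_lt => e e0.
have [d d0 hd] := cf t tab e e0.
move/cvgrPdist_lt : rnt => /(_ _ d0); apply: filterS => n rd.
by rewrite distrC; apply: hd => //; rewrite distrC.
Qed.

Lemma cts_smeas a b f : cts a b f -> smeas `]a, b[ f.
Proof.
move=> cf; apply: (@smeas_continuous_comp _ _ V a b (fun t _ => f t) (fun=> 0)).
  move=> rn xn t x rnab tab rnt _; apply: (cts_seq cf) => //; last by lra.
  by move=> n; have := rnab n; lra.
exact: smeas_cst.
Qed.

Lemma cts_intg a b f : cts a b f -> intg a b f.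
Proof.
move=> cf; have [M M0 fM] := cts_bounded cf.
apply: (@intg_bounded _ _ _ _ _ M); first exact: cts_smeas.
by apply: nearW => t tab; apply: fM; lra.
Qed.

Lemma ctsDZ a b f g (k : R) : cts a b f -> cts a b g -> cts a b (fun t => f t + k *: g t).
Proof.
move=> cf cg t tab e e0.
have e2 : 0 < e / 2 by rewrite divr_gt0.
have k0 : 0 < `|k| + 1 by rewrite ltr_wpDl.
have e2k : 0 < e / 2 / (`|k| + 1) by rewrite divr_gt0.
have [d d0 hd] := cf t tab _ e2; have [d' d'0 hd'] := cg t tab _ e2k.
exists (Num.min d d'); first by rewrite lt_min d0.
move=> s sab; rewrite lt_min => /andP[st st'].
rewrite opprD addrACA -scalerBr; apply: le_lt_trans (ler_normD _ _) _.
rewrite (splitr e); apply: ltrD; first exact: hd.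
rewrite normrZ; have := hd' s sab st'; rewrite ltr_pdivlMr//.
by apply: le_lt_trans; rewrite mulrC ler_wpM2l// lerDl.
Qed.

Lemma ctsB a b f g : cts a b f -> cts a b g -> cts a b (fun t => f t - g t).
Proof.
by move=> cf cg; have := ctsDZ (-1) cf cg; apply: cts_eq => t _; rewrite scaleN1r.
Qed.

Lemma lip_cts a b f (M : R) : (forall s t, a <= s -> s <= t -> t <= b -> `|f t - f s| <= M * (t - s)) ->
  cts a b f.
Proof.
move=> Mf t tab e e0; have M0 : 0 < `|M| + 1 by rewrite ltr_wpDl.
exists (e / (`|M| + 1)); first by rewrite divr_gt0.
move=> s sab; rewrite ltr_pdivlMr// => st; apply: le_lt_trans st.
have [ts|ts] := leP t s.
  apply: le_trans (Mf t s _ ts _) _; [lra|lra|].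
  rewrite ger0_norm ?subr_ge0// mulrC ler_wpM2l ?subr_ge0//.
  by apply: le_trans (ler_norm M) _; rewrite lerDl.
rewrite distrC; apply: le_trans (Mf s t _ (ltW ts) _) _; [lra|lra|].
rewrite ltr0_norm ?subr_lt0// opprB mulrC ler_wpM2l ?subr_ge0 1?ltW//.
by apply: le_lt_trans (ler_norm M) _; rewrite ltrDl.
Qed.

Lemma bint_cts a b v : intg a b v -> cts a b (fun t => bint a t v).
Proof.
move=> Iv t tab e e0; have [d d0 hd] := nint_small Iv e0.
exists d => // s sab; have [ts|ts] := leP t s.
  rewrite ger0_norm ?subr_ge0// => std.
  rewrite (@bint_split _ _ a t s)//; [|lra|by apply: intg_sub Iv; lra].
  rewrite addrAC subrr add0r; apply: le_lt_trans (bint_norm _) (hd _ _ _ ts _ std); try lra.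
  by apply: intg_sub Iv; lra.
rewrite ltr0_norm ?subr_lt0// opprB => std.
rewrite (@bint_split _ _ a s t)//; [|lra|lra|by apply: intg_sub Iv; lra].
rewrite opprD addrA subrr add0r normrN.
apply: le_lt_trans (bint_norm _) (hd _ _ _ (ltW ts) _ std); try lra.
by apply: intg_sub Iv; lra.
Qed.

(** For slope [K + e], the supremum [c] of the points up to which the bound holds is attained by
    continuity, and the right difference quotient at [c] would carry the bound beyond it if [c < b].
    No linear functionals are involved. *)
Lemma mean_value_inequality a b f (K : R) : a <= b -> cts a b f ->
  (forall t, a <= t < b -> forall e, 0 < e -> exists2 d, 0 < d &
    forall h, 0 < h < d -> t + h <= b -> `|f (t + h) - f t| <= (K + e) * h) ->
  `|f b - f a| <= K * (b - a).
Proof.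
move=> ab cf df.
suff H e : 0 < e -> `|f b - f a| <= (K + e) * (b - a).
  apply/ler_addgt0Pr => e e0; have ba0 : 0 < b - a + 1 by lra.
  have e1 : 0 < e / (b - a + 1) by rewrite divr_gt0.
  apply: le_trans (H _ e1) _; rewrite mulrDl lerD2l mulrAC ler_pdivrMr//.
  by nra.
move=> e0; pose P t := forall s, a <= s <= t -> `|f s - f a| <= (K + e) * (s - a).
pose S := [set t | a <= t <= b /\ P t].
have Sa : S a.
  split; first by rewrite lexx.
  move=> s /andP[h1 h2]; have -> : s = a by lra.
  by rewrite !subrr normr0 mulr0.
have hS : has_sup S by split; [exists a|exists b => t [/andP[]]].
pose c := sup S.
have ac : a <= c by exact: sup_upper_bound.
have cb : c <= b by apply: ge_sup; [exists a|move=> t [/andP[]]].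
have Pl s : a <= s < c -> `|f s - f a| <= (K + e) * (s - a).
  move=> /andP[as_ sc]; have cs0 : 0 < c - s by lra.
  have [t [_ Pt] st] := sup_adherent cs0 hS.
  by apply: Pt; rewrite as_ /=; rewrite -/c in st; lra.
have Pc : P c.
  move=> s /andP[as_]; rewrite le_eqVlt => /predU1P[->|sc]; last by apply: Pl; rewrite as_.
  have [->|] := eqVneq a c; first by rewrite !subrr normr0 mulr0.
  move=> anc; have {anc} altc : a < c by rewrite lt_neqAle anc.
  apply/ler_addgt0Pr => e1 e10.
  have e12 : 0 < e1 / 2 by rewrite divr_gt0.
  have k0 : 0 < `|K + e| + 1 by rewrite ltr_wpDl.
  have [|d d0 hd] := cf c _ _ e12; first by lra.
  (* The bound passes from [c - r] to [c]. The three terms make the jump of [f] at most [e1 / 2],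
     keep [c - r] in the interval, and absorb [(K + e) * r], whose sign is unknown. *)
  pose r := Num.min (d / 2) (Num.min (c - a) (e1 / 2 / (`|K + e| + 1))).
  have r0 : 0 < r by rewrite !lt_min !divr_gt0//= subr_gt0 altc.
  have rd : r <= d / 2 by rewrite ge_min lexx.
  have rc : r <= c - a by rewrite !ge_min lexx orbT.
  have re : r <= e1 / 2 / (`|K + e| + 1) by rewrite !ge_min lexx !orbT.
  have h1 : `|f (c - r) - f c| < e1 / 2.
    apply: hd; first by lra.
    by rewrite addrAC subrr add0r normrN gtr0_norm//; lra.
  have h2 : `|f (c - r) - f a| <= (K + e) * (c - r - a) by apply: Pl; lra.
  have h3 : - ((K + e) * r) <= e1 / 2.
    apply: le_trans (ler_norm _) _; rewrite normrN normrM (gtr0_norm r0).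
    move: re; rewrite ler_pdivlMr// => re; apply: le_trans re.
    by rewrite mulrC ler_wpM2l 1?ltW// ltrDl.
  rewrite -(subrKA (f (c - r))); apply: le_trans (ler_normD _ _) _.
  by rewrite distrC; nra.
have [<-|cnb] := eqVneq c b; first by apply: Pc; rewrite ac lexx.
have cltb : c < b by rewrite lt_neqAle cnb.
have [|d d0 hd] := df c _ _ e0; first by rewrite ac.
pose r := Num.min (d / 2) (b - c).
have r0 : 0 < r by rewrite lt_min divr_gt0//= subr_gt0.
have rd : r <= d / 2 by rewrite ge_min lexx.
have rc : r <= b - c by rewrite ge_min lexx orbT.
have : S (c + r).
  split; first by lra.
  move=> s /andP[as_ sr]; have [sc|cs] := leP s c; first by apply: Pc; rewrite as_.
  have h1 := Pc c; rewrite ac lexx in h1; have {}h1 := h1 isT.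
  have h2 : `|f (c + (s - c)) - f c| <= (K + e) * (s - c) by apply: hd; lra.
  rewrite (_ : c + (s - c) = s) in h2; last by ring.
  rewrite -(subrKA (f c)); apply: le_trans (ler_normD _ _) _.
  by nra.
move=> /(sup_upper_bound hS); rewrite -/c; lra.
Qed.

Definition right_deriv a b f g := forall t, a <= t < b -> forall e, 0 < e -> exists2 d, 0 < d &
  forall h, 0 < h < d -> t + h <= b -> `|f (t + h) - f t - h *: g t| <= e * h.

Lemma right_deriv_bint a b g : cts a b g -> right_deriv a b (fun t => bint a t g) g.
Proof.
move=> cg t tab e e0; have Ig := cts_intg cg.
have [|d d0 hd] := cg t _ e e0; first by lra.
exists d => // h /andP[h0 hd'] thb.
rewrite (@bint_split _ _ a t (t + h)); [|lra|lra|by apply: intg_sub Ig; lra].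
rewrite (addrC (bint a t g)) addrK.
have -> : h *: g t = bint t (t + h) (fun=> g t).
  by rewrite bint_cst; [congr (_ *: _); ring|lra].
have It : intg t (t + h) g by apply: intg_sub Ig; lra.
rewrite -bintB//; last exact: intg_cst.
apply: le_trans (bint_norm (intgB It (intg_cst _ _ _))) _.
rewrite {2}(_ : h = t + h - t); last by ring.
apply: nint_bound; first by lra.
apply: nearW => s /andP[h1 h2]; apply/ltW/hd; first by lra.
by rewrite ger0_norm; lra.
Qed.

(** The difference of [f] and the primitive of [g] has right derivative 0, hence is constant by the
    mean value inequality with [K = 0]. *)
Lemma fundamental_theorem a b f g : a <= b -> cts a b f -> cts a b g ->
  right_deriv a b f g -> f b - f a = bint a b g.
Proof.
move=> ab cf cg fg; have Ig := cts_intg cg.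
have gg := right_deriv_bint cg.
pose H t := f t - bint a t g.
have cH : cts a b H by apply: ctsB => //; exact: bint_cts.
suff : `|H b - H a| <= 0 * (b - a).
  rewrite mul0r normr_le0 /H (@bint_empty _ _ a a)// subr0 => /eqP h.
  by apply/eqP; rewrite -subr_eq0 addrAC h.
apply: mean_value_inequality => // t tab e e0.
have e2 : 0 < e / 2 by rewrite divr_gt0.
have [d d0 hd] := fg t tab _ e2; have [d' d'0 hd'] := gg t tab _ e2.
exists (Num.min d d'); first by rewrite lt_min d0.
move=> h /andP[h0]; rewrite lt_min => /andP[hd1 hd2] thb.
have h1 := hd h; rewrite h0 hd1 in h1; have {}h1 := h1 isT thb.
have h2 := hd' h; rewrite h0 hd2 in h2; have {}h2 := h2 isT thb.
rewrite add0r (splitr e) mulrDl.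
rewrite (_ : H (t + h) - H t = f (t + h) - f t - h *: g t -
  (bint a (t + h) g - bint a t g - h *: g t)).
  by apply: le_trans (ler_normB _ _) _; exact: lerD.
by rewrite /H [in RHS]opprB subrKA opprD addrACA -opprD.
Qed.

(** Cutting [[a, b]] into [n.+1] equal pieces and adding up bounds [Delta a b] by
    [C * ((b - a) / n.+1%:R) * m a b], for every [n]. It replaces differentiation where a function
    is only absolutely continuous. *)
Lemma additive_zero a b (Delta : R -> R -> V) (m : R -> R -> R) (C : R) : a <= b -> 0 <= C ->
  (forall r s t, a <= r -> r <= s -> s <= t -> t <= b -> Delta r t = Delta r s + Delta s t) ->
  (forall r s t, a <= r -> r <= s -> s <= t -> t <= b -> m r t = m r s + m s t) ->
  (forall r s, a <= r -> r <= s -> s <= b -> `|Delta r s| <= C * (s - r) * m r s) ->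
  Delta a b = 0.
Proof.
move=> ab C0 DD mm Dm.
suff H (n : nat) : `|Delta a b| <= C * ((b - a) / n.+1%:R) * m a b.
  apply/normr0_eq0/le_anti; rewrite normr_ge0 andbT; apply/ler_addgt0Pr => e e0.
  pose K := `|C * (b - a) * m a b| + 1.
  have K0 : 0 < K by rewrite /K ltr_wpDl.
  pose n := Num.truncn (K / e).
  apply: le_trans (H n) _; rewrite add0r mulrA mulrAC ler_pdivrMr//.
  have := truncnS_gt (K / e); rewrite -/n ltr_pdivrMr// => hn.
  rewrite (mulrC e); apply/ltW; apply: le_lt_trans hn.
  by apply: le_trans (ler_norm _) _; rewrite lerDl.
pose d := (b - a) / n.+1%:R.
have d0 : 0 <= d by rewrite divr_ge0// subr_ge0.
have bE : a + d * n.+1%:R = b by rewrite mulfVK ?pnatr_eq0// subrKC.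
suff : forall k, (k <= n.+1)%N -> `|Delta a (a + d * k%:R)| <= C * d * m a (a + d * k%:R).
  by move=> /(_ n.+1 (leqnn _)); rewrite bE.
have mono k : (k <= n.+1)%N -> a + d * k%:R <= b.
  by move=> kn; rewrite -bE lerD2l ler_wpM2l// ler_nat.
have ge k : a <= a + d * k%:R by rewrite lerDl mulr_ge0.
elim=> [_|k IH kn].
  rewrite mulr0 addr0; have := Dm a a (lexx a) (lexx a) ab; rewrite subrr mulr0 mul0r => D0.
  have := mm a a a (lexx _) (lexx _) (lexx _) ab => maa.
  have -> : m a a = 0 by lra.
  by rewrite mulr0.
have le : a + d * k%:R <= a + d * k.+1%:R by rewrite lerD2l ler_wpM2l// ler_nat.
rewrite (DD a _ _ (lexx a) (ge k) le (mono _ kn)) (mm a _ _ (lexx a) (ge k) le (mono _ kn)).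
apply: le_trans (ler_normD _ _) _; rewrite mulrDr; apply: lerD; first exact/IH/ltnW.
apply: le_trans (Dm _ _ (ge k) le (mono _ kn)) _.
rewrite (_ : a + d * k.+1%:R - (a + d * k%:R) = d)// -natr1; ring.
Qed.

(** The defect of the formula on [[s, t]] is additive and of second order, at most [2 * L * (t - s)]
    times the integral of [|v|], so [additive_zero] removes it. The families used are multiplication
    by a test function, which gives integration by parts, and [r |-> T (t - r)], which gives
    variation of constants. *)
Lemma product_rule a b (B B' : R -> V -> V) u v (L : R) : a <= b -> 0 <= L ->
  (forall r x y, a <= r <= b -> B r (x + y) = B r x + B r y) ->
  (forall r k x, a <= r <= b -> B r (k *: x) = k *: B r x) ->
  (forall r x y, a <= r <= b -> B' r (x - y) = B' r x - B' r y) ->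
  (forall r x, a <= r <= b -> `|B r x| <= L * `|x|) ->
  (forall r x, a <= r <= b -> `|B' r x| <= L * `|x|) ->
  (forall r s x, a <= r -> r <= s -> s <= b -> `|B s x - B r x| <= L * (s - r) * `|x|) ->
  (forall x, cts a b (B'^~ x)) ->
  (forall r s x, a <= r -> r <= s -> s <= b -> B s x - B r x = bint r s (B'^~ x)) ->
  intg a b v ->
  (forall r s, a <= r -> r <= s -> s <= b -> u s - u r = bint r s v) ->
  intg a b (fun r => B r (v r)) /\ intg a b (fun r => B' r (u r)) /\
  B b (u b) - B a (u a) = bint a b (fun r => B r (v r) + B' r (u r)).
Proof.
move=> ab L0 BD BZ B'B BM B'M BL B'c BE Iv uv.
have BB r x y : a <= r <= b -> B r (x - y) = B r x - B r y.
  by move=> rab; rewrite BD// -scaleN1r BZ// scaleN1r.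
have cu : cts a b u.
  apply: (@cts_eq _ _ (fun t => u a + 1 *: bint a t v)).
    by move=> t tab; rewrite scale1r -uv; [rewrite subrKC|lra..].
  apply: ctsDZ; last exact: bint_cts.
  by apply: (@lip_cts _ _ _ 0) => s t _ _ _; rewrite subrr normr0 mul0r.
have I1 : intg a b (fun r => B r (v r)).
  have IL := intgZ L Iv.
  apply: (intg_le _ IL); last first.
    by apply: nearW => t tab; rewrite normrZ ger0_norm//; apply: BM; lra.
  apply: (@smeas_continuous_comp _ _ V a b B v); last exact: intg_smeas.
  move=> rn xn t x rnab tab rnt xnx; apply/cvgrPdist_lt => e e0.
  have e1 : 0 < e / (2 * (L + `|x| + 1)).
    by rewrite divr_gt0// mulr_gt0// ltr_wpDl// addr_ge0.
  have e2 : 0 < e / (2 * (L * `|x| + 1)).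
    by rewrite divr_gt0// mulr_gt0// ltr_wpDl// mulr_ge0.
  have e3 : 0 < e / (2 * (L + 1)) by rewrite divr_gt0// mulr_gt0// ltr_wpDl.
  move/cvgrPdist_lt : rnt => /(_ _ e2) c1.
  move/cvgrPdist_lt : xnx => /(_ _ e3) c2.
  apply: filterS2 c1 c2 => n; rewrite !ltr_pdivlMr ?mulr_gt0 ?ltr_wpDl ?mulr_ge0//.
  move=> c1 c2; have rn_ab := rnab n.
  have h1 : `|B t x - B (rn n) x| <= L * `|t - rn n| * `|x|.
    have [l|l] := leP t (rn n).
      by rewrite distrC (distrC t) (ger0_norm (_ : 0 <= rn n - t)) ?subr_ge0//; apply: BL; lra.
    by rewrite (gtr0_norm (_ : 0 < t - rn n)) ?subr_gt0//; apply: BL; lra.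
  have h2 : `|B (rn n) x - B (rn n) (xn n)| <= L * `|x - xn n|.
    by rewrite -BB; [apply: BM|]; lra.
  rewrite -(subrKA (B (rn n) x)); apply: le_lt_trans (ler_normD _ _) _.
  have := normr_ge0 (t - rn n); have := normr_ge0 (x - xn n); have := normr_ge0 x.
  by nra.
have [Mu Mu0 hMu] := cts_bounded cu.
have I2 : intg a b (fun r => B' r (u r)).
  apply: (@intg_bounded _ _ _ _ _ (L * Mu)); last first.
    apply: nearW => t tab; apply: le_trans (B'M _ _ _) _; first by lra.
    by apply: ler_wpM2l => //; apply: hMu; lra.
  apply: (@smeas_continuous_comp _ _ V a b (fun r _ => B' r (u r)) (fun=> 0)); last exact: smeas_cst.
  move=> rn xn t x rnab tab rnt _; apply/cvgrPdist_lt => e e0.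
  have e1 : 0 < e / (2 * (L + 1)) by rewrite divr_gt0// mulr_gt0// ltr_wpDl.
  have e2 : 0 < e / 2 by rewrite divr_gt0.
  have rnab' n : a <= rn n <= b by have := rnab n; lra.
  have tab' : a <= t <= b by lra.
  move/cvgrPdist_lt : (cts_seq cu rnab' tab' rnt) => /(_ _ e1) c1.
  move/cvgrPdist_lt : (cts_seq (B'c (u t)) rnab' tab' rnt) => /(_ _ e2) c2.
  apply: filterS2 c1 c2 => n; rewrite ltr_pdivlMr ?mulr_gt0 ?ltr_wpDl// => c1 c2.
  rewrite -(subrKA (B' (rn n) (u t))); apply: le_lt_trans (ler_normD _ _) _.
  rewrite -B'B//; have := B'M (rn n) (u t - u (rn n)) (rnab' n).
  have := normr_ge0 (u t - u (rn n)).
  by nra.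
split=> //; split=> //.
have IF := intgD I1 I2.
pose F r := B r (v r) + B' r (u r).
pose Delta s t := B t (u t) - B s (u s) - bint s t F.
suff : Delta a b = 0 by move=> /eqP; rewrite subr_eq0 => /eqP.
apply: (@additive_zero a b Delta (fun s t => nint s t v) (2 * L)) => //.
- by rewrite mulr_ge0.
- move=> r s t ar rs st tb; rewrite /Delta (@bint_split _ _ r s t)//; last by apply: intg_sub IF; lra.
  by rewrite opprD [RHS]addrACA [in RHS](addrC (_ - _)) subrKA.
- by move=> r s t ar rs st tb; apply: nint_split => //; apply: intg_sub Iv; lra.
move=> s t as_ st tb.
have Ivs : intg s t v by apply: intg_sub Iv; lra.
have sab : a <= s <= b by lra.
have tab : a <= t <= b by lra.
have [IBt EBt] := bint_op (fun x y => BD t x y tab) (fun k x => BZ t k x tab) (fun x => BM t x tab) Ivs.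
have I1s : intg s t (fun r => B r (v r)) by apply: intg_sub I1; lra.
have I2s : intg s t (fun r => B' r (u r)) by apply: intg_sub I2; lra.
have I3s : intg s t (B'^~ (u s)) by apply: cts_intg; apply: cts_sub (B'c (u s)); lra.
(* The increment is split as [B t (u t - u s)] plus [(B t - B s) (u s)]; writing both as integrals
   freezes [B] at [t] in the first and [u] at [s] in the second. *)
have -> : Delta s t = bint s t (fun r => B t (v r) - B r (v r)) +
    bint s t (fun r => B' r (u s) - B' r (u r)).
  rewrite !bintB//.
  rewrite EBt -uv// -BE// BB// /Delta [in LHS]bintD// opprD.
  by rewrite [RHS]addrACA subrKA.
have h1 : `|bint s t (fun r => B t (v r) - B r (v r))| <= L * (t - s) * nint s t v.
  apply: le_trans (bint_norm (intgB IBt I1s)) _.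
  have Ik := intgZ (L * (t - s)) Ivs.
  apply: le_trans (nint_le Ik _) _.
    apply: nearW => r /andP[r1 r2]; rewrite normrZ (ger0_norm (_ : 0 <= L * (t - s))) ?mulr_ge0 ?subr_ge0//.
    apply: le_trans (BL r t (v r) _ _ tb) _; [lra|lra|].
    by rewrite ler_wpM2r// ler_wpM2l//; lra.
  by rewrite nintZ// ger0_norm// mulr_ge0// subr_ge0.
have h2 : `|bint s t (fun r => B' r (u s) - B' r (u r))| <= L * nint s t v * (t - s).
  apply: le_trans (bint_norm (intgB I3s I2s)) _.
  apply: nint_bound => //; apply: nearW => r /andP[r1 r2].
  rewrite -B'B; last by lra.
  apply: le_trans (B'M _ _ _) _; first by lra.
  apply: ler_wpM2l => //; rewrite distrC uv; [|lra..].
  apply: le_trans (bint_norm _) _; first by apply: intg_sub Iv; lra.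
  by apply: (nint_subset _ _ _ Ivs); lra.
apply: le_trans (ler_normD _ _) _; apply: le_trans (lerD h1 h2) _.
rewrite le_eqVlt; apply/orP; left; apply/eqP; ring.
Qed.

Lemma cts_scale a b (k : R -> R) f : continuous k -> cts a b f -> cts a b (fun t => k t *: f t).
Proof.
move=> ck /ctsP cf; apply/ctsP => t.
by apply: cvgZ; [exact: (continuous_subspaceT ck)|exact: cf].
Qed.

Lemma cts_add a b f g : cts a b f -> cts a b g -> cts a b (fun t => f t + g t).
Proof.
move=> cf cg; apply: (@cts_eq a b (fun t => f t + 1 *: g t)); last exact: ctsDZ.
by move=> t _; rewrite scale1r.
Qed.

End Calculus.

(** * Weak derivatives *)

Section Bump.
Context {R : realType}.
Implicit Types (x y h t : R).

Definition pos_part x : R := Num.max 0 x.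

Lemma pos_part_sq x h :
  `|pos_part (x + h) ^+ 2 - pos_part x ^+ 2 - h * (2 * pos_part x)| <= h ^+ 2.
Proof.
rewrite /pos_part ler_norml; case: (leP 0 x) => x0; case: (leP 0 (x + h)) => xh0;
  apply/andP; split; nra.
Qed.

Lemma pos_part_lip x y : `|pos_part x - pos_part y| <= `|x - y|.
Proof.
rewrite /pos_part; case: (leP 0 x) => x0; case: (leP 0 y) => y0 //.
- by rewrite subr0 (ger0_norm x0); apply: le_trans (ler_norm _); lra.
- by rewrite sub0r normrN (ger0_norm y0) distrC; apply: le_trans (ler_norm _); lra.
- by rewrite subrr normr0.
Qed.

(** A quadratic spline of class C^1 that climbs from 0 at [x <= 0] to 1 at [x >= 2]; its derivative
    is [tent], the hat on [[0, 2]] with peak 1 at 1 and integral 1. Written with truncated powers,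
    both inherit their estimates from [pos_part]. *)
Definition smooth_step x : R :=
  (pos_part x ^+ 2 - 2 * pos_part (x - 1) ^+ 2 + pos_part (x - 2) ^+ 2) / 2.

Definition tent x : R := pos_part x - 2 * pos_part (x - 1) + pos_part (x - 2).

(** The truncated squares carry weights 1, 2 and 1, and half of the sum is the constant 2. The same
    weights, unhalved, give the 4 in [tent_lip]. *)
Lemma smooth_step_deriv x h :
  `|smooth_step (x + h) - smooth_step x - h * tent x| <= 2 * h ^+ 2.
Proof.
have := pos_part_sq x h; have := pos_part_sq (x - 1) h; have := pos_part_sq (x - 2) h.
rewrite /smooth_step /tent (addrAC x h) (addrAC x h (- 2)).
move: (pos_part (x + h)) (pos_part (x - 1 + h)) (pos_part (x - 2 + h)) => a b c.
move: (pos_part x) (pos_part (x - 1)) (pos_part (x - 2)) => a' b' c'.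
rewrite !ler_norml => /andP[? ?] /andP[? ?] /andP[? ?]; apply/andP; split; lra.
Qed.

Lemma smooth_step0 x : x <= 0 -> smooth_step x = 0.
Proof.
move=> x0; rewrite /smooth_step /pos_part.
rewrite !max_l; lra.
Qed.

Lemma smooth_step1 x : 2 <= x -> smooth_step x = 1.
Proof.
move=> x2; rewrite /smooth_step /pos_part.
by rewrite !max_r; [field|lra..].
Qed.

Lemma tent0 x : x <= 0 \/ 2 <= x -> tent x = 0.
Proof.
by case=> hx; rewrite /tent /pos_part; [rewrite !max_l|rewrite !max_r]; lra.
Qed.

Lemma tent_bound x : `|tent x| <= 1.
Proof.
rewrite /tent /pos_part ler_norml; apply/andP; split;
case: (leP 0 x) => h1; case: (leP 0 (x - 1)) => h2; case: (leP 0 (x - 2)) => h3; lra.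
Qed.

Lemma tent_lip x y : `|tent x - tent y| <= 4 * `|x - y|.
Proof.
have := pos_part_lip x y; have := pos_part_lip (x - 1) (y - 1); have := pos_part_lip (x - 2) (y - 2).
rewrite (_ : x - 1 - (y - 1) = x - y); last by ring.
rewrite (_ : x - 2 - (y - 2) = x - y); last by ring.
rewrite /tent; move: (`|x - y|) => k.
rewrite !ler_norml => /andP[? ?] /andP[? ?] /andP[? ?]; apply/andP; split; lra.
Qed.

Lemma quadratic_is_derive (phi : R -> R) t d (K : R) :
  (forall h, `|phi (t + h) - phi t - h * d| <= K * h ^+ 2) -> is_derive t 1 phi d.
Proof.
move=> H; have c : (fun h => h^-1 *: (phi (h *: 1 + t) - phi t)) @ 0^' --> d.
  apply/cvgrPdist_lt => e e0; near=> h.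
  have h0 : h != 0 by near: h; exact: nbhs_dnbhs_neq.
  have K0 : 0 < `|K| + 1 by rewrite ltr_wpDl.
  have hK : `|h| < e / (`|K| + 1).
    near: h; apply: dnbhs0_lt; exact: divr_gt0.
  have -> : d - h^-1 *: (phi (h *: 1 + t) - phi t) = - (h^-1 * (phi (t + h) - phi t - h * d)).
    rewrite /GRing.scale /= mulr1 (addrC h t) [in RHS]mulrBr mulKf// opprB.
    by rewrite addrC.
  rewrite normrN normrM normfV ltr_pdivrMl ?normr_gt0//.
  apply: le_lt_trans (H h) _; rewrite -(real_normK (num_real h)) expr2 mulrCA.
  rewrite ltr_pM2l ?normr_gt0//.
  move: hK; rewrite ltr_pdivlMr// => hK; apply: le_lt_trans hK.
  by rewrite mulrC ler_wpM2l//; apply: le_trans (ler_norm K) _; rewrite lerDl.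
split; first by apply/cvg_ex; exists d.
exact: cvg_lim.
Unshelve. all: by end_near. Qed.

Definition bump (a b eta t : R) : R := smooth_step ((t - a) / eta) - smooth_step ((t - b) / eta).
Definition dbump (a b eta t : R) : R := (tent ((t - a) / eta) - tent ((t - b) / eta)) / eta.

Lemma bump_is_derive a b eta t : 0 < eta -> is_derive t 1 (bump a b eta) (dbump a b eta t).
Proof.
move=> eta0; apply: (@quadratic_is_derive _ _ _ (4 / eta ^+ 2)) => h.
have E c : (t + h - c) / eta = (t - c) / eta + h / eta by rewrite -mulrDl addrAC.
have := smooth_step_deriv ((t - a) / eta) (h / eta).
have := smooth_step_deriv ((t - b) / eta) (h / eta).
rewrite /bump /dbump !E.
move: (smooth_step _) (smooth_step _) (smooth_step _) (smooth_step _) (tent _) (tent _).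
move=> s1 s2 s3 s4 t1 t2.
rewrite (_ : h * ((t1 - t2) / eta) = h / eta * t1 - h / eta * t2); last by ring.
rewrite (_ : 4 / eta ^+ 2 * h ^+ 2 = 4 * (h / eta) ^+ 2); last by rewrite expr_div_n; ring.
move: (h / eta) => k; rewrite !ler_norml => /andP[? ?] /andP[? ?]; apply/andP; split; lra.
Qed.

Lemma dbump_continuous a b eta : 0 < eta -> continuous (dbump a b eta).
Proof.
move=> eta0 t; apply/cvgrPdist_lt => e e0.
have e1 : 0 < e * eta ^+ 2 / 8 by rewrite divr_gt0// mulr_gt0// exprn_gt0.
apply/nbhs_ballP; exists (e * eta ^+ 2 / 8) => // s ts.
have {}ts : `|t - s| < e * eta ^+ 2 / 8 by exact: ts.
have := tent_lip ((t - a) / eta) ((s - a) / eta); have := tent_lip ((t - b) / eta) ((s - b) / eta).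
rewrite /dbump -!mulrBl.
rewrite (_ : t - a - (s - a) = t - s); last by ring.
rewrite (_ : t - b - (s - b) = t - s); last by ring.
rewrite !normrM normfV (gtr0_norm eta0) => h1 h2.
rewrite ltr_pdivrMr//.
have h3 : 8 * (`|t - s| / eta) < e * eta.
  by rewrite mulrA ltr_pdivrMr// -mulrA -expr2; lra.
move: h1 h2 h3; move: (`|t - s| / eta) => k.
move: (tent _) (tent _) (tent _) (tent _) => t1 t2 t3 t4.
rewrite !ler_norml ltr_norml => /andP[? ?] /andP[? ?] ?; apply/andP; split; lra.
Qed.

Lemma bump_test a b eta tau : 0 < eta -> 0 < a -> a < b -> b + 2 * eta < tau ->
  test_function tau (bump a b eta) /\ derive1 (bump a b eta) = dbump a b eta.
Proof.
move=> eta0 a0 ab btau.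
have dE : derive1 (bump a b eta) = dbump a b eta.
  by apply/funext => t; rewrite derive1E; have [_ ->] := bump_is_derive a b t eta0.
split=> //; split.
- by move=> t; have [] := bump_is_derive a b t eta0.
- by rewrite dE; exact: dbump_continuous.
exists a, (b + 2 * eta); split => // t nt; rewrite /bump.
have [ta|at_] := leP t a.
  by rewrite !smooth_step0 ?subrr// ler_pdivrMr// mul0r; lra.
rewrite !smooth_step1 ?subrr// ler_pdivlMr//.
  by rewrite leNgt; apply/negP => ?; apply: nt; apply/andP; split; lra.
by rewrite leNgt; apply/negP => ?; apply: nt; apply/andP; split; lra.
Qed.

End Bump.

(** * Weakly differentiable functions are primitives *)

Section WeakDerivative.
Context {R : realType} {V : completeNormedModType R}.
Implicit Types (u v z : R -> V) (tau : R).

Lemma derivable_right_deriv (phi : R -> R) (y : V) a b : (forall t, derivable phi t 1) ->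
  right_deriv a b (fun t => phi t *: y) (fun t => derive1 phi t *: y).
Proof.
move=> dphi t _ e e0.
have c : h^-1 *: (phi (h + t) - phi t) @[h --> 0^'] --> derive1 phi t.
  have := dphi t; rewrite /derivable /derive1.
  by under eq_fun do rewrite /= [_ *: 1]mulr1.
have y0 : 0 < `|y| + 1 by rewrite ltr_wpDl.
have e1 : 0 < e / (`|y| + 1) by rewrite divr_gt0.
move/cvgrPdist_lt : c => /(_ _ e1); rewrite /prop_near1 /= => /nbhs_ballP[d /= d0 hd].
exists d => // h /andP[h0 hdlt] _.
have := hd h; rewrite -ball_normE /= sub0r normrN gtr0_norm// => /(_ hdlt (lt0r_neq0 h0)).
rewrite distrC => H.
rewrite -scalerBl scalerA -scalerBl normrZ.
rewrite (_ : phi (t + h) - phi t - h * _ = h * (h^-1 *: (phi (h + t) - phi t) - derive1 phi t)); last first.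
  by rewrite mulrBr /GRing.scale /= mulVKf ?gt_eqF// (addrC t).
rewrite normrM (gtr0_norm h0) -mulrA (mulrC e); apply: ler_wpM2l; first exact: ltW.
move: H; rewrite ltr_pdivlMr// => H; apply: le_trans (ltW H).
by rewrite ler_wpM2l// lerDl.
Qed.

Lemma continuous_cts (f : R -> R) (y : V) a b : continuous f -> cts a b (fun t => f t *: y).
Proof.
move=> cf; apply/ctsP; apply: continuous_subspaceT => t.
by apply: cvgZl; exact: cf.
Qed.

Lemma test_ftc (phi : R -> R) (y : V) r s : (forall t, derivable phi t 1) ->
  continuous (derive1 phi) -> r <= s ->
  phi s *: y - phi r *: y = bint r s (fun t => derive1 phi t *: y).
Proof.
move=> dphi cphi rs.
apply: (@fundamental_theorem _ _ r s (fun t => phi t *: y) (fun t => derive1 phi t *: y)) => //.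
- apply: continuous_cts => t.
  by have /derivable1_diffP/differentiable_continuous := dphi t.
- exact: continuous_cts.
- exact: derivable_right_deriv.
Qed.

(** Integration by parts is the product rule for [phi t *: u t]; the boundary terms vanish because
    the support of [phi] lies inside []0, tau[]. *)
Lemma test_product (phi : R -> R) u v tau : 0 <= tau -> test_function tau phi ->
  intg 0 tau v ->
  (forall r s, 0 <= r -> r <= s -> s <= tau -> u s - u r = bint r s v) ->
  intg 0 tau (fun t => phi t *: v t) /\ intg 0 tau (fun t => derive1 phi t *: u t) /\
  bint 0 tau (fun t => derive1 phi t *: u t) = - bint 0 tau (fun t => phi t *: v t).
Proof.
move=> tau0 [dphi cphi [a [b [a0 btau supp]]]] Iv uv.
have phi0 : phi 0 = 0 by apply: supp => /andP[]; lra.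
have phit : phi tau = 0 by apply: supp => /andP[]; lra.
have cts1 (f : R -> R) : continuous f -> cts 0 tau (f : R -> R).
  by move=> cf; apply/ctsP; exact: continuous_subspaceT.
have cphi0 : continuous phi.
  by move=> t; have /derivable1_diffP/differentiable_continuous := dphi t.
have [M M0 hM] := cts_bounded (cts1 _ cphi0).
have [M' M'0 hM'] := cts_bounded (cts1 _ cphi).
have LM : M <= M + M' by lra. have LM' : M' <= M + M' by lra.
have := @product_rule R V 0 tau (fun t y => phi t *: y) (fun t y => derive1 phi t *: y) u v (M + M') tau0.
case => //.
- by rewrite addr_ge0.
- by move=> r x y _; rewrite scalerDr.
- by move=> r k x _; rewrite !scalerA mulrC.
- by move=> r x y _; rewrite scalerBr.
- by move=> r x rt; rewrite normrZ ler_wpM2r// (le_trans (hM _ rt)).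
- by move=> r x rt; rewrite normrZ ler_wpM2r// (le_trans (hM' _ rt)).
- move=> r s x r0 rs st; rewrite (test_ftc x dphi cphi rs).
  have I1 : intg r s (fun t => derive1 phi t *: x) by apply: cts_intg; exact: continuous_cts.
  apply: le_trans (bint_norm I1) _; rewrite mulrAC; apply: nint_bound => //.
  apply: nearW => t tr; rewrite normrZ ler_wpM2r// (le_trans (hM' _ _))//; lra.
- by move=> x; exact: continuous_cts.
- by move=> r s x r0 rs st; rewrite (test_ftc x dphi cphi rs).
move=> I1 [I2 E]; split; [exact: I1|split; [exact: I2|]].
move: E; rewrite phi0 phit !scale0r subrr (bintD I1 I2) => E.
by apply/eqP; rewrite -addr_eq0 addrC -E.
Qed.

Lemma ac_weak_derivative u v tau : 0 <= tau -> intg 0 tau v ->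
  (forall r s, 0 <= r -> r <= s -> s <= tau -> u s - u r = bint r s v) ->
  @weak_derivative R Reals V tau u v.
Proof.
move=> tau0 Iv uv; apply/weak_derivativeP => phi tphi.
by have [_ []] := test_product tau0 tphi Iv uv.
Qed.

(** The rescaled tent is a kernel of mass 1 on [[c, c + 2 * eta]], being the derivative of a step of
    height 1; averaging a continuous function against it recovers the value at [c]. *)
Lemma tent_average z tau c : cts 0 tau z -> 0 < c -> c < tau -> forall e, 0 < e ->
  exists2 d, 0 < d & forall eta, 0 < eta < d -> c + 2 * eta < tau ->
  intg 0 tau (fun t => (tent ((t - c) / eta) / eta) *: z t) /\
  `|bint 0 tau (fun t => (tent ((t - c) / eta) / eta) *: z t) - z c| <= e.
Proof.
move=> cz c0 ctau e e0.
have e2 : 0 < e / 2 by rewrite divr_gt0.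
have [|d d0 hd] := cz c _ _ e2; first by lra.
exists (d / 2); first by rewrite divr_gt0.
move=> eta /andP[eta0 etad] ceta.
pose k t := tent ((t - c) / eta) / eta.
have kc : continuous k.
  move=> t; apply/cvgrPdist_lt => e' e'0.
  have e1 : 0 < e' * eta ^+ 2 / 4 by rewrite divr_gt0// mulr_gt0// exprn_gt0.
  apply/nbhs_ballP; exists (e' * eta ^+ 2 / 4) => // s ts.
  have {}ts : `|t - s| < e' * eta ^+ 2 / 4 by exact: ts.
  have := tent_lip ((t - c) / eta) ((s - c) / eta).
  rewrite /k -!mulrBl (_ : t - c - (s - c) = t - s); last by ring.
  rewrite !normrM normfV (gtr0_norm eta0) => h1.
  rewrite ltr_pdivrMr//; apply: le_lt_trans h1 _.
  by rewrite mulrA ltr_pdivrMr// -mulrA -expr2; lra.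
have kz : cts 0 tau (fun t => k t *: z t).
  apply/ctsP/subspace_continuousP => t tab; apply: cvgZ.
    by apply: cvg_within_filter; exact: kc.
  by move/ctsP/subspace_continuousP : cz; exact.
have Ikz := cts_intg kz; split => //.
rewrite -/(k _) -[X in `|X - _|]/(bint 0 tau (fun t => k t *: z t)).
have Ikc : intg 0 tau (fun t => k t *: z c) by apply: cts_intg; exact: continuous_cts.
have E : bint 0 tau (fun t => k t *: z c) = z c.
  pose S t := smooth_step ((t - c) / eta).
  have dS (t : R) : is_derive t 1 S (k t).
    apply: (@quadratic_is_derive _ _ _ _ (2 / eta ^+ 2)) => h.
    rewrite /S /k (_ : (t + h - c) / eta = (t - c) / eta + h / eta); last by rewrite -mulrDl addrAC.
    have := smooth_step_deriv ((t - c) / eta) (h / eta).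
    rewrite (_ : 2 / eta ^+ 2 * h ^+ 2 = 2 * (h / eta) ^+ 2); last by rewrite expr_div_n; ring.
    by rewrite (_ : h * (tent _ / eta) = h / eta * tent ((t - c) / eta)); last by ring.
  have S'k : derive1 S = k by apply/funext => t; rewrite derive1E; have [_ ->] := dS t.
  rewrite -S'k -test_ftc.
  + rewrite /S smooth_step1; last by rewrite ler_pdivlMr//; lra.
    rewrite smooth_step0; last by rewrite ler_pdivrMr// mul0r; lra.
    by rewrite scale1r scale0r subr0.
  + by move=> t; have [] := dS t.
  + by rewrite S'k.
  + lra.
rewrite -E -bintB//.
have Id := intgB Ikz Ikc.
rewrite (@bint_split _ _ 0 c tau)//; [|lra..].
rewrite (@bint_split _ _ c (c + 2 * eta) tau)//; [|lra|lra|by apply: intg_sub Id; lra].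
have k0 t : t <= c \/ c + 2 * eta <= t -> k t = 0.
  move=> ht; rewrite /k tent0 ?mul0r//; case: ht => ht; [left|right].
    by rewrite ler_pdivrMr// mul0r; lra.
  by rewrite ler_pdivlMr//; lra.
rewrite (@bint_eq _ _ 0 c _ (fun=> 0)) ?bint0 ?add0r; last first.
  by move=> t tc; rewrite k0 ?scale0r ?subr0//; left; lra.
rewrite (@bint_eq _ _ (c + 2 * eta) tau _ (fun=> 0)) ?bint0 ?addr0; last first.
  by move=> t tc; rewrite k0 ?scale0r ?subr0//; right; lra.
apply: le_trans (bint_norm _) _; first by apply: intg_sub Id; lra.
(* The kernel is at most [1 / eta] on an interval of length [2 * eta], and [z] varies there by at
   most [e / 2]. *)
have -> : e = (e / 2 / eta) * (c + 2 * eta - c).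
  by field; rewrite gt_eqF.
apply: nint_bound; first lra.
apply: nearW => t /andP[t1 t2]; rewrite -scalerBr normrZ mulrC ler_pM//.
  by apply/ltW/hd; [lra|rewrite gtr0_norm; lra].
rewrite /k normrM normfV (gtr0_norm eta0) ler_pdivrMr// mulVf ?gt_eqF//.
exact: tent_bound.
Qed.

(* The test functions are bumps whose derivatives are narrow tents of integral 1
   and -1 at [r] and [s]. *)
Lemma weak_derivative_ac u v tau : 0 < tau -> cts 0 tau u -> intg 0 tau v ->
  @weak_derivative R Reals V tau u v ->
  forall r s, 0 <= r -> r <= s -> s <= tau -> u s - u r = bint r s v.
Proof.
move=> tau0 cu Iv /weak_derivativeP wd.
pose w t := bint 0 t v.
have wv r s : 0 <= r -> r <= s -> s <= tau -> w s - w r = bint r s v.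
  move=> r0 rs st; rewrite /w (@bint_split _ _ 0 r s)//; last by apply: intg_sub Iv; lra.
  by rewrite (addrC (bint 0 r v)) addrK.
(* By the argument of du Bois-Reymond, [z] has weak derivative 0 and must be constant. *)
pose z t := u t - w t.
have cz : cts 0 tau z by apply: ctsB => //; exact: bint_cts.
have zc a b : 0 < a -> a < b -> b < tau -> z a = z b.
  move=> a0 ab btau; apply/eqP; rewrite -subr_eq0 -normr_le0; apply/ler_addgt0Pr => e e0.
  have e2 : 0 < e / 2 by rewrite divr_gt0.
  have [|d d0 hd] := tent_average cz a0 _ e2; first by lra.
  have [d' d'0 hd'] := tent_average cz (lt_trans a0 ab) btau e2.
  pose eta := Num.min (d / 2) (Num.min (d' / 2) ((tau - b) / 4)).
  have eta0 : 0 < eta by rewrite !lt_min !divr_gt0//= subr_gt0.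
  have e_d : eta <= d / 2 by rewrite ge_min lexx.
  have e_d' : eta <= d' / 2 by rewrite !ge_min lexx orbT.
  have e_t : eta <= (tau - b) / 4 by rewrite !ge_min lexx !orbT.
  have ed : 0 < eta < d by lra.
  have ed' : 0 < eta < d' by lra.
  have ateta : a + 2 * eta < tau by lra.
  have bteta : b + 2 * eta < tau by lra.
  have [I1 h1] := hd _ ed ateta.
  have [I2 h2] := hd' _ ed' bteta.
  have [tf dE] := bump_test eta0 a0 ab bteta.
  have [J1 [J2 JE]] := test_product (ltW tau0) tf Iv wv.
  have := wd _ tf; rewrite -JE => K.
  (* The definition of the weak derivative for [u] and integration by parts for [w] have the same
     right-hand side, so the derivative of the bump integrates [z] to 0; this derivative is the
     difference of the two kernels. *)
  have Z : bint 0 tau (fun t => (tent ((t - a) / eta) / eta) *: z t) =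
           bint 0 tau (fun t => (tent ((t - b) / eta) / eta) *: z t).
    apply/eqP; rewrite -subr_eq0 -(bintB I1 I2); apply/eqP.
    have cdu : intg 0 tau (fun t => derive1 (bump a b eta) t *: u t).
      by case: tf => _ cb _; exact: cts_intg (cts_scale cb cu).
    rewrite (@bint_eq _ _ _ _ _ (fun t => derive1 (bump a b eta) t *: u t - derive1 (bump a b eta) t *: w t)).
      by rewrite (bintB cdu J2) K subrr.
    by move=> t _; rewrite dE -[RHS]scalerBr -scalerBl /dbump -mulrBl.
  rewrite add0r (splitr e) -(subrKA (bint 0 tau (fun t => (tent ((t - a) / eta) / eta) *: z t))).
  apply: le_trans (ler_normD _ _) _; rewrite distrC {2}Z; exact: (lerD h1 h2).
(* The kernels reach only interior points; the end points follow by continuity. *)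
have zE t : 0 <= t <= tau -> z t = z (tau / 2).
  have H s : 0 < s -> s < tau -> z s = z (tau / 2).
    move=> s0 st; have [st2|ts2|->//] := ltgtP s (tau / 2).
      by apply: zc => //; lra.
    by rewrite (zc (tau / 2) s)//; lra.
  move=> /andP[t0 tt].
  apply/eqP; rewrite -subr_eq0 -normr_le0; apply/ler_addgt0Pr => e e0; rewrite add0r.
  have [|d d0 hd] := cz t _ _ e0; first by rewrite t0.
  have [s [s0 st sd]] : exists s, [/\ 0 < s, s < tau & `|s - t| < d].
    have [th|th] := leP t (tau / 2).
      exists (t + Num.min (d / 2) (tau / 4)).
      have m0 : 0 < Num.min (d / 2) (tau / 4) by rewrite lt_min !divr_gt0.
      have m1 : Num.min (d / 2) (tau / 4) <= d / 2 by rewrite ge_min lexx.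
      have m2 : Num.min (d / 2) (tau / 4) <= tau / 4 by rewrite ge_min lexx orbT.
      by split; [lra|lra|rewrite addrAC subrr add0r gtr0_norm//; lra].
    exists (t - Num.min (d / 2) (tau / 4)).
    have m0 : 0 < Num.min (d / 2) (tau / 4) by rewrite lt_min !divr_gt0.
    have m1 : Num.min (d / 2) (tau / 4) <= d / 2 by rewrite ge_min lexx.
    have m2 : Num.min (d / 2) (tau / 4) <= tau / 4 by rewrite ge_min lexx orbT.
    by split; [lra|lra|rewrite addrAC subrr add0r normrN gtr0_norm//; lra].
  by rewrite -(H s)// distrC; apply/ltW/hd => //; lra.
move=> r s r0 rs st; rewrite -wv//.
have rt : 0 <= r <= tau by rewrite r0 (le_trans rs).
have st' : 0 <= s <= tau by rewrite (le_trans r0).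
have h1 : z s = z r by rewrite (zE _ rt) (zE _ st').
rewrite /z in h1.
move/eqP: h1; rewrite subr_eq => /eqP ->.
by rewrite addrAC (addrAC (u r)) subrr add0r addrC.
Qed.

End WeakDerivative.

(** * Functions in L^p *)

Section PowerIntegrals.
Context {R : realType}.
Local Notation smeasR := (@strongly_measurable R Reals R setT (@rnorm R Reals R)).
Implicit Types (h : R -> R) (p tau : R).

Definition pfin p tau h : Prop :=
  (\int[mu]_(t in `]0%R, tau[) ((h t) `^ p)%:E < +oo)%E.

Lemma pfin_le p tau h1 h2 : 0 <= p -> {ae mu, forall t, 0 < t < tau -> 0 <= h1 t <= h2 t} ->
  pfin p tau h2 -> pfin p tau h1.
Proof.
move=> p0 h12; apply: le_lt_trans; apply: le_integral_ae => //; try by move=> t _; rewrite lee_fin powR_ge0.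
apply: filterS h12 => t h12; rewrite /= in_itv /= => tt; have /andP[h10 hh] := h12 tt.
by rewrite lee_fin ge0_ler_powR// nnegrE// (le_trans h10).
Qed.

Lemma borel_strong_measurable (g : R -> R) : borel_strong g -> measurable_fun setT g.
Proof.
move=> [fn [sf ff]]; apply: (@measurable_fun_cvg _ _ _ _ fn) => [n|t _]; last exact: ff.
exact: (fsimple_measurable_fun id (sf n)).
Qed.

(** From [h1 + h2 <= 2 * max(h1, h2)] one gets [(h1 + h2)^p <= 2^p * (h1^p + h2^p)]. As only
    finiteness matters, this takes the place of Minkowski's inequality. *)
Lemma pfin_combine p tau (C : R) h h1 h2 : 0 <= p -> 0 <= C -> smeasR `]0, tau[ h1 -> smeasR `]0, tau[ h2 ->
  (forall t, 0 <= h1 t) -> (forall t, 0 <= h2 t) ->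
  {ae mu, forall t, 0 < t < tau -> 0 <= h t <= C * (h1 t + h2 t)} ->
  pfin p tau h1 -> pfin p tau h2 -> pfin p tau h.
Proof.
move=> p0 C0 s1 s2 h10 h20 hC f1 f2.
have mD : measurable (`]0, tau[%classic : set R) by [].
have /(strongly_measurableP _ mD)[g1 b1 e1] := s1.
have /(strongly_measurableP _ mD)[g2 b2 e2] := s2.
have m1 : measurable_fun `]0, tau[ (fun t => ((`|g1 t|) `^ p)%:E).
  apply/measurable_EFinP; apply: measurable_funTS.
  by apply: (measurableT_comp (measurable_powR p)); exact: borel_strong_norm.
have m2 : measurable_fun `]0, tau[ (fun t => ((`|g2 t|) `^ p)%:E).
  apply/measurable_EFinP; apply: measurable_funTS.
  by apply: (measurableT_comp (measurable_powR p)); exact: borel_strong_norm.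
have I1 : (\int[mu]_(t in `]0%R, tau[) ((`|g1 t|) `^ p)%:E < +oo)%E.
  apply: le_lt_trans f1; apply: le_integral_ae => //; try by move=> t _; rewrite lee_fin powR_ge0.
  by apply: filterS e1 => t e1 tt; rewrite -e1// ger0_norm.
have I2 : (\int[mu]_(t in `]0%R, tau[) ((`|g2 t|) `^ p)%:E < +oo)%E.
  apply: le_lt_trans f2; apply: le_integral_ae => //; try by move=> t _; rewrite lee_fin powR_ge0.
  by apply: filterS e2 => t e2 tt; rewrite -e2// ger0_norm.
pose K := (C * 2) `^ p.
apply: (@le_lt_trans _ _ (\int[mu]_(t in `]0%R, tau[)
    (K%:E * (((`|g1 t|) `^ p)%:E + ((`|g2 t|) `^ p)%:E)))%E).
  apply: le_integral_ae => //; try by move=> t _; rewrite lee_fin powR_ge0.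
    by move=> t _; rewrite -EFinD -EFinM lee_fin mulr_ge0 ?addr_ge0 ?powR_ge0.
  apply: filterS3 e1 e2 hC => t e1 e2 hC tt; rewrite -e1// -e2// !ger0_norm//.
  have := hC; rewrite /= in_itv /= in tt; move=> /(_ tt)/andP[ht0 htC].
  rewrite -EFinD -EFinM lee_fin.
  have mx : h1 t + h2 t <= 2 * Num.max (h1 t) (h2 t).
    by rewrite mulr_natl mulr2n lerD// le_max lexx ?orbT.
  have m0 : 0 <= Num.max (h1 t) (h2 t) by rewrite le_max h10.
  apply: (@le_trans _ _ ((C * 2 * Num.max (h1 t) (h2 t)) `^ p)).
    rewrite ge0_ler_powR// ?nnegrE ?mulr_ge0//.
    by apply: le_trans htC _; rewrite -mulrA ler_wpM2l.
  rewrite powRM ?mulr_ge0// /K ler_wpM2l ?powR_ge0//.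
  by case: (leP (h1 t) (h2 t)) => _; rewrite ?lerDl ?lerDr powR_ge0.
rewrite ge0_integralZl_EFin//; last 3 first.
- by move=> t _; rewrite adde_ge0// lee_fin powR_ge0.
- exact: emeasurable_funD.
- exact: powR_ge0.
rewrite ge0_integralD//; try by move=> t _; rewrite lee_fin powR_ge0.
have I12 := lte_add_pinfty I1 I2.
by apply: lte_mul_pinfty I12; rewrite ?lee_fin ?powR_ge0.
Qed.

Lemma pfin_cst p tau (M : R) : pfin p tau (fun=> M).
Proof.
rewrite /pfin integral_cst//= lte_mul_pinfty ?lee_fin ?powR_ge0//.
exact: (mu_itvoo 0 tau).
Qed.

Context {V : completeNormedModType R}.
Local Notation smeas := (@strongly_measurable R Reals V setT (@rnorm R Reals V)).

(** On an interval of finite length it suffices that [|f| <= 1 + |f|^p]. *)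
Lemma Lp_intg p tau (f : R -> V) : 1 <= p -> @Lp R Reals V p tau f -> intg 0 tau f.
Proof.
move=> p1 [sf If]; apply/intgP; split; first exact: sf.
have p0 : 0 <= p by lra.
have mD : measurable (`]0, tau[%classic : set R) by [].
have : pfin 1 tau (fun t => `|f t|).
  have s1 : smeasR `]0, tau[ (fun t => `|f t| `^ p).
    have /(strongly_measurableP _ mD)[g b e1] := sf.
    apply/(strongly_measurableP _ mD); exists (fun t => `|g t| `^ p); last first.
      by apply: filterS e1 => t e1 tt; rewrite e1.
    have mg : measurable_fun setT (fun t => (`|g t| `^ p)).
      by apply: (measurableT_comp (measurable_powR p)); exact: borel_strong_norm.
    have := borel_strongZ mg (borel_strong_cst (1 : R)).
    by under eq_fun do rewrite [_ *: _]mulr1.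
  have s0 : smeasR `]0, tau[ (fun=> 1) by exact: smeas_cst.
  have pow0 t : 0 <= `|f t| `^ p by exact: powR_ge0.
  have If1 : pfin 1 tau (fun t => `|f t| `^ p).
    by rewrite /pfin; under eq_integral do rewrite powRr1 ?powR_ge0//; exact: If.
  apply: (@pfin_combine 1 tau 1 _ (fun=> 1) (fun t => `|f t| `^ p) ler01 ler01 s0 s1
    (fun=> ler01) pow0 _ (pfin_cst 1 tau 1) If1).
  apply: nearW => t _; rewrite normr_ge0 mul1r /=.
  have [l|l] := leP 1 (`|f t|); last by rewrite (le_trans (ltW l))// lerDl powR_ge0.
  by rewrite (le_trans (le1r_powR l p1))// lerDr.
rewrite /pfin; under eq_integral do rewrite powRr1//.
exact.
Qed.

Lemma Lp_combine p tau (C : R) (f : R -> V) h1 h2 : 0 <= p -> 0 <= C -> smeas `]0, tau[ f ->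
  smeasR `]0, tau[ h1 -> smeasR `]0, tau[ h2 ->
  (forall t, 0 <= h1 t) -> (forall t, 0 <= h2 t) ->
  {ae mu, forall t, 0 < t < tau -> `|f t| <= C * (h1 t + h2 t)} ->
  pfin p tau h1 -> pfin p tau h2 -> @Lp R Reals V p tau f.
Proof.
move=> p0 C0 sf s1 s2 h10 h20 hC f1 f2; split; first exact: sf.
apply: (@pfin_combine p tau C (fun t => `|f t|) h1 h2 p0 C0 s1 s2 h10 h20 _ f1 f2).
by apply: filterS hC => t hC tt; rewrite normr_ge0 hC.
Qed.

Lemma Lp_cts p tau (f : R -> V) : 0 <= p -> cts 0 tau f -> @Lp R Reals V p tau f.
Proof.
move=> p0 cf; have [M M0 fM] := cts_bounded cf; split; first exact: cts_smeas.
apply: (@pfin_le p tau (fun t => `|f t|) (fun=> M)) => //; last exact: pfin_cst.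
by apply: nearW => t tt; rewrite normr_ge0 fM//; lra.
Qed.

Lemma LpDZ p tau (f g : R -> V) (k : R) : 1 <= p -> @Lp R Reals V p tau f -> @Lp R Reals V p tau g ->
  @Lp R Reals V p tau (fun t => f t + k *: g t).
Proof.
move=> p1 Lf Lg; have p0 : 0 <= p by lra.
have mD : measurable (`]0, tau[%classic : set R) by [].
have If := intg_smeas (intgDZ k (Lp_intg p1 Lf) (Lp_intg p1 Lg)).
have [sf If'] := Lf; have [sg Ig'] := Lg.
apply: (@Lp_combine p tau (1 + `|k|) _ (fun t => `|f t|) (fun t => `|g t|) p0 _ If
  (smeas_norm mD sf) (smeas_norm mD sg) _ _ _ If' Ig'); rewrite ?addr_ge0//.
apply: nearW => t _; apply: le_trans (ler_normD _ _) _; rewrite normrZ.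
have := normr_ge0 (f t); have := normr_ge0 (g t); have := normr_ge0 k.
by nra.
Qed.

Lemma Lp_ae p tau (f g : R -> V) : 0 <= p -> {ae mu, forall t, 0 < t < tau -> f t = g t} ->
  @Lp R Reals V p tau f -> @Lp R Reals V p tau g.
Proof.
move=> p0 fg [sf If]; split; first exact: smeas_ae sf.
apply: (@pfin_le p tau (fun t => `|g t|) (fun t => `|f t|)) => //.
by apply: filterS fg => t fg tt; rewrite fg// normr_ge0 lexx.
Qed.

Lemma pfin_reflect p tau (h : R -> R) : 0 <= p -> smeasR `]0, tau[ h ->
  pfin p tau h -> pfin p tau (fun t => h (tau - t)).
Proof.
move=> p0 sh; have mD : measurable (`]0, tau[%classic : set R) by [].
have /(strongly_measurableP _ mD)[g b e1] := sh.
rewrite /pfin => If.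
have itvE : mirror tau @^-1` (`]0, tau[%classic : set R) = `]0, tau[%classic.
  by rewrite reflect_itv subr0 subrr.
have mg : measurable_fun `]0, tau[ (fun t => (g t `^ p)%:E).
  apply/measurable_EFinP; apply: measurable_funTS.
  by apply: (measurableT_comp (measurable_powR p)); exact: borel_strong_measurable.
apply: (@le_lt_trans _ _ (\int[mu]_(t in mirror tau @^-1` (`]0%R, tau[%classic : set R)) ((g (mirror tau t)) `^ p)%:E)%E).
  rewrite itvE; apply: le_integral_ae => //; try by move=> t _; rewrite lee_fin powR_ge0.
  apply: filterS (ae_reflect tau e1) => t e2 /= tt; rewrite e2//; move: tt.
  by rewrite /= !in_itv /= => /andP[? ?]; apply/andP; split; lra.
rewrite (integral_reflect tau mD mg); last first.
  by move=> t _; rewrite lee_fin powR_ge0.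
apply: le_lt_trans If; apply: le_integral_ae => //; try by move=> t _; rewrite lee_fin powR_ge0.
by apply: filterS e1 => t e1 tt; rewrite e1.
Qed.

(** The scalar differentiation theorem is applied to the distances [|g - x n i|] from the countably
    many values of the approximating simple functions. At a common Lebesgue point [t], choose a
    value within [e / 8] of [g t]; then [|g s - g t|] is at most the variation of that distance plus
    twice its value at [t]. *)
Lemma lebesgue_right_point a b (f : R -> V) : intg a b f ->
  {ae mu, forall t, a < t < b -> forall e, 0 < e -> exists2 d, 0 < d &
    forall h : R, 0 < h < d -> t + h <= b -> nint t (t + h) (fun s => f s - f t) <= e * h}.
Proof.
move=> If; have mD : measurable (`]a, b[%classic : set R) by [].
have /(strongly_measurableP _ mD)[g bg fg] := intg_smeas If.
have Ig : intg a b g by exact: intg_ae If.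
have [gn [sg cg]] := bg.
have /choice[r rE] : forall n, exists r : seq V, range (gn n) = [set` r].
  by move=> n; apply/finite_seqP; case: (sg n).
(* Indices beyond the list give the centre 0, which merely adds a point to the countable family. *)
pose x n i := nth 0 (r n) i.
pose phi n i t := `|g t - x n i|.
have bphi n i : borel_strong (fun t => g t - x n i).
  by apply: borel_strongB => //; exact: borel_strong_cst.
have mphi n i : measurable_fun setT (phi n i) by exact: borel_strong_norm.
have pt n i : {ae mu, forall t, lebesgue_pt (phi n i \_ `]a, b[) t}.
  apply/lebesgue_differentiation/integrable_locally_restrict => //.
  apply/integrableP; split; first by apply/measurable_EFinP; exact: (measurable_funTS (mphi n i)).
  have /intgP[_] := intgB Ig (intg_cst a b (x n i)); rewrite /intnorm.
  by under [X in _ -> (X < _)%E]eq_integral do rewrite /= normr_id.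
have {}pt : {ae mu, forall t n i, lebesgue_pt (phi n i \_ `]a, b[) t}.
  by apply: ae_foralln => n; exact: ae_foralln.
have fgc := fg; apply: filterS2 pt fgc => t pt ftg tab e e0.
have e8 : 0 < e / 8 by rewrite divr_gt0.
have [n ng] : exists n, `|g t - gn n t| < e / 8.
  by move/cvgrPdist_lt : (cg t) => /(_ _ e8) H; have [n] := filter_ex H; exists n.
have [i xi] : exists i, gn n t = x n i.
  have : gn n t \in r n by rewrite -[is_true _]/([set` r n] (gn n t)) -rE; exists t.
  by move=> /(nthP 0)[i _ <-]; exists i.
have := pt n i => /fine_cvgP[finav /cvgrPdist_lt /(_ _ e8) av].
have [d /= d0 hd] : \forall h \near 0^'+, davg (phi n i \_ `]a, b[) t h \is a fin_num /\
    `|0 - fine (davg (phi n i \_ `]a, b[) t h)| < e / 8.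
  by apply: filterS2 finav av => h.
have [ta tb] := andP tab.
exists d => // h /andP[h0 hdd] thb.
have hball : ball (0 : R) d h by rewrite -ball_normE /= sub0r normrN gtr0_norm.
have [fin] := hd h hball h0; rewrite sub0r normrN => lt8.
have phit : phi n i t < e / 8 by rewrite /phi -xi.
have tD : (`]a, b[%classic : set R) t by rewrite /= in_itv.
have sD s : t < s < t + h -> (`]a, b[%classic : set R) s.
  by move=> ?; rewrite /= in_itv /=; apply/andP; split; lra.
have bd : (intnorm `]t, (t + h)%R[ (fun s => (f s - f t)%R) <= (e * h)%:E)%E.
  pose q s := `|phi n i s - phi n i t|.
  have q0 s : 0 <= q s by exact: normr_ge0.
  have pt0 : 0 <= 2 * phi n i t by apply: mulr_ge0 => //; exact: normr_ge0.
  have mq : measurable_fun setT q.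
    by apply: measurableT_comp => //; apply: measurable_funB.
  apply: (@le_trans _ _ (\int[mu]_(s in `]t, (t + h)%R[) ((q s)%:E + (2 * phi n i t)%:E))%E).
    apply: le_integral_ae => //.
      by move=> s _; rewrite -EFinD lee_fin; exact: addr_ge0.
    apply: filterS fg => s fsg; rewrite /= in_itv /= => st.
    rewrite fsg; last exact: sD.
    rewrite (ftg tD) -EFinD lee_fin -(subrKA (x n i)).
    apply: le_trans (ler_normD _ _) _; rewrite (distrC (x n i)) -/(phi n i s) -/(phi n i t) /q.
    by have := ler_norm (phi n i s - phi n i t); lra.
  have mqE : measurable_fun `]t, (t + h)%R[ (fun s => (q s)%:E).
    by apply/measurable_EFinP; exact: (measurable_funTS mq).
  rewrite ge0_integralD//; last by move=> s _; rewrite lee_fin.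
  rewrite integral_cst//= lebesgue_measure_itv /= lte_fin ltrDl h0.
  (* The mean over the ball, of length [2 * h], is below [e / 8], so the variation integrates to at
     most [e / 4 * h]; the constant term, at most [e / 4], fits into the rest. *)
  have -> : (e * h = (e / 4) * h + (e * 3 / 4) * h) by field.
  rewrite (EFinD (e / 4 * h)); apply: leeD; last first.
    rewrite -EFinD -EFinM lee_fin.
    by rewrite (_ : t + h - t = h); [rewrite ler_wpM2r ?ltW//; lra|ring].
  apply: (@le_trans _ _ (\int[mu]_(s in ball t h)
     (`|(center ((phi n i \_ `]a, b[) t) \o (phi n i \_ `]a, b[)) s|)%:E)%E); last first.
    move: fin lt8; rewrite /davg /iavg lebesgue_measure_ball; last exact: ltW.
    have -> : ((h *+ 2)%:E^-1 = ((h *+ 2)^-1)%:E :> \bar R)%E.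
      by rewrite inver gt_eqF// pmulrn_lgt0.
    set I := (\int[_]_(_ in _) _)%E => fin.
    have I0 : (0 <= I)%E by apply: integral_ge0 => s _; rewrite lee_fin.
    have Ifin : I \is a fin_num.
      rewrite ge0_fin_numE// ltNge leye_eq; apply/negP => /eqP Ioo; move: fin.
      by rewrite Ioo gt0_muley// lte_fin invr_gt0 pmulrn_lgt0.
    have h2 : 0 < h *+ 2 by rewrite pmulrn_lgt0.
    have -> : fine (((h *+ 2)^-1)%:E * I)%E = (h *+ 2)^-1 * fine I by rewrite fineM.
    rewrite normrM normfV (gtr0_norm h2) (ger0_norm (fine_ge0 I0)) ltr_pdivrMl// => lt8.
    rewrite -(fineK Ifin) lee_fin; apply/ltW; apply: lt_le_trans lt8 _.
    by rewrite mulr2n; lra.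
  apply: (@le_trans _ _ (\int[mu]_(s in `]t, (t + h)%R[)
     (`|(center ((phi n i \_ `]a, b[) t) \o (phi n i \_ `]a, b[)) s|)%:E)%E).
    have H s : `]t, (t + h)%R[%classic s -> ((q s)%:E <= (`|(center ((phi n i \_ `]a, b[) t) \o (phi n i \_ `]a, b[)) s|)%:E)%E.
      rewrite /= in_itv /= => st; rewrite !patchE (mem_set (sD s st)) (mem_set tD) lee_fin.
      exact: lexx.
    apply: le_integral_ae; [exact: measurable_itv|by move=> s _; rewrite lee_fin|by move=> s _; rewrite lee_fin|exact: aeW].
  apply: ge0_subset_integral => //.
  - exact: measurable_ball.
  - apply/measurable_EFinP; apply: measurable_funTS; apply: measurableT_comp => //.
    apply: measurable_funD => //.
    by apply/(measurable_restrictT _ _).1 => //; exact: (measurable_funTS (mphi n i)).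
  - move=> s; rewrite /= in_itv /= => /andP[s1 s2].
    rewrite -ball_normE /= ltr0_norm; lra.
rewrite -lee_fin fineK// ge0_fin_numE ?intnorm_ge0//.
exact: le_lt_trans bd (ltry _).
Qed.

End PowerIntegrals.

(** * Semigroups and strong solutions *)

Lemma addr_regroup (V : zmodType) (a b c d e : V) :
  a - b - c - (d - e) = a - c - d - (b - e).
Proof.
rewrite !opprB (addrAC a) -!addrA; congr (_ + (_ + _)).
by rewrite addrCA [RHS]addrCA; congr (_ + _); exact: addrC.
Qed.

Lemma norm_third (R : realType) (V : normedModType R) (a b c : V) (e : R) :
  `|a| <= e / 3 -> `|b| <= e / 3 -> `|c| <= e / 3 -> `|a - (b + c)| <= e.
Proof.
by move=> ha hb hc; have := ler_normB a (b + c); have := ler_normD b c; lra.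
Qed.

Lemma window_range (R : realFieldType) (t h r d : R) :
  t < r < t + h -> h < d -> 0 <= t + h - r < d.
Proof. by move=> ? ?; lra. Qed.

Section Semigroups.
Context {R : realType} {V : completeNormedModType R}.
Variables (T : R -> V -> V) (tau C M : R).
Hypothesis (hT : @C0_semigroup R Reals V T) (tau0 : 0 < tau).
Hypothesis TM : forall t x, 0 <= t <= tau -> `|T t x| <= M * `|x|.
Local Notation domA := (@domA R Reals V T).
Local Notation opA := (@opA R Reals V T).
Implicit Types (x y : V) (t s r : R).

Lemma T_add t x y : 0 <= t -> T t (x + y) = T t x + T t y.
Proof.
move=> t0; have [H _ _ _] := hT; have [/(_ 1 x y) + _] := H t t0.
by rewrite !scale1r.
Qed.

Lemma T_0 t : 0 <= t -> T t 0 = 0.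
Proof. by move=> t0; apply: (@addrI _ (T t 0)); rewrite -T_add// !addr0. Qed.

Lemma T_scale t (k : R) x : 0 <= t -> T t (k *: x) = k *: T t x.
Proof.
move=> t0; have [H _ _ _] := hT; have [/(_ k x 0) + _] := H t t0.
by rewrite T_0// !addr0.
Qed.

Lemma T_sub t x y : 0 <= t -> T t (x - y) = T t x - T t y.
Proof. by move=> t0; rewrite T_add// -scaleN1r T_scale// scaleN1r. Qed.

Lemma T_id x : T 0 x = x.
Proof. by have [_ H _ _] := hT; exact: H. Qed.

Lemma T_semigroup t s x : 0 <= t -> 0 <= s -> T (t + s) x = T t (T s x).
Proof. by have [_ _ H _] := hT; exact: H. Qed.

Lemma at_right_P (F : R -> V) y : F t @[t --> 0^'+] --> y <->
  forall e, 0 < e -> exists2 d, 0 < d & forall h, 0 < h < d -> `|F h - y| < e.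
Proof.
split=> [/cvgrPdist_lt c e e0|H].
  have := c e e0 => /nbhs_ballP[d /= d0 hd]; exists d => // h /andP[h0 hlt].
  rewrite distrC; apply: hd => //.
  by rewrite -ball_normE /= sub0r normrN gtr0_norm.
apply/cvgrPdist_lt => e e0; have [d d0 hd] := H e e0.
apply/nbhs_ballP; exists d => //= h.
rewrite -ball_normE /= sub0r normrN => hlt h0; rewrite distrC; apply: hd.
by rewrite h0 -(gtr0_norm h0).
Qed.

Lemma T_cvg0 x e : 0 < e -> exists2 d, 0 < d & forall h, 0 <= h < d -> `|T h x - x| < e.
Proof.
have [_ _ _ H] := hT; have /at_right_P H' := H x.
move=> e0; have [d d0 hd] := H' e e0; exists d => // h /andP[].
rewrite le_eqVlt => /predU1P[<- _|h0 hlt]; first by rewrite T_id subrr normr0.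
by apply: hd; rewrite h0.
Qed.

(* [x] is in D(A) and [y = - A x] *)
Definition gen x y := forall e, 0 < e -> exists2 d, 0 < d &
  forall h, 0 < h < d -> `|T h x - x - h *: y| <= e * h.

Lemma gen_quotient x y : gen x y <->
  @diff_quotient R Reals V T x t @[t --> 0^'+] --> y.
Proof.
have E h : 0 < h -> `|h^-1 *: (T h x - x) - y| = h^-1 * `|T h x - x - h *: y|.
  move=> h0; have hn0 : h != 0 by rewrite gt_eqF.
  have -> : h^-1 *: (T h x - x) - y = h^-1 *: (T h x - x - h *: y).
    by rewrite [RHS]scalerBr scalerA (mulVf hn0) scale1r.
  by rewrite normrZ gtr0_norm ?invr_gt0.
rewrite at_right_P; split=> H e e0.
  have e2 : 0 < e / 2 by rewrite divr_gt0.
  have [d d0 hd] := H _ e2; exists d => // h hh; have /andP[h0 _] := hh.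
  rewrite [X in X < _]E// mulrC ltr_pdivrMr//; apply: le_lt_trans (hd h hh) _.
  by rewrite ltr_pM2r//; lra.
have [d d0 hd] := H e e0; exists d => // h hh; have /andP[h0 _] := hh.
by have /ltW := hd h hh; rewrite [X in X <= _]E// mulrC ler_pdivrMr.
Qed.

Lemma gen_opA x y : gen x y -> domA x /\ opA x = - y.
Proof.
move=> /gen_quotient g; split; first by apply/cvg_ex; exists y.
by congr (- _); apply: cvg_lim.
Qed.

Lemma domA_gen x : domA x -> gen x (- opA x).
Proof. by move=> dx; apply/gen_quotient; rewrite opprK; exact: dx. Qed.

Lemma gen_lin x y x' y' (k : R) : gen x y -> gen x' y' -> gen (x + k *: x') (y + k *: y').
Proof.
move=> g g' e e0; have e2 : 0 < e / 2 by rewrite divr_gt0.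
have k0 : 0 < `|k| + 1 by rewrite ltr_wpDl.
have e2k : 0 < e / 2 / (`|k| + 1) by rewrite divr_gt0.
have [d d0 hd] := g _ e2; have [d' d'0 hd'] := g' _ e2k.
exists (Num.min d d'); first by rewrite lt_min d0.
move=> h /andP[h0]; rewrite lt_min => /andP[h1 h2].
have -> : T h (x + k *: x') - (x + k *: x') - h *: (y + k *: y') =
   (T h x - x - h *: y) + k *: (T h x' - x' - h *: y').
  rewrite T_add ?T_scale ?ltW// scalerDr !scalerBr !scalerA (mulrC h k).
  by rewrite !opprD (addrACA (T h x)) [LHS]addrACA.
apply: le_trans (ler_normD _ _) _; rewrite (splitr e) mulrDl.
apply: lerD; first by apply: hd; rewrite h0.
rewrite normrZ; have := hd' h; rewrite h0 h2 => /(_ isT) H.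
apply: (@le_trans _ _ ((`|k| + 1) * (e / 2 / (`|k| + 1) * h))).
  apply: (@le_trans _ _ ((`|k| + 1) * `|T h x' - x' - h *: y'|)).
    by rewrite ler_wpM2r// lerDl.
  by rewrite ler_wpM2l// ltW.
by rewrite le_eqVlt; apply/orP; left; apply/eqP; field; rewrite gt_eqF.
Qed.

Lemma gen_T x y t : 0 <= t <= tau -> gen x y -> gen (T t x) (T t y).
Proof.
move=> tt g e e0; have t0 : 0 <= t by lra.
have M0 : 0 < `|M| + 1 by rewrite ltr_wpDl.
have e1 : 0 < e / (`|M| + 1) by rewrite divr_gt0.
have [d d0 hd] := g _ e1; exists d => // h hh; have h0 : 0 <= h by lra.
have -> : T h (T t x) = T t (T h x) by rewrite -T_semigroup// -T_semigroup// (addrC h).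
rewrite -T_sub// -T_scale// -T_sub//.
apply: le_trans (TM _ tt) _; have H := hd h hh.
apply: (@le_trans _ _ ((`|M| + 1) * (e / (`|M| + 1) * h))).
  apply: (@le_trans _ _ ((`|M| + 1) * `|T h x - x - h *: y|)).
    rewrite ler_wpM2r//; apply: le_trans (ler_norm M) _; by rewrite lerDl.
  by rewrite ler_wpM2l// ltW.
by rewrite le_eqVlt; apply/orP; left; apply/eqP; field; rewrite gt_eqF.
Qed.

Lemma domA_lin x y (k : R) : domA x -> domA y ->
  domA (x + k *: y) /\ opA (x + k *: y) = opA x + k *: opA y.
Proof.
move=> /domA_gen gx /domA_gen gy; have [d ->] := gen_opA (gen_lin k gx gy).
by split=> //; rewrite opprD scalerN !opprK.
Qed.

Lemma domA_sub x y : domA x -> domA y -> domA (x - y) /\ opA (x - y) = opA x - opA y.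
Proof. by move=> dx dy; have := domA_lin (-1) dx dy; rewrite !scaleN1r. Qed.

Lemma domA_T x t : 0 <= t <= tau -> domA x -> domA (T t x) /\ opA (T t x) = T t (opA x).
Proof.
move=> tt /domA_gen gx; have [d ->] := gen_opA (gen_T tt gx).
have t0 : 0 <= t by lra.
by split=> //; rewrite -[- opA x]sub0r (T_sub _ _ t0) (T_0 t0) sub0r opprK.
Qed.

Lemma cts_T x : cts 0 tau (T^~ x).
Proof.
have M0 : 0 < `|M| + 1 by rewrite ltr_wpDl.
move=> t tt e e0; have [d d0 hd] := T_cvg0 x (divr_gt0 e0 M0).
have H r s : 0 <= r -> r <= s -> s <= tau -> s - r < d -> `|T s x - T r x| < e.
  move=> r0 rs st srd.
  have -> : T s x = T r (T (s - r) x) by rewrite -T_semigroup ?subr_ge0// subrKC.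
  rewrite -T_sub//; have := hd (s - r); rewrite subr_ge0 rs srd => /(_ isT).
  rewrite ltr_pdivlMr// => H; apply: le_lt_trans H.
  apply: le_trans (TM _ _) _; first by lra.
  by rewrite mulrC ler_wpM2l//; apply: le_trans (ler_norm M) _; rewrite lerDl.
exists d => // s ss; have [l|l] := leP t s.
  by rewrite ger0_norm ?subr_ge0// => ?; apply: H => //; lra.
by rewrite ltr0_norm ?subr_lt0// opprB distrC => ?; apply: H => //; lra.
Qed.

Hypothesis TD : forall t x, 0 < t <= tau -> domA (T t x).
Hypothesis TC : forall t x, 0 < t <= tau -> `|opA (T t x)| <= C / t * `|x|.
Hypotheses (M0 : 0 <= M) (C0 : 0 <= C).

Definition AT t x := opA (T t x).

Lemma AT_lin t x y (k : R) : 0 < t <= tau -> AT t (x + k *: y) = AT t x + k *: AT t y.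
Proof.
move=> tt; have t0 : 0 <= t by lra.
by rewrite /AT T_add// T_scale//; have [_ ->] := domA_lin k (@TD _ x tt) (@TD _ y tt).
Qed.

Lemma AT_sub t x y : 0 < t <= tau -> AT t (x - y) = AT t x - AT t y.
Proof. by move=> tt; have := AT_lin x y (-1) tt; rewrite !scaleN1r. Qed.

Lemma AT_shift t s x : 0 < t -> 0 <= s -> t + s <= tau -> AT (t + s) x = T s (AT t x).
Proof.
move=> t0 s0 ts; rewrite /AT (addrC t s) T_semigroup//; last by lra.
have tt : 0 < t <= tau by lra.
have ss : 0 <= s <= tau by lra.
by have [_ ->] := domA_T ss (@TD _ x tt).
Qed.

(** Since [AT s x = T (s - a) (AT a x)], continuity away from 0 is that of an orbit. *)
Lemma cts_AT a b x : 0 < a -> b <= tau -> cts a b (AT^~ x).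
Proof.
move=> a0 bt t tt e e0.
have [|d d0 hd] := cts_T (AT a x) (t := t - a) _ e0; first by lra.
exists d => // s ss st.
have -> : AT s x = T (s - a) (AT a x) by rewrite -AT_shift; [congr AT; ring|lra..].
have -> : AT t x = T (t - a) (AT a x) by rewrite -AT_shift; [congr AT; ring|lra..].
apply: hd; first by lra.
by rewrite (_ : s - a - (t - a) = s - t); last by ring.
Qed.

Lemma T_ftc r s x : 0 < r -> r <= s -> s <= tau ->
  T s x - T r x = - bint r s (AT^~ x).
Proof.
move=> r0 rs st.
have cA := cts_AT x r0 st; have IA := cts_intg cA.
rewrite -[RHS]scaleN1r -(bintZ (-1) IA).
apply: (@fundamental_theorem _ _ r s (T^~ x) (fun t => -1 *: AT t x)) => //.
- by apply: cts_sub (cts_T x); lra.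
- apply: (@cts_eq _ _ _ _ (fun t => 0 + -1 *: AT t x)).
    by move=> t _; rewrite add0r.
  apply: ctsDZ => //; apply: (@lip_cts _ _ _ _ _ 0) => a b _ _ _.
  by rewrite subrr normr0 mul0r.
move=> t tt e e0; have t0 : 0 < t <= tau by lra.
have [d d0 hd] := domA_gen (@TD _ x t0) e0; exists d => // h hh thb.
by rewrite scaleN1r (addrC t h) T_semigroup; [exact: hd|lra|lra].
Qed.

Lemma intg_T_conv f t : 0 <= t <= tau -> intg 0 t f -> intg 0 t (fun r => T (t - r) (f r)).
Proof.
move=> tt If; apply: (@intg_le _ _ V 0 t _ (fun r => M *: f r)).
- apply: (@smeas_continuous_comp _ _ V 0 t (fun r x => T (t - r) x) f); last exact: intg_smeas.
  move=> rn xn s x rnt st rns xnx; apply/cvgrPdist_lt => e e0.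
  have e2 : 0 < e / 2 by rewrite divr_gt0.
  have M1 : 0 < M + 1 by rewrite ltr_wpDl.
  have [|d d0 hd] := cts_T x (t := t - s) _ e2; first by lra.
  move/cvgrPdist_lt : rns => /(_ _ d0) c1.
  move/cvgrPdist_lt : xnx => /(_ _ (divr_gt0 e2 M1)) c2.
  apply: filterS2 c1 c2 => n c1; rewrite ltr_pdivlMr// => c2; have rn_t := rnt n.
  rewrite -(subrKA (T (t - rn n) x)); apply: le_lt_trans (ler_normD _ _) _.
  rewrite (splitr e); apply: ltrD.
    rewrite distrC; apply: hd; first by lra.
    by rewrite (_ : t - rn n - (t - s) = s - rn n); last by ring.
  rewrite -T_sub; last by lra.
  apply: le_lt_trans c2; apply: le_trans (TM _ _) _; first by lra.
  by rewrite mulrC ler_wpM2l// lerDl.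
- exact: intgZ.
apply: nearW => r rt; rewrite normrZ (ger0_norm M0); apply: TM; lra.
Qed.

(** [u] is absolutely continuous with density [v]; for [v] in L^p this is the working form of
    membership in W^{1,p}, by [W1p_withP]. *)
Definition ac (u v : R -> V) := intg 0 tau v /\
  forall r s, 0 <= r -> r <= s -> s <= tau -> u s - u r = bint r s v.

Lemma ac_cts u v : ac u v -> cts 0 tau u.
Proof.
move=> [Iv uv]; apply: (@cts_eq _ _ _ _ (fun t => u 0 + 1 *: bint 0 t v)).
  by move=> t tab; rewrite scale1r -uv; [rewrite subrKC|lra..].
apply: ctsDZ; last exact: bint_cts.
by apply: (@lip_cts _ _ _ _ _ 0) => s t _ _ _; rewrite subrr normr0 mul0r.
Qed.

(* [T (t - r)] is Lipschitz in [r] only on [0, b] with [b < t], so the product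
   rule is applied there and [b] tends to [t]. *)
Lemma variation_of_constants u v f : ac u v -> intg 0 tau f ->
  {ae mu, forall t, 0 < t < tau -> domA (u t) /\ v t + opA (u t) = f t} ->
  forall t, 0 <= t <= tau -> u t = T t (u 0) + bint 0 t (fun r => T (t - r) (f r)).
Proof.
move=> acuv If eq t tt; have [Iv uv] := acuv; have cu := ac_cts acuv.
have Ift : intg 0 t f by apply: intg_sub If; lra.
have IF := intg_T_conv tt Ift.
have step b : 0 <= b -> b < t -> T (t - b) (u b) - T t (u 0) = bint 0 b (fun r => T (t - r) (f r)).
  (* For [r] in [[0, b]] the operators [T (t - r)] are bounded by [M] and [A T (t - r)] by
     [C / (t - b)]; the product rule takes a single constant. *)
  move=> b0 bt; pose L := M + C / (t - b).
  have tb0 : 0 < t - b by lra.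
  have L0 : 0 <= C / (t - b) by rewrite divr_ge0// ltW.
  have LC r : 0 <= r <= b -> C / (t - r) <= L.
    move=> rb; apply: (@le_trans _ _ (C / (t - b))); last by rewrite lerDr.
    by rewrite ler_wpM2l// lef_pV2 ?posrE; lra.
  have tr r : 0 <= r <= b -> 0 < t - r <= tau by lra.
  have BE r s x : 0 <= r -> r <= s -> s <= b ->
      T (t - s) x - T (t - r) x = bint r s (fun q => AT (t - q) x).
    move=> r0 rs sb.
    have IA : intg (t - s) (t - r) (AT^~ x) by apply: cts_intg; apply: cts_AT; lra.
    have := bint_reflect t IA; rewrite (_ : t - (t - r) = r); last by ring.
    rewrite (_ : t - (t - s) = s); last by ring.
    move=> ->; rewrite -[RHS]opprK -T_ftc; [by rewrite opprB|lra..].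
  have cB x : cts 0 b (fun q => AT (t - q) x).
    move=> q qb e e0; have [|d d0 hd] := @cts_AT (t - b) tau x tb0 (lexx _) (t - q) _ _ e0; first by lra.
    exists d => // s sb sq; apply: hd; first by lra.
    by rewrite (_ : t - s - (t - q) = q - s); [rewrite distrC|ring].
  have Ivb : intg 0 b v by apply: intg_sub Iv; lra.
  have [||||||||I1 [I2 E]] := @product_rule R V 0 b (fun r x => T (t - r) x) (fun r x => AT (t - r) x) u v L b0 _ _ _ _ _ _ _ cB BE Ivb.
  - by rewrite addr_ge0.
  - by move=> r x y rb; apply: T_add; lra.
  - by move=> r k x rb; apply: T_scale; lra.
  - by move=> r x y rb; apply: AT_sub; exact: tr.
  - move=> r x rb; apply: le_trans (TM _ _) _; first by lra.
    by rewrite ler_wpM2r// lerDl.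
  - move=> r x rb; apply: le_trans (@TC _ _ (tr _ rb)) _.
    by rewrite ler_wpM2r// LC.
  - move=> r s x r0 rs sb; rewrite BE//.
    have IB : intg r s (fun q => AT (t - q) x) by apply: intg_sub (cts_intg (cB x)); lra.
    apply: le_trans (bint_norm IB) _; rewrite mulrAC; apply: nint_bound => //.
    apply: nearW => q qrs; have qb : 0 <= q <= b by lra.
    apply: le_trans (@TC _ _ (tr _ qb)) _.
    by rewrite ler_wpM2r// LC.
  - by move=> r s r0 rs sb; apply: uv => //; lra.
  (* [A] commutes with the semigroup on D(A), so the two terms of the product rule combine into
     [T (t - q)] applied to [v q + opA (u q) = f q]. *)
  move: E; rewrite subr0 => ->; apply: bint_ae.
  apply: filterS eq => q eq qb; have [|dq <-] := eq; first by lra.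
  rewrite T_add; last by lra.
  congr (_ + _); rewrite /AT; have qt : 0 <= t - q <= tau by lra.
  by have [_ ->] := domA_T qt dq.
have [->|tn0] := eqVneq t 0; first by rewrite bint_empty// T_id addr0.
have tpos : 0 < t by rewrite lt_neqAle eq_sym tn0 /=; lra.
apply/eqP; rewrite -subr_eq0 -normr_le0; apply/ler_addgt0Pr => e e0; rewrite add0r.
have e3 : 0 < e / 3 by rewrite divr_gt0.
have M1 : 0 < M + 1 by rewrite ltr_wpDl.
have [d1 d10 h1] := T_cvg0 (u t) e3.
have [d2 d20 h2] := cu t tt _ (divr_gt0 e3 M1).
have [d3 d30 h3] := nint_small IF e3.
pose d := Num.min (Num.min (d1 / 2) (d2 / 2)) (Num.min (d3 / 2) t).
have d0 : 0 < d by rewrite !lt_min !divr_gt0.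
have dd1 : d <= d1 / 2 by rewrite /d !ge_min lexx.
have dd2 : d <= d2 / 2 by rewrite /d !ge_min lexx orbT.
have dd3 : d <= d3 / 2 by rewrite /d !ge_min lexx !orbT.
have ddt : d <= t by rewrite /d !ge_min lexx !orbT.
have b0 : 0 <= t - d by lra.
have bt : t - d < t by lra.
have := step _ b0 bt; rewrite (_ : t - (t - d) = d); last by ring.
move=> E.
have -> : T t (u 0) + bint 0 t (fun r => T (t - r) (f r)) =
    T d (u (t - d)) + bint (t - d) t (fun r => T (t - r) (f r)).
  rewrite (@bint_split _ _ 0 (t - d) t _ b0 (ltW bt) IF) -E addrA.
  by rewrite subrKC.
have g1 : `|u t - T d (u t)| < e / 3 by rewrite distrC; apply: h1; lra.
have g2 : `|T d (u t) - T d (u (t - d))| < e / 3.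
  rewrite -T_sub; last by lra.
  have := h2 (t - d); rewrite b0 /= => /(_ _ _) H.
  have : `|u (t - d) - u t| < e / 3 / (M + 1).
    by apply: H; [lra|rewrite (_ : t - d - t = - d); [rewrite normrN gtr0_norm//; lra|ring]].
  rewrite ltr_pdivlMr// distrC => H'; apply: le_lt_trans H'.
  apply: le_trans (TM _ _) _; first by lra.
  by rewrite mulrC ler_wpM2l// lerDl.
have g3 : `|bint (t - d) t (fun r => T (t - r) (f r))| < e / 3.
  apply: le_lt_trans (bint_norm _) _; first by apply: intg_sub IF; lra.
  by apply: h3; lra.
rewrite opprD addrA -{1}(subrK (T d (u t)) (u t)) -(addrA (u t - _)).
set a := u t - _ in g1 *; set b := T d (u t) - _ in g2 *; set c := bint _ _ _ in g3 *.
have := ler_normB (a + b) c; have := ler_normD a b; lra.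
Qed.

Lemma conv_flow f t h : intg 0 tau f -> 0 <= t -> 0 <= h -> t + h <= tau ->
  bint 0 (t + h) (fun r => T (t + h - r) (f r)) =
  T h (bint 0 t (fun r => T (t - r) (f r))) + bint t (t + h) (fun r => T (t + h - r) (f r)).
Proof.
move=> If t0 h0 tht.
have th : 0 <= t + h <= tau by lra.
have tt : 0 <= t <= tau by lra.
have hh : 0 <= h <= tau by lra.
have I1 : intg 0 (t + h) (fun r => T (t + h - r) (f r)).
  by apply: intg_T_conv => //; apply: intg_sub If; lra.
have I2 : intg 0 t (fun r => T (t - r) (f r)).
  by apply: intg_T_conv => //; apply: intg_sub If; lra.
rewrite (@bint_split _ _ 0 t (t + h) _ t0 _ I1); last by lra.
congr (_ + _).
have [_ <-] := bint_op (fun x y => @T_add h x y h0) (fun k x => @T_scale h k x h0) (fun x => TM x hh) I2.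
apply: bint_eq => r rt; rewrite -T_semigroup; [congr T; ring|lra|lra].
Qed.

(* At a common right Lebesgue point [t] of [f] and [v], the orbit of the
   convolution at [t] is right differentiable. *)
Lemma conv_strong f v : intg 0 tau f ->
  ac (fun t => bint 0 t (fun r => T (t - r) (f r))) v ->
  {ae mu, forall t, 0 < t < tau -> domA (bint 0 t (fun r => T (t - r) (f r))) /\
     v t + opA (bint 0 t (fun r => T (t - r) (f r))) = f t}.
Proof.
move=> If [Iv uv]; set u := fun t => bint 0 t (fun r => T (t - r) (f r)).
apply: filterS2 (lebesgue_right_point Iv) (lebesgue_right_point If) => t Lv Lf tt.
suff /gen_opA[dut ->] : gen (u t) (v t - f t).
  by split=> //; rewrite opprB subrKC.
move=> e e0; have e3 : 0 < e / 3 by rewrite divr_gt0.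
have M1 : 0 < M + 1 by rewrite ltr_wpDl.
have [d1 d10 h1] := Lv tt _ e3.
have [d2 d20 h2] := Lf tt _ (divr_gt0 e3 M1).
have [d3 d30 h3] := T_cvg0 (f t) e3.
exists (Num.min (Num.min d1 d2) (Num.min d3 (tau - t))).
  by rewrite !lt_min d10 d20 d30 subr_gt0; case/andP: tt.
move=> h /andP[h0]; rewrite !lt_min => /andP[/andP[hd1 hd2] /andP[hd3 hdt]].
have thb : t + h <= tau by lra.
have t0 : 0 <= t by lra.
have th : t <= t + h by lra.
have g1 := h1 h; rewrite h0 hd1 in g1; have {}g1 := g1 isT thb.
have g2 := h2 h; rewrite h0 hd2 in g2; have {}g2 := g2 isT thb.
have := conv_flow If t0 (ltW h0) thb; rewrite -/(u t) -/(u (t + h)) => E.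
pose F r := T (t + h - r) (f r).
have IF : intg t (t + h) F.
  have th' : 0 <= t + h <= tau by lra.
  have I1 : intg 0 (t + h) F by apply: intg_T_conv => //; apply: intg_sub If; lra.
  by apply: intg_sub I1; lra.
have Ivt : intg t (t + h) v by apply: intg_sub Iv; lra.
have Ift : intg t (t + h) f by apply: intg_sub If; lra.
(* By the semigroup law [T h (u t)] is [u (t + h)] minus the integral of [F] over the window []t, t
   + h[]; subtracting the constants [v t] and [f t] leaves two mean deviations, each to be of order
   [e * h]. *)
have -> : T h (u t) - u t - h *: (v t - f t) =
   bint t (t + h) (fun r => v r - v t) - bint t (t + h) (fun r => F r - f t).
  rewrite (bintB Ivt (intg_cst _ _ _)) (bintB IF (intg_cst _ _ _)).
  rewrite !bint_cst// (_ : t + h - t = h); last by ring.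
  rewrite -uv//; have -> : T h (u t) = u (t + h) - bint t (t + h) F by rewrite E addrK.
  by rewrite [h *: (v t - f t)]scalerBr; exact: addr_regroup.
have k1 : `|bint t (t + h) (fun r => v r - v t)| <= e * h / 3.
  have -> : e * h / 3 = e / 3 * h by ring.
  exact: le_trans (bint_norm (intgB Ivt (intg_cst _ _ _))) g1.
have IFf : intg t (t + h) (fun r => F r - T (t + h - r) (f t)).
  apply: intgB => //; apply: cts_intg => q qq e' e'0.
  have [|d d0 hd] := cts_T (f t) (t := t + h - q) _ e'0; first by lra.
  exists d => // s ss sq; apply: hd; first by lra.
  by rewrite (_ : t + h - s - (t + h - q) = q - s); [rewrite distrC|ring].
have ITf : intg t (t + h) (fun r => T (t + h - r) (f t) - f t).
  apply: intgB; last exact: intg_cst.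
  apply: cts_intg => q qq e' e'0.
  have [|d d0 hd] := cts_T (f t) (t := t + h - q) _ e'0; first by lra.
  exists d => // s ss sq; apply: hd; first by lra.
  by rewrite (_ : t + h - s - (t + h - q) = q - s); [rewrite distrC|ring].
(* The first part is small because [t] is a Lebesgue point of [f], the second by strong continuity
   of the semigroup at 0. *)
have -> : bint t (t + h) (fun r => F r - f t) =
   bint t (t + h) (fun r => F r - T (t + h - r) (f t)) +
   bint t (t + h) (fun r => T (t + h - r) (f t) - f t).
  by rewrite -(bintD IFf ITf); apply: bint_eq => r _; rewrite subrKA.
have k2 : `|bint t (t + h) (fun r => F r - T (t + h - r) (f t))| <= e * h / 3.
  apply: le_trans (bint_norm IFf) _.
  have Iff := intgB Ift (intg_cst t (t + h) (f t)).
  apply: le_trans (nint_le (intgZ M Iff) _) _.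
    apply: nearW => r rt; rewrite normrZ (ger0_norm M0) -T_sub; last by lra.
    by apply: TM; lra.
  rewrite (nintZ M Iff) (ger0_norm M0).
  apply: (@le_trans _ _ (M * (e / 3 / (M + 1) * h))); first by rewrite ler_wpM2l.
  apply: (@le_trans _ _ ((M + 1) * (e / 3 / (M + 1) * h))).
    by rewrite ler_wpM2r ?lerDl// mulr_ge0 ?divr_ge0// ltW.
  by rewrite le_eqVlt; apply/orP; left; apply/eqP; field; rewrite gt_eqF.
have k3 : `|bint t (t + h) (fun r => T (t + h - r) (f t) - f t)| <= e * h / 3.
  apply: le_trans (bint_norm ITf) _.
  have -> : e * h / 3 = e / 3 * (t + h - t) by ring.
  apply: (nint_bound th); apply: nearW => r rt; apply/ltW/h3.
  exact: window_range rt hd3.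
exact: norm_third k1 k2 k3.
Qed.

End Semigroups.

Lemma subr_split (V : zmodType) (u a b c : V) : u - (a + b) = (c - a) + ((u - c) - b).
Proof. by rewrite addrA (addrC (c - a)) subrKA opprD addrA. Qed.

(** The arithmetic of [strong_solution_MRp], kept apart: [a] and [b] stand for the bounds
    [C / (tau / 2)] of [A T (tau / 2)] and [M * (tau / 2)] of [smoothing], and [s1], [s2] for the
    two parts of the graph norm. *)
Lemma graph_estimate (R : realFieldType) (M a b x y t1 t2 t3 t4 s1 s2 s3 : R) :
  0 <= M -> 0 <= a -> 0 <= b -> 0 <= x -> 0 <= y ->
  t1 <= M * x -> t2 <= a * x -> t3 <= b * y -> t4 <= M * y ->
  s1 <= t1 + t3 -> s2 <= t2 + s3 -> s3 <= t4 + y ->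
  s1 + s2 <= ((M + b) + (a + (1 + M))) * (x + y).
Proof.
move=> M0 a0 b0 x0 y0 h1 h2 h3 h4 k1 k2 k3.
have m1 : 0 <= b * x by rewrite mulr_ge0.
have m2 : 0 <= a * y by rewrite mulr_ge0.
have m3 : 0 <= M * x by rewrite mulr_ge0.
have m4 : 0 <= M * y by rewrite mulr_ge0.
lra.
Qed.

(** * Strong solutions, MR_p and the trace space *)

Section StrongSolutions.
Context {R : realType} {V : completeNormedModType R}.
Variables (T : R -> V -> V) (tau C M p : R).
Hypothesis (hT : @C0_semigroup R Reals V T) (tau0 : 0 < tau) (p1 : 1 < p).
Hypothesis TM : forall t x, 0 <= t <= tau -> `|T t x| <= M * `|x|.
Hypothesis TD : forall t x, 0 < t <= tau -> @domA R Reals V T (T t x).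
Hypothesis TC : forall t x, 0 < t <= tau -> `|@opA R Reals V T (T t x)| <= C / t * `|x|.
Hypotheses (M0 : 0 <= M) (C0 : 0 <= C).
Local Notation domA := (@domA R Reals V T).
Local Notation opA := (@opA R Reals V T).
Local Notation Lp := (@Lp R Reals V p tau).
Local Notation smeas := (@strongly_measurable R Reals V setT (@rnorm R Reals V)).
Local Notation strong_solution := (@strong_solution R Reals V T p tau).
Local Notation MRp := (@MRp R Reals V T p tau).
Local Notation trp := (@trp R Reals V T p tau).
Implicit Types (x y : V) (t s r : R) (u v f g : R -> V).

Let p_ge0 : 0 <= p. Proof. by have := p1; lra. Qed.
Let p_ge1 : 1 <= p. Proof. exact: ltW. Qed.

Lemma W1p_withP u v : @W1p_with R Reals V p tau u v <-> Lp v /\ ac tau u v.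
Proof.
split=> [[/ctsP cu Lu Lv wd]|[Lv acuv]].
  split=> //; have Iv := Lp_intg p_ge1 Lv; split; first exact: Iv.
  exact: weak_derivative_ac tau0 cu Iv wd.
have cu := ac_cts acuv; have [Iv uv] := acuv.
split; [exact/ctsP|exact: Lp_cts|exact: Lv|exact: ac_weak_derivative (ltW tau0) Iv uv].
Qed.

Lemma W1pP u : @W1p R Reals V p tau u <-> exists2 v, Lp v & ac tau u v.
Proof.
by split=> [[v /W1p_withP[]]|[v Lv acuv]]; [exists v|exists v; apply/W1p_withP].
Qed.

Lemma strong_solutionP f u : strong_solution f u <-> exists v, [/\ Lp v, ac tau u v &
  {ae mu, forall t, 0 < t < tau -> domA (u t) /\ v t + opA (u t) = f t}].
Proof.
split=> [[v [/W1p_withP[Lv acuv] eq]]|[v [Lv acuv eq]]].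
  by exists v; split=> //; apply: filterS eq => t eq tt; apply: eq; rewrite in_itv.
exists v; split; first exact/W1p_withP.
by apply: filterS eq => t eq; rewrite in_itv => tt; apply: eq.
Qed.

Lemma ac_DZ u v u' v' (k : R) : ac tau u v -> ac tau u' v' ->
  ac tau (fun t => u t + k *: u' t) (fun t => v t + k *: v' t).
Proof.
move=> [Iv uv] [Iv' uv']; split; first exact: intgDZ.
move=> r s r0 rs st.
have I1 : intg r s v by apply: intg_sub Iv; lra.
have I2 : intg r s v' by apply: intg_sub Iv'; lra.
rewrite (bintDZ _ I1 I2) -uv// -uv'// [k *: (u' s - u' r)]scalerBr.
by rewrite opprD addrACA.
Qed.

Lemma strong_solutionDZ f u f' u' (k : R) : strong_solution f u -> strong_solution f' u' ->
  strong_solution (fun t => f t + k *: f' t) (fun t => u t + k *: u' t).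
Proof.
move=> /strong_solutionP[v [Lv acv eq]] /strong_solutionP[v' [Lv' acv' eq']].
apply/strong_solutionP; exists (fun t => v t + k *: v' t); split.
- exact: LpDZ.
- exact: ac_DZ.
apply: filterS2 eq eq' => t eq eq' tt.
have [d <-] := eq tt; have [d' <-] := eq' tt.
have [dd ->] := domA_lin hT k d d'; split; first exact: dd.
by rewrite [k *: (_ + _)]scalerDr addrACA.
Qed.

Lemma Lp_reflect f : Lp f -> Lp (fun t => f (tau - t)).
Proof.
move=> [sf If].
have mD : measurable (`]0, tau[%classic : set R) by [].
have E : mirror tau @^-1` `]0, tau[ = `]0, tau[%classic :> set R.
  by rewrite reflect_itv /= subrr subr0.
split; first by have := smeas_reflect tau mD sf; rewrite E.
by apply: (pfin_reflect p_ge0 _ If); apply: smeas_norm.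
Qed.

(** Reversal of time changes the sign of the derivative [v] and not that of [A u], and
    [- v + A u = (v + A u) - 2 v] is still in L^p. This solution carries the final value of [u] as
    its initial value. *)
Lemma strong_solution_reflect f u : Lp f -> strong_solution f u ->
  exists2 g, Lp g & strong_solution g (fun t => u (tau - t)).
Proof.
move=> Lf /strong_solutionP[v [Lv [Iv uv] eq]].
exists (fun t => f (tau - t) + -2 *: v (tau - t)); first exact: (LpDZ (-2) p_ge1 (Lp_reflect Lf) (Lp_reflect Lv)).
apply/strong_solutionP; exists (fun t => -1 *: v (tau - t)).
have Ir : intg 0 tau (fun t => v (tau - t)).
  by have := intg_reflect tau Iv; rewrite subrr subr0.
split.
- have L0 : Lp (fun=> 0).
    apply: Lp_cts => //; apply: (@lip_cts _ _ _ _ _ 0) => a b _ _ _.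
    by rewrite subrr normr0 mul0r.
  apply: (Lp_ae p_ge0 _ (LpDZ (-1) p_ge1 L0 (Lp_reflect Lv))).
  by apply: nearW => t _; rewrite add0r.
- split; first exact: intgZ.
  move=> r s r0 rs st.
  have Irs : intg (tau - s) (tau - r) v by apply: intg_sub Iv; lra.
  have Irs' : intg r s (fun t => v (tau - t)) by apply: intg_sub Ir; lra.
  have := bint_reflect tau Irs; rewrite !subKr => E.
  rewrite (bintZ _ Irs') E -uv; [by rewrite scaleN1r opprB|lra..].
have := ae_reflect tau eq; apply: filterS => t h tt.
have [|d <-] := h; first by lra.
split=> //; rewrite scaleN1r scaleNr scaler_nat mulr2n opprD.
by rewrite addrACA subrr add0r addrC.
Qed.

Lemma smeas_DZ f g (k : R) : smeas `]0, tau[ f -> smeas `]0, tau[ g ->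
  smeas `]0, tau[ (fun t => f t + k *: g t).
Proof.
have mD : measurable (`]0, tau[%classic : set R) by [].
move=> sf sg; apply: (@smeas_comp2 _ _ _ _ _ (fun x y => x + k *: y) _ _ _ mD sf sg).
by move=> xn yn x y cx cy; apply: cvgD => //; exact: cvgZr.
Qed.

Lemma graph_normE x : @graph_norm R Reals V T x = `|x| + `|opA x|.
Proof. by []. Qed.

(** The right-hand side is [v + A w], and the point is the strong measurability of [A w]: simple
    functions with values in D(A) that converge in the graph norm stay simple under [opA] and
    converge to it. *)
Lemma MRp_strong_solution w : MRp w -> exists2 f, Lp f & strong_solution f w.
Proof.
move=> [/W1pP[v Lv acv] [[fn [sfn dfn cfn]] fin]].
have cw := ac_cts acv; have [sv fv] := Lv.
have mD : measurable (`]0, tau[%classic : set R) by [].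
have sA : smeas `]0, tau[ (fun t => opA (w t)).
  exists (fun n t => opA (fn n t)); split=> //.
    by move=> n; exact: fsimple_comp (sfn n).
  apply: filterS cfn => t cfn tt; split=> //; have [dw cn] := cfn tt.
  have E n : opA (w t) - opA (fn n t) = opA (w t - fn n t).
    by have [_ ->] := domA_sub hT dw (dfn n t).
  suff H : `|opA (w t) - opA (fn n t)| @[n --> \oo] --> (0 : R) by exact: H.
  have c0 : (fun _ : nat => 0 : R) @ \oo --> (0 : R) by exact: cvg_cst.
  apply: (squeeze_cvgr _ c0 cn).
  apply: nearW => n; rewrite E normr_ge0 graph_normE lerDr /=; exact: normr_ge0.
exists (fun t => v t + opA (w t)); last first.
  apply/strong_solutionP; exists v; split=> //.
  by apply: filterS cfn => t cfn tt; have [] := cfn tt.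
apply: (@Lp_combine _ _ p tau 1 _ (fun t => `|v t|) (fun t => @graph_norm R Reals V T (w t))
  p_ge0 ler01 _ _ _ _ _ _ fv fin).
- have := smeas_DZ 1 sv sA; congr smeas; apply/funext => t; by rewrite scale1r.
- exact: smeas_norm mD sv.
- apply: (@smeas_comp2 _ _ _ _ _ (fun x y => `|x| + `|y|)) mD (cts_smeas cw) sA.
  by move=> xn yn x y cx cy; apply: cvgD; exact: cvg_norm.
- by move=> t; exact: normr_ge0.
- by move=> t; rewrite graph_normE addr_ge0.
apply: nearW => t _; rewrite mul1r graph_normE; apply: le_trans (ler_normD _ _) _.
by rewrite lerD2l lerDr.
Qed.

(** It maps into D(A), and on D(A) one has [x = T (tau / 2) x + smoothing (A x)]. The time [tau / 2]
    leaves room for the shifts by [h] in the computation of the generator, so that all times stay in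
    [[0, tau]]. *)
Definition smoothing x := bint 0 (tau / 2) (fun r => T r x).

Let half0 : 0 <= tau / 2. Proof. by have := tau0; lra. Qed.
Let halftau : tau / 2 <= tau. Proof. by have := tau0; lra. Qed.

Lemma intg_T x : intg 0 tau (T^~ x).
Proof. exact: cts_intg (cts_T hT TM x). Qed.

Lemma smoothing_sub x y : smoothing (x - y) = smoothing x - smoothing y.
Proof.
have I z : intg 0 (tau / 2) (T^~ z) by apply: intg_sub (intg_T z); have := tau0; lra.
rewrite /smoothing -(bintB (I x) (I y)); apply: bint_eq => r rr; apply: T_sub => //; lra.
Qed.

Lemma smoothing_norm x : `|smoothing x| <= M * (tau / 2) * `|x|.
Proof.
have I : intg 0 (tau / 2) (T^~ x) by apply: intg_sub (intg_T x); have := tau0; lra.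
apply: le_trans (bint_norm I) _.
have -> : M * (tau / 2) * `|x| = M * `|x| * (tau / 2 - 0) by ring.
apply: nint_bound half0 _; apply: nearW => r rr; apply: TM; have := halftau; move: rr => /andP[? ?] ?.
  by apply/andP; split; lra.
Qed.

(** [T h] shifts the window of integration, so the increment is the integral over []tau / 2, tau / 2
    + h[] minus that over []0, h[]. *)
Lemma gen_smoothing x : gen T (smoothing x) (T (tau / 2) x - x).
Proof.
move=> e e0; have e2 : 0 < e / 2 by rewrite divr_gt0.
have rd := right_deriv_bint (cts_T hT TM x).
have t0 := tau0.
have [|d1 d10 h1] := rd 0 _ _ e2; first by lra.
have [|d2 d20 h2] := rd (tau / 2) _ _ e2; first by lra.
exists (Num.min (Num.min d1 d2) (tau / 2)); first by rewrite !lt_min d10 d20; lra.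
move=> h /andP[h0]; rewrite !lt_min => /andP[/andP[hd1 hd2] hdt].
have I := intg_T x.
have := h1 h; rewrite h0 hd1 add0r => /(_ isT) {}h1.
have := h2 h; rewrite h0 hd2 => /(_ isT) {}h2.
have {}h1 : `|bint 0 h (T^~ x) - h *: x| <= e / 2 * h.
  have := h1 _; rewrite (bint_empty _ (lexx 0)) subr0 (T_id hT); apply; lra.
have {}h2 : `|bint 0 (tau / 2 + h) (T^~ x) - bint 0 (tau / 2) (T^~ x) - h *: T (tau / 2) x| <= e / 2 * h.
  by apply: h2; lra.
have I1 : intg 0 (tau / 2) (T^~ x) by apply: intg_sub I; lra.
have I2 : intg (0 + h) (tau / 2 + h) (T^~ x) by apply: intg_sub I; lra.
have I3 : intg 0 (tau / 2 + h) (T^~ x) by apply: intg_sub I; lra.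
have h0' := ltW h0; have hh : 0 <= h <= tau by lra.
have E : T h (smoothing x) = bint 0 (tau / 2 + h) (T^~ x) - bint 0 h (T^~ x).
  have [_ <-] := bint_op (fun x y => T_add hT x y h0') (fun k x => T_scale hT k x h0') (fun x => TM x hh) I1.
  have h3 : h <= tau / 2 + h by lra.
  rewrite (bint_split h0' h3 I3) addrAC subrr add0r -{2}(add0r h) -(bint_shift I2).
  apply: bint_eq => r rr; rewrite (addrC r) (T_semigroup hT)//; lra.
rewrite E; have -> : bint 0 (tau / 2 + h) (T^~ x) - bint 0 h (T^~ x) - smoothing x - h *: (T (tau / 2) x - x) =
  (bint 0 (tau / 2 + h) (T^~ x) - bint 0 (tau / 2) (T^~ x) - h *: T (tau / 2) x) - (bint 0 h (T^~ x) - h *: x).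
  by rewrite [h *: (_ - x)]scalerBr; exact: addr_regroup.
apply: le_trans (ler_normB _ _) _; rewrite (splitr e) mulrDl; exact: lerD.
Qed.

Lemma smoothing_opA x : domA x -> smoothing (opA x) = x - T (tau / 2) x.
Proof.
move=> dx; have t0 := tau0.
have c y : cts 0 (tau / 2) (T^~ y) by apply: cts_sub (cts_T hT TM y); lra.
have rd : right_deriv 0 (tau / 2) (T^~ x) (T^~ (- opA x)).
  move=> t tt e e0; have tt' : 0 <= t <= tau by lra.
  have [d d0 hd] := gen_T hT TM tt' (domA_gen dx) e0; exists d => // h hh _.
  rewrite (addrC t) (T_semigroup hT); [exact: hd|lra|lra].
have := fundamental_theorem half0 (c x) (c _) rd; rewrite (T_id hT) => E.
rewrite -[LHS]opprK -[RHS]opprK opprB E; congr (- _).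
have s0 := smoothing_sub (opA x) (opA x); rewrite !subrr in s0.
have s1 := smoothing_sub 0 (opA x); rewrite s0 !sub0r in s1.
exact: esym s1.
Qed.

(* If [x_n -> u] and [y_n -> A u] are simple, so is [T (tau / 2) x_n + smoothing y_n],
   which converges in the graph norm because [u = T (tau / 2) u + smoothing (A u)]. *)
Lemma strong_solution_MRp f u : Lp f -> strong_solution f u -> MRp u.
Proof.
move=> Lf /strong_solutionP[v [Lv acv eq]]; have t0 := tau0; have h0 := half0.
have cu := ac_cts acv; have [sv fv] := Lv; have Lu := Lp_cts p_ge0 cu.
have mD : measurable (`]0, tau[%classic : set R) by [].
have Lg := LpDZ (-1) p_ge1 Lf Lv.
have eqA : {ae mu, forall t, 0 < t < tau -> domA (u t) /\ opA (u t) = f t + -1 *: v t}.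
  apply: filterS eq => t eq tt; have [d <-] := eq tt; split; first exact: d.
  by rewrite scaleN1r addrAC subrr add0r.
split; first by apply/W1pP; exists v.
have tt2 : 0 < tau / 2 <= tau by lra.
have tt2' : 0 <= tau / 2 <= tau by lra.
split; last first.
  apply: (@pfin_combine R p tau 1 _ (fun t => `|u t|) (fun t => `|f t + -1 *: v t|) p_ge0 ler01 _ _ _ _ _ Lu.2 Lg.2).
  - exact: smeas_norm mD Lu.1.
  - exact: smeas_norm mD Lg.1.
  - by move=> t; exact: normr_ge0.
  - by move=> t; exact: normr_ge0.
  apply: filterS eqA => t eqA tt; have [_ <-] := eqA tt.
  by rewrite graph_normE mul1r addr_ge0 /=.
have [xn [sx _ cx]] := Lu.1; have [yn [sy _ cy]] := Lg.1.
exists (fun n t => T (tau / 2) (xn n t) + 1 *: smoothing (yn n t)); split.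
- by move=> n; exact: (fsimple_comp2 (fun x y => T (tau / 2) x + 1 *: smoothing y) (sx n) (sy n)).
- move=> n t; have [dy _] := gen_opA (gen_smoothing (yn n t)).
  by have [dd _] := domA_lin hT 1 (@TD _ (xn n t) tt2) dy.
pose K := (M + M * (tau / 2)) + (C / (tau / 2) + (1 + M)).
have Ct : 0 <= C / (tau / 2) by rewrite divr_ge0.
have Mt : 0 <= M * (tau / 2) by rewrite mulr_ge0.
apply: filterS2 (filterI cx cy) eqA => t [c1 c2] eqA tt.
have [d E] := eqA tt; split; first exact: d.
have [_ {}c1] := c1 tt; have [_ {}c2] := c2 tt.
have H n : @graph_norm R Reals V T (u t - (T (tau / 2) (xn n t) + 1 *: smoothing (yn n t))) <=
    K * (`|u t - xn n t| + `|f t + -1 *: v t - yn n t|).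
  have -> : u t - (T (tau / 2) (xn n t) + 1 *: smoothing (yn n t)) =
      T (tau / 2) (u t - xn n t) + 1 *: smoothing (f t + -1 *: v t - yn n t).
    have S1 := smoothing_sub (f t + -1 *: v t) (yn n t).
    have S2 := T_sub hT (u t) (xn n t) h0.
    have S3 := smoothing_opA d; rewrite E in S3; rewrite S3 in S1.
    rewrite S1 S2 [1 *: smoothing _]scale1r [1 *: (_ - smoothing _)]scale1r.
    exact: subr_split.
  set x := u t - xn n t; set y := f t + -1 *: v t - yn n t.
  have [dy Ey] := gen_opA (gen_smoothing y).
  have [_ Es] := domA_lin hT 1 (@TD _ x tt2) dy.
  rewrite graph_normE Es !scale1r Ey.
  have n5 := ler_normD (T (tau / 2) x) (smoothing y).
  have n6 := ler_normB (opA (T (tau / 2) x)) (T (tau / 2) y - y).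
  have n7 := ler_normB (T (tau / 2) y) y.
  rewrite opprB -opprB in n6 *.
  exact: (graph_estimate M0 Ct Mt (normr_ge0 x) (normr_ge0 y) (TM x tt2') (@TC _ x tt2)
    (smoothing_norm y) (TM y tt2') n5 n6 n7).
have c0 : (fun _ : nat => 0 : R) @ \oo --> (0 : R) by exact: cvg_cst.
have c3 : K * (`|u t - xn n t| + `|f t + -1 *: v t - yn n t|) @[n --> \oo] --> (0 : R).
  have <- : K * (0 + 0) = 0 by rewrite addr0 mulr0.
  by apply: cvgMr; apply: cvgD; [exact: c1|exact: c2].
apply: (squeeze_cvgr _ c0 c3).
by apply: nearW => n; rewrite H andbT graph_normE addr_ge0.
Qed.

Lemma trpP x : trp x <-> exists f u, [/\ Lp f, strong_solution f u & u 0 = x].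
Proof.
split=> [[w /MRp_strong_solution[f Lf sf] w0]|[f [u [Lf sf u0]]]]; first by exists f, w.
by exists u; [exact: strong_solution_MRp Lf sf|exact: u0].
Qed.

Lemma trp_end f u : Lp f -> strong_solution f u -> trp (u tau).
Proof.
move=> Lf /(strong_solution_reflect Lf)[g Lg sg]; apply/trpP.
by exists g, (fun t => u (tau - t)); split=> //; rewrite subr0.
Qed.

Lemma trpDZ x y (k : R) : trp x -> trp y -> trp (x + k *: y).
Proof.
move=> /trpP[f [u [Lf sf <-]]] /trpP[g [w [Lg sg <-]]]; apply/trpP.
exists (fun t => f t + k *: g t), (fun t => u t + k *: w t).
by split; [exact: LpDZ|exact: strong_solutionDZ|exact: erefl].
Qed.

End StrongSolutions.

(** * Hardy's inequality *)

Section Hardy.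
Context {R : realType}.
Implicit Types (g h : R -> R) (p t s r a b : R).

(** Above the level [A], [g = g]^ p * g [^ (1 - p)] and the negative power [1 - p] is largest at the
    level itself. *)
Lemma powR_threshold (g A p : R) : 0 <= g -> 0 < A -> 1 < p -> g <= A + g `^ p * A `^ (1 - p).
Proof.
move=> g0 A0 p1; have [gA|Ag] := leP g A.
  by rewrite (le_trans gA)// lerDl mulr_ge0 ?powR_ge0.
have p0 : 0 < p by lra.
rewrite -(mulr_powRB1 g0 p0) (_ : 1 - p = - (p - 1)); last by ring.
rewrite powRN -mulrA; apply: (@le_trans _ _ (g * (g `^ (p - 1) / A `^ (p - 1)))).
  rewrite ler_peMr// ler_pdivlMr ?powR_gt0// mul1r.
  by apply: ge0_ler_powR => //; rewrite ?nnegrE; lra.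
by rewrite lerDr ltW.
Qed.

(* Instead of Hoelder's inequality, the integrand is cut at the level
   [x * s `^ (- 2^-1)]; here [x] is chosen. *)
Lemma hardy_optimize (N t c p : R) : 0 < t -> 0 <= N -> 0 <= c -> 1 < p ->
  (forall x, 0 < x -> N <= 2 * x * t `^ (2^-1) + x `^ (1 - p) * c) ->
  (t^-1 * N) `^ p <= 4 `^ p * (t `^ (- (2^-1) - p / 2) * c).
Proof.
move=> t0; rewrite le_eqVlt => /predU1P[<- c0 p1 _|N0 c0 p1 H].
  rewrite mulr0 powR0; last by rewrite gt_eqF//; lra.
  by rewrite !mulr_ge0// powR_ge0.
set r := t `^ (2^-1) in H *; have r0 : 0 < r by exact: powR_gt0.
have rr : r * r = t.
  by rewrite -powRD; [rewrite (_ : 2^-1 + 2^-1 = 1); [rewrite powRr1// ltW|field]|rewrite (gt_eqF t0) implybT].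
(* With this [x] the first term of the bound equals [N / 2] and is absorbed by the left-hand
   side. *)
have [x x0 NE] : exists2 x, 0 < x & N = 4 * x * r.
  exists (N / (4 * r)); first by rewrite divr_gt0// mulr_gt0.
  by field; rewrite gt_eqF.
have := H x x0; rewrite {1}NE => Hx.
have xp : x `^ p = x * x `^ (p - 1) by rewrite mulr_powRB1//; lra.
have xm : x `^ (1 - p) * x `^ (p - 1) = 1.
  rewrite -powRD; last by rewrite (gt_eqF x0) implybT.
  by rewrite (_ : 1 - p + (p - 1) = 0); [rewrite powRr0|ring].
have q0 : 0 < x `^ (p - 1) by exact: powR_gt0.
have key : x `^ p * r <= c.
  have : 2 * (x * r) * x `^ (p - 1) <= x `^ (1 - p) * c * x `^ (p - 1).
    by apply: ler_wpM2r (ltW q0) _ _ _; lra.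
  rewrite (_ : x `^ (1 - p) * c * x `^ (p - 1) = c); last by rewrite mulrAC xm mul1r.
  have : 0 < x * x `^ (p - 1) * r by exact: mulr_gt0 (mulr_gt0 x0 q0) r0.
  rewrite xp; lra.
have -> : t^-1 * N = 4 * (x * r^-1).
  by rewrite NE -rr; field; rewrite gt_eqF.
have ri0 : 0 <= r^-1 by rewrite invr_ge0 ltW.
rewrite (powRM _ _ (mulr_ge0 (ltW x0) ri0))// ler_pM2l ?powR_gt0// (powRM _ (ltW x0) ri0).
rewrite powRD; last by rewrite (gt_eqF t0) implybT.
rewrite (powRN t 2^-1) -/r.
have -> : r^-1 `^ p = t `^ (- (p / 2)).
  by rewrite /r -powRN -powRrM; congr (_ `^ _); ring.
rewrite (_ : r^-1 * _ * c = t `^ (- (p / 2)) * (c / r)); last by ring.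
by rewrite mulrC ler_pM2l ?powR_gt0// ler_pdivlMr.
Qed.

Lemma integral_powR a b r : 0 < a -> a < b -> r != 0 ->
  (\int[mu]_(x in `]a, b[) (x `^ (r - 1))%:E <= ((b `^ r - a `^ r) / r)%:E)%E.
Proof.
move=> a0 ab r0.
have D (q x : R) : 0 < x -> derivable (fun y : R => y `^ q) x 1.
  by move=> xp; apply: derivable_powR; rewrite in_itv /= xp.
have cF (x : R) : 0 < x -> {for x, continuous (fun x => r^-1 * x `^ r)}.
  move=> x0; have c : {for x, continuous (fun y : R => y `^ r)}.
    by apply: differentiable_continuous; apply/derivable1_diffP; exact: D.
  by apply: cvgM; [exact: cvg_cst|exact: c].
have -> : ((b `^ r - a `^ r) / r)%:E = ((r^-1 * b `^ r)%:E - (r^-1 * a `^ r)%:E)%E.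
  by rewrite -EFinB; congr EFin; ring.
rewrite -(@continuous_FTC2 _ (fun x => x `^ (r - 1)) (fun x => r^-1 * x `^ r) a b ab).
- apply: ge0_subset_integral => //.
  + apply/measurable_EFinP; apply: measurable_funS measurableT _ (measurable_powR _) => //.
  + by move=> x _; rewrite lee_fin powR_ge0.
  + exact: subset_itv_oo_cc.
- apply: derivable_within_continuous => x; rewrite in_itv /= => /andP[ax _].
  by apply: D; lra.
- split=> [x||].
  + rewrite in_itv /= => /andP[ax _]; apply: derivableM; first exact: derivable_cst.
    by apply: D; lra.
  + by apply: cvg_at_right_filter; apply: cF.
  + by apply: cvg_at_left_filter; apply: cF; lra.
move=> x; rewrite in_itv /= => /andP[ax _]; have x0 : 0 < x by lra.
rewrite derive1E; have dd := is_derive1_powR r x0.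
have := is_deriveZ r^-1 dd => d2.
have [_ ->] := d2.
by rewrite /GRing.scale /= mulrA mulVf// mul1r.
Qed.

Lemma measurable_powR_comp (p : R) h : measurable_fun setT h ->
  measurable_fun setT (fun s => h s `^ p).
Proof. by move=> mh; apply: (measurableT_comp (measurable_powR p)). Qed.

Lemma hardy_tonelli h (c tau : R) : 0 < c -> (forall s, 0 <= h s) -> measurable_fun setT h ->
  (\int[mu]_(t in `]0%R, tau[) \int[mu]_(s in `]0%R, t[) (t `^ (- c - 1) * (h s * s `^ c))%:E <=
   (c^-1)%:E * \int[mu]_(s in `]0%R, tau[) (h s)%:E)%E.
Proof.
move=> c0 h0 mh; pose K t s : R := t `^ (- c - 1) * (h s * s `^ c).
have K0 t s : 0 <= K t s by rewrite /K !mulr_ge0// powR_ge0.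
pose b (z : measurableTypeR R * measurableTypeR R) : bool := (0 < z.2) && (z.2 < z.1) && (z.1 < tau).
(* The kernel is extended by 0 from the triangle [0 < s < t < tau] to the plane, where Tonelli's
   theorem applies. *)
pose k (z : measurableTypeR R * measurableTypeR R) : R := if b z then K z.1 z.2 else 0.
have mk : measurable_fun setT (EFin \o k).
  apply/measurable_EFinP; apply: measurable_fun_ifT.
  - apply: measurable_and; first apply: measurable_and; apply: measurable_fun_ltr => //;
      (exact: measurable_fst || exact: measurable_snd).
  - apply: measurable_funM.
      exact: (measurableT_comp (measurable_powR _) measurable_fst).
    apply: measurable_funM; first exact: (measurableT_comp mh measurable_snd).
    exact: (measurableT_comp (measurable_powR _) measurable_snd).
  - exact: measurable_cst.
have k0 z : (0 <= (EFin \o k) z)%E by rewrite /= /k; case: ifP => _; rewrite lee_fin.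
have E1 : (\int[mu]_(t in `]0%R, tau[) \int[mu]_(s in `]0%R, t[) (K t s)%:E =
           \int[mu]_t \int[mu]_s (k (t, s))%:E)%E.
  rewrite integral_mkcond; apply: eq_integral => t _; rewrite patchE.
  case: ifPn => [|nt].
    rewrite inE /= in_itv /= => /andP[t0 tt].
    rewrite integral_mkcond; apply: eq_integral => s _; rewrite patchE mem_setE in_itv /=.
    by rewrite /k /b /= tt andbT; case: ifP.
  apply/esym/integral0_eq => s _; rewrite /k /b /=; case: ifP => // /andP[/andP[s0 st] tt].
  by move: nt; rewrite notin_setE /= in_itv /= tt andbT (lt_trans s0 st).
rewrite E1 (fubini_tonelli (EFin \o k))// -ge0_integralZl_EFin//; last 3 first.
- by move=> s _; rewrite lee_fin.
- by apply/measurable_EFinP; exact: measurable_funS measurableT _ mh.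
- by rewrite invr_ge0 ltW.
rewrite [leRHS]integral_mkcond; apply: le_integral_ae => //.
- by move=> s _; apply: integral_ge0 => t _; exact: k0.
- by move=> s _; rewrite patchE; case: ifP => _ //; rewrite -EFinM lee_fin mulr_ge0// invr_ge0 ltW.
apply: nearW => s _; rewrite patchE; case: ifPn => [|ns]; last first.
  rewrite integral0_eq// => t _; rewrite /= /k /b /=; case: ifP => // /andP[/andP[s0 st] tt].
  by move: ns; rewrite notin_setE /= in_itv /= s0 (lt_trans st tt).
rewrite inE /= in_itv /= => /andP[s0 st].
have -> : (\int[mu]_t (EFin \o k) (t, s) = \int[mu]_(t in `]s, tau[) ((h s * s `^ c)%:E * (t `^ (- c - 1))%:E))%E.
  rewrite [RHS]integral_mkcond; apply: eq_integral => t _; rewrite patchE mem_setE in_itv /=.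
  by rewrite /k /b /= s0 /=; case: ifP => // _; rewrite /K mulrC EFinM.
have hs0 : 0 <= h s * s `^ c by rewrite mulr_ge0// powR_ge0.
rewrite ge0_integralZl_EFin//; last 2 first.
- by move=> t _; rewrite lee_fin powR_ge0.
- by apply/measurable_EFinP; apply: measurable_funS measurableT _ (measurable_powR _).
have cn0 : - c != 0 by rewrite oppr_eq0 gt_eqF.
apply: le_trans (lee_wpmul2l _ (integral_powR s0 st cn0)) _; first by rewrite lee_fin.
rewrite -!EFinM lee_fin.
have -> : (tau `^ (- c) - s `^ (- c)) / - c = c^-1 * (s `^ (- c) - tau `^ (- c)).
  by field; rewrite gt_eqF.
apply: (@le_trans _ _ (h s * s `^ c * (c^-1 * s `^ (- c)))).
  rewrite ler_wpM2l// ler_wpM2l ?invr_ge0 ?(ltW c0)// gerBl; exact: powR_ge0.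
rewrite (_ : _ * (c^-1 * _) = c^-1 * h s * (s `^ c * s `^ (- c))); last by ring.
by rewrite powRN mulfV ?mulr1// gt_eqF// powR_gt0.
Qed.

Lemma hardy_pointwise g (p t e x : R) : 1 < p -> (forall s, 0 <= g s) -> measurable_fun setT g ->
  0 < e -> e < t -> 0 < x ->
  (\int[mu]_(s in `]e, t[) (g s)%:E <= (2 * x * t `^ (2^-1))%:E +
    (x `^ (1 - p))%:E * \int[mu]_(s in `]0%R, t[) (g s `^ p * s `^ ((p - 1) / 2))%:E)%E.
Proof.
move=> p1 g0 mg e0 et x0; pose G s := g s `^ p * s `^ ((p - 1) / 2).
have G0 s : 0 <= G s by rewrite /G mulr_ge0// powR_ge0.
have mG : measurable_fun setT G.
  by apply: measurable_funM; [exact: measurable_powR_comp|exact: measurable_powR].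
have mGD (D : set R) : measurable_fun D (EFin \o G).
  by apply/measurable_EFinP; exact: measurable_funS measurableT _ mG.
have mW (D : set R) (q : R) : measurable_fun D (fun s => (s `^ q)%:E).
  by apply/measurable_EFinP; apply: measurable_funS measurableT _ (measurable_powR _).
apply: (@le_trans _ _ (\int[mu]_(s in `]e, t[) (x%:E * (s `^ (2^-1 - 1))%:E + (x `^ (1 - p))%:E * (G s)%:E))%E).
  apply: le_integral_ae => //.
  - by move=> s _; rewrite lee_fin.
  - by move=> s _; rewrite -!EFinM -EFinD lee_fin addr_ge0// mulr_ge0 ?powR_ge0// ltW.
  apply: nearW => s; rewrite /= in_itv /= => /andP[es _]; have s0 : 0 < s by lra.
  rewrite -!EFinM -EFinD lee_fin.
  have A0 : 0 < x * s `^ (2^-1 - 1) by rewrite mulr_gt0// powR_gt0.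
  apply: le_trans (powR_threshold (g0 s) A0 p1) _; rewrite lerD2l.
  rewrite powRM ?powR_ge0 ?(ltW x0)// -powRrM (_ : (2^-1 - 1) * (1 - p) = (p - 1) / 2); last by field.
  by rewrite mulrCA.
rewrite ge0_integralD//; last 4 first.
- by move=> s _; rewrite -EFinM lee_fin mulr_ge0 ?powR_ge0// ltW.
- exact: measurable_funeM (mW _ _).
- by move=> s _; rewrite -EFinM lee_fin mulr_ge0 ?powR_ge0// ltW.
- exact: measurable_funeM (mGD _).
rewrite !ge0_integralZl_EFin ?powR_ge0 ?(ltW x0)//; try by move=> s _; rewrite lee_fin ?powR_ge0.
have n0 : 2^-1 != 0 :> R by rewrite invr_eq0.
apply: leeD.
- apply: le_trans (lee_wpmul2l _ (integral_powR e0 et n0)) _; first by rewrite lee_fin ltW.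
  rewrite -EFinM lee_fin invrK mulrA -mulrA [leRHS](_ : _ = x * (t `^ 2^-1 * 2)); last by ring.
  by rewrite ler_wpM2l ?(ltW x0)// ler_wpM2r// gerBl powR_ge0.
- apply: lee_wpmul2l; first by rewrite lee_fin powR_ge0.
  apply: ge0_subset_integral; [by []|by []|exact: mGD|by move=> s _; rewrite lee_fin|].
  by apply: itvoo_sub => //; exact: ltW.
- exact: mGD.
- exact: mW.
Qed.

Context {V : completeNormedModType R}.

Lemma hardy_inequality (p tau : R) (v : R -> V) : 1 < p -> 0 < tau ->
  @Lp R Reals V p tau v -> pfin p tau (fun t => t^-1 * nint 0 t v).
Proof.
move=> p1 tau0 Lv; have Iv := Lp_intg (ltW p1) Lv; have [sv fv] := Lv.
have mD : measurable (`]0, tau[%classic : set R) by [].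
have /(strongly_measurableP _ mD)[g0 b eg] := sv.
pose g s := `|g0 s|; have g_ge0 s : 0 <= g s by exact: normr_ge0.
have mg : measurable_fun setT g := borel_strong_norm b.
pose c := (p - 1) / 2; have c0 : 0 < c by rewrite /c; lra.
have N e t : 0 <= e -> t <= tau -> (nint e t v)%:E = (\int[mu]_(s in `]e, t[) (g s)%:E)%E.
  move=> e0 tt; rewrite -nintE; last exact: intg_sub Iv.
  apply: intnorm_ae => //; apply: filterS eg => s eg; rewrite /= in_itv /= => st.
  by apply: eg; rewrite /= in_itv /=; lra.
have four0 : (0:R) <= 4 by [].
have h1 : (\int[mu]_(t in `]0%R, tau[) ((t^-1 * nint 0 t v) `^ p)%:E <=
  \int[mu]_(t in `]0%R, tau[) \int[mu]_(s in `]0%R, t[) (t `^ (- c - 1) * ((4 `^ p * g s `^ p) * s `^ c))%:E)%E.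
  apply: le_integral_ae => //.
  - by move=> t _; rewrite lee_fin powR_ge0.
  - by move=> t _; apply: integral_ge0 => s _; rewrite lee_fin !mulr_ge0// powR_ge0.
  apply: nearW => t; rewrite /= in_itv /= => /andP[t0 tt].
  have -> : (\int[mu]_(s in `]0%R, t[) (t `^ (- c - 1) * ((4 `^ p * g s `^ p) * s `^ c))%:E =
     (4 `^ p * t `^ (- c - 1))%:E * \int[mu]_(s in `]0%R, t[) (g s `^ p * s `^ c)%:E)%E.
    rewrite -ge0_integralZl_EFin ?mulr_ge0 ?powR_ge0//; last 2 first.
    - by move=> s _; rewrite lee_fin mulr_ge0// powR_ge0.
    - apply/measurable_EFinP/measurable_funTS; apply: measurable_funM.
        exact: measurable_powR_comp.
      exact: measurable_powR.
    by apply: eq_integral => s _; rewrite -EFinM; congr EFin; ring.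
  have : (0 <= \int[mu]_(s in `]0%R, t[) (g s `^ p * s `^ c)%:E)%E.
    by apply: integral_ge0 => s _; rewrite lee_fin mulr_ge0// powR_ge0.
  have H e x := @hardy_pointwise g p t e x p1 g_ge0 mg; move: H; rewrite -/c.
  (* If the weighted integral is infinite, so is the right-hand side and the bound is trivial. *)
  case: (\int[mu]_(s in _) _)%E => [G||] H //; last first.
    by move=> _; rewrite gt0_muley ?leey// lte_fin mulr_gt0// powR_gt0.
  rewrite lee_fin => G0; rewrite -EFinM lee_fin -mulrA.
  rewrite (_ : - c - 1 = - 2^-1 - p / 2); last by rewrite /c; field.
  apply: hardy_optimize => //; first exact: nint_ge0.
  move=> x x0; apply/ler_addgt0Pr => e e0.
  have [d d0 hd] := nint_small Iv e0.
  (* The pointwise estimate covers []a, t[]; what is left over []0, a[] is below [e] by absolute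
     continuity of the integral. *)
  pose a := Num.min (d / 2) (t / 2).
  have a0 : 0 < a by rewrite lt_min !divr_gt0.
  have ad : a <= d / 2 by rewrite /a ge_min lexx.
  have at2 : a <= t / 2 by rewrite /a ge_min lexx orbT.
  have at_ : a < t by lra.
  have It : intg 0 t v by apply: intg_sub Iv; lra.
  rewrite (nint_split (ltW a0) (ltW at_) It) addrC; apply: lerD.
    by have := H a x a0 at_ x0; rewrite -(N _ _ (ltW a0) (ltW tt)) -EFinM -EFinD lee_fin.
  by apply/ltW/hd; lra.
apply: le_lt_trans h1 _; apply: le_lt_trans (hardy_tonelli tau c0 _ _) _.
- by move=> s; rewrite mulr_ge0// powR_ge0.
- by apply: measurable_funM => //; exact: measurable_powR_comp.
have c1 : 0 <= c^-1 by rewrite invr_ge0 ltW.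
apply: lte_mul_pinfty; [by rewrite lee_fin|by []|].
have -> : (\int[mu]_(s in `]0%R, tau[) (4 `^ p * g s `^ p)%:E = (4 `^ p)%:E * \int[mu]_(s in `]0%R, tau[) (g s `^ p)%:E)%E.
  rewrite -ge0_integralZl_EFin ?powR_ge0//.
  - by move=> s _; rewrite lee_fin powR_ge0.
  - by apply/measurable_EFinP/measurable_funTS; exact: measurable_powR_comp.
apply: lte_mul_pinfty; [by rewrite lee_fin powR_ge0|by []|].
have -> : (\int[mu]_(s in `]0%R, tau[) (g s `^ p)%:E = \int[mu]_(s in `]0%R, tau[) (`|v s| `^ p)%:E)%E.
  apply: eq_integral_ae; first by [].
  - by move=> s _; rewrite lee_fin powR_ge0.
  - by move=> s _; rewrite lee_fin powR_ge0.
  by apply: filterS eg => s eg /eg ->.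
exact: fv.
Qed.

End Hardy.

(** * The equivalence on a real Banach space *)

Lemma subr_regroup3 (V : zmodType) (a b c d : V) : a - b - (c + (a - d)) = (d - b) - c.
Proof. by rewrite opprD opprB addrCA (addrC (a - b)) subrKA addrC. Qed.

Lemma subr_swap (V : zmodType) (x y a b : V) : x - a = y - b -> x - y = a - b.
Proof. by move=> E; rewrite -(subrK a x) E addrAC [y - b - y]addrAC subrr add0r addrC. Qed.

Section RealSpaces.
Context {R : realType} {V : completeNormedModType R}.
Variables (T : R -> V -> V) (tau C M p : R).
Hypothesis (hT : @C0_semigroup R Reals V T) (tau0 : 0 < tau) (p1 : 1 < p).
Hypothesis TM : forall t x, 0 <= t <= tau -> `|T t x| <= M * `|x|.
Hypothesis TD : forall t x, 0 < t <= tau -> @domA R Reals V T (T t x).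
Hypothesis TC : forall t x, 0 < t <= tau -> `|@opA R Reals V T (T t x)| <= C / t * `|x|.
Hypotheses (M0 : 0 <= M) (C0 : 0 <= C).
Local Notation domA := (@domA R Reals V T).
Local Notation opA := (@opA R Reals V T).
Local Notation Lp := (@Lp R Reals V p tau).
Local Notation smeas := (@strongly_measurable R Reals V setT (@rnorm R Reals V)).
Local Notation strong_solution := (@strong_solution R Reals V T p tau).
Local Notation trp := (@trp R Reals V T p tau).
Local Notation SSP := (strong_solutionP T tau0 p1).
Local Notation trpP := (trpP hT tau0 p1 TM TD TC M0 C0).
Implicit Types (x y : V) (t s r : R) (u v f g : R -> V).

Let p_ge1 : 1 <= p. Proof. exact: ltW. Qed.
Let p_ge0 : 0 <= p. Proof. by have := p1; lra. Qed.

(** Continuity near each interior point is asked for because [A T(t) x] and [t^-1] need not stay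
    bounded at 0. *)
Lemma cts_oo_smeas (W : completeNormedModType R) (a b : R) (f : R -> W) :
  (forall t, a < t < b -> exists a' b', [/\ a' < t, t < b' & cts a' b' f]) ->
  @strongly_measurable R Reals W setT (@rnorm R Reals W) `]a, b[ f.
Proof.
move=> cf; apply: (@smeas_continuous_comp _ _ R a b (fun r _ => f r) (fun=> 0)); last exact: smeas_cst.
move=> rn xn t x rnab tab rnt _; have [a' [b' [at' tb' c]]] := cf t tab.
apply/cvgrPdist_lt => e e0; have [|d d0 hd] := c t _ e e0; first by rewrite !ltW.
pose d' := Num.min d (Num.min (t - a') (b' - t)).
have d'0 : 0 < d' by rewrite !lt_min d0 !subr_gt0 at' tb'.
move/cvgrPdist_lt : rnt => /(_ _ d'0); apply: filterS => n.
rewrite !lt_min => /andP[h1 /andP[h2 h3]]; rewrite distrC; apply: hd; last by rewrite distrC.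
by move: h2 h3; rewrite !ltr_norml => /andP[? ?] /andP[? ?]; apply/andP; split; lra.
Qed.

Lemma nint_cts (a b : R) v : intg a b v -> cts a b (fun t => nint a t v).
Proof.
move=> Iv t tab e e0; have [d d0 hd] := nint_small Iv e0; exists d => // s sab.
wlog ts : s t sab tab / t <= s => [H|].
  have [ts|/ltW st] := leP t s; first exact: H.
  by rewrite distrC => ?; rewrite distrC; apply: H.
rewrite ger0_norm ?subr_ge0// => std; have /andP[at_ _] := tab.
have I : intg a s v by apply: intg_sub Iv; lra.
rewrite (nint_split at_ ts I) addrAC subrr add0r ger0_norm ?nint_ge0//.
by apply: hd => //; lra.
Qed.

Lemma smeas_average (tau' : R) v : intg 0 tau' v ->
  @strongly_measurable R Reals R setT (@rnorm R Reals R) `]0, tau'[ (fun t => t^-1 * nint 0 t v).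
Proof.
move=> Iv; have sn := cts_smeas (nint_cts Iv).
apply: (@smeas_continuous_comp _ R R 0 tau' (fun t (y : R) => t^-1 * y : R)) sn.
move=> rn xn t x _ /andP[t0 _] rnt xnx; apply: cvgM xnx.
by apply: cvgV => //; rewrite gt_eqF.
Qed.

Lemma AT_smeas x : smeas `]0, tau[ ((AT T)^~ x).
Proof.
apply: cts_oo_smeas => t /andP[t0 tt]; exists (t / 2), tau; split=> //; first lra.
by apply: (cts_AT hT TM TD); lra.
Qed.

Lemma orbit_strong_solution x : trp x -> strong_solution (fun=> 0) (fun t => T t x).
Proof.
move=> /trpP[f [u [Lf /SSP[v [Lv acv eq]] u0]]].
have [Iv uv] := acv.
have LA : Lp (fun t => -1 *: AT T t x).
  have L1 := LpDZ (-1) p_ge1 Lf Lv.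
  (* [h1] is the term for Hardy's inequality; [h2] is [|A u|] almost everywhere, by the equation for
     [u]. *)
  pose h1 t := `|t^-1 * nint 0 t v|; pose h2 t := `|f t + -1 *: v t|.
  have b1 : {ae mu, forall t, 0 < t < tau -> `|-1 *: AT T t x| <= (C + M) * (h1 t + h2 t)}.
    apply: filterS eq => t eq tt; have [d e] := eq tt.
    have tt1 : 0 < t <= tau by lra.
    have tt2 : 0 <= t <= tau by lra.
    have -> : AT T t x = AT T t (x - u t) + T t (opA (u t)).
      have [_ <-] := domA_T hT TM tt2 d.
      by rewrite (AT_sub hT TD _ _ tt1) subrK.
    rewrite normrZ normrN normr1 mul1r.
    have k1 : `|x - u t| <= nint 0 t v.
      rewrite -u0 distrC uv; [|lra..].
      by apply: bint_norm; apply: intg_sub Iv; lra.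
    have k2 := @TC t (x - u t) tt1; have k3 := TM (opA (u t)) tt2.
    have k4 : opA (u t) = f t + -1 *: v t by rewrite -e scaleN1r addrAC subrr add0r.
    rewrite k4 in k3 *; have k5 := ler_normD (AT T t (x - u t)) (T t (f t + -1 *: v t)).
    apply: le_trans k5 _.
    have h10 : 0 <= h1 t by exact: normr_ge0.
    have h20 : 0 <= h2 t by exact: normr_ge0.
    apply: (@le_trans _ _ (C * h1 t + M * h2 t)); last first.
      have := mulr_ge0 C0 h20; have := mulr_ge0 M0 h10; lra.
    apply: lerD k3; apply: le_trans k2 _; rewrite -mulrA ler_wpM2l//.
    apply: le_trans (ler_norm _); rewrite ler_wpM2l// invr_ge0; lra.
  apply: (@Lp_combine R V p tau (C + M) _ h1 h2 p_ge0 _ _ _ _ _ _ b1).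
  - by rewrite addr_ge0.
  - have := smeas_DZ (-1) (smeas_cst `]0, tau[ 0) (AT_smeas x); congr smeas; apply/funext => t; by rewrite add0r.
  - exact: smeas_norm (smeas_average Iv).
  - exact: smeas_norm L1.1.
  - by move=> t; exact: normr_ge0.
  - by move=> t; exact: normr_ge0.
  - apply: (@pfin_le R p tau _ _ p_ge0 _ (hardy_inequality p1 tau0 Lv)).
    apply: nearW => t tt; rewrite /h1 normr_ge0 /= ger0_norm// mulr_ge0 ?nint_ge0// invr_ge0; lra.
  - exact: L1.2.
have IA := Lp_intg p_ge1 LA.
apply/SSP; exists (fun t => -1 *: AT T t x); split; first exact: LA.
- split; first exact: IA.
  have pos r s : 0 < r -> r <= s -> s <= tau -> T s x - T r x = bint r s (fun t => -1 *: AT T t x).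
    move=> r0 rs st; have IAr : intg r s ((AT T)^~ x) by exact: cts_intg (cts_AT hT TM TD x r0 st).
    by rewrite (T_ftc hT TM TD x r0 rs st) (bintZ _ IAr) scaleN1r.
  move=> r s; rewrite le_eqVlt => /predU1P[<-|]; last exact: pos.
  move=> s0 st; rewrite (T_id hT); have [->|sn0] := eqVneq s 0.
    by rewrite (T_id hT) bint_empty// subrr.
  have {sn0}sp : 0 < s by rewrite lt_neqAle eq_sym sn0.
  apply/eqP; rewrite -subr_eq0 -normr_le0; apply/ler_addgt0Pr => e e0; rewrite add0r.
  have e2 : 0 < e / 2 by rewrite divr_gt0.
  have [d1 d10 h1] := T_cvg0 hT x e2.
  have [d2 d20 h2] := nint_small IA e2.
  pose r' := Num.min (Num.min (d1 / 2) (d2 / 2)) s.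
  have r0 : 0 < r' by rewrite !lt_min sp !divr_gt0.
  have rd1 : r' <= d1 / 2 by rewrite /r' !ge_min lexx.
  have rd2 : r' <= d2 / 2 by rewrite /r' !ge_min lexx orbT.
  have rs : r' <= s by rewrite /r' !ge_min lexx orbT.
  have IAs : intg 0 s (fun t => -1 *: AT T t x) by apply: intg_sub IA; lra.
  rewrite (bint_split (ltW r0) rs IAs) -(pos r' s r0 rs st).
  have E : T s x - x - (bint 0 r' (fun t => -1 *: AT T t x) + (T s x - T r' x)) =
      (T r' x - x) - bint 0 r' (fun t => -1 *: AT T t x) by exact: subr_regroup3.
  rewrite E; apply: le_trans (ler_normB _ _) _; rewrite (splitr e); apply: lerD.
    by apply/ltW/h1; lra.
  apply: le_trans (bint_norm _) _; first by apply: intg_sub IA; lra.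
  by apply/ltW/h2; lra.
apply: nearW => t tt; have tt1 : 0 < t <= tau by lra.
by split; [exact: TD|rewrite scaleN1r addNr].
Qed.

Lemma strong_solution_formula f u : Lp f -> strong_solution f u -> forall t, 0 <= t <= tau ->
  u t = T t (u 0) + bint 0 t (fun r => T (t - r) (f r)).
Proof.
move=> Lf /SSP[v [Lv acv eq]].
exact: (variation_of_constants hT TM TD TC M0 C0 acv (Lp_intg p_ge1 Lf) eq).
Qed.

Lemma strong_solution_diff f u u' : Lp f -> strong_solution f u -> strong_solution f u' ->
  forall t, 0 <= t <= tau -> u' t - u t = T t (u' 0 - u 0).
Proof.
move=> Lf sf sf' t tt; have t0 : 0 <= t by lra.
rewrite (strong_solution_formula Lf sf tt) (strong_solution_formula Lf sf' tt) (T_sub hT _ _ t0).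
by rewrite opprD addrACA subrr addr0.
Qed.

Lemma Lp0 : Lp (fun=> 0).
Proof.
apply: Lp_cts => //; apply: (@lip_cts _ _ _ _ _ 0) => a b _ _ _.
by rewrite subrr normr0 mul0r.
Qed.

Lemma trp0 : trp 0.
Proof.
apply/trpP; exists (fun=> 0), (fun=> 0); split; [exact: Lp0| |by []].
apply/SSP; exists (fun=> 0); split; [exact: Lp0| |].
  split; first exact: intg_cst.
  by move=> r s _ _ _; rewrite bint0 subrr.
have [|d E] := @gen_opA _ _ T 0 0.
  move=> e e0; exists tau => // h /andP[h0 _].
  by rewrite (T_0 hT (ltW h0)) scaler0 !subr0 normr0 mulr_ge0// ltW.
by apply: nearW => t _; rewrite E oppr0 addr0.
Qed.

Lemma trp_sub x y : trp x -> trp y -> trp (x - y).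
Proof. by move=> tx ty; rewrite -scaleN1r; apply: trpDZ hT tau0 p1 TM TD TC M0 C0 _ _ _ tx ty. Qed.

Lemma trp_add x y : trp x -> trp y -> trp (x + y).
Proof. by move=> tx ty; rewrite -[y]scale1r; apply: trpDZ hT tau0 p1 TM TD TC M0 C0 _ _ _ tx ty. Qed.

Lemma trp_flow x : trp x -> trp (T tau x).
Proof.
move=> /orbit_strong_solution so.
exact: (trp_end hT tau0 p1 TM TD TC M0 C0 Lp0 so).
Qed.

Lemma convolutionE f : @convolution R Reals V T f = fun t => bint 0 t (fun r => T (t - r) (f r)).
Proof. by apply/funext => t; rewrite bintE. Qed.

Lemma convolution_solution f : Lp f ->
  @W1p R Reals V p tau (@convolution R Reals V T f) ->
  strong_solution f (@convolution R Reals V T f).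
Proof.
rewrite convolutionE => Lf /(W1pP tau0 p1)[v Lv acv]; apply/SSP; exists v; split; [exact: Lv|exact: acv|].
have K := conv_strong hT TM M0 (Lp_intg p_ge1 Lf) acv.
exact: K.
Qed.

Lemma solution_convolution f u : Lp f -> strong_solution f u -> trp (u 0) ->
  @W1p R Reals V p tau (@convolution R Reals V T f).
Proof.
move=> Lf sf /orbit_strong_solution /SSP[v' [Lv' acv' _]].
have /SSP[v [Lv acv _]] := sf; apply/(W1pP tau0 p1).
exists (fun t => v t + -1 *: v' t); first exact: LpDZ (-1) p_ge1 Lv Lv'.
have [I E] := ac_DZ (-1) acv acv'; split; first exact: I.
have F t : 0 <= t <= tau -> @convolution R Reals V T f t = u t + -1 *: T t (u 0).
  by move=> tt; rewrite convolutionE (strong_solution_formula Lf sf tt) scaleN1r addrAC subrr add0r.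
move=> r s r0 rs st; rewrite -(E r s r0 rs st) !F; [by []|lra..].
Qed.

Lemma period_map_equivalence (Phi : V -> V) :
  (forall x, trp x -> trp (Phi x)) ->
  (forall (a : R) x y, trp x -> trp y -> Phi (a *: x + y) = a *: Phi x + Phi y) ->
  (@maximal_regularity R Reals V T p tau /\ set_bij trp trp (fun x => x - Phi (T tau x)))
  <-> @maximal_Lp_regularity R Reals V T p tau Phi.
Proof.
move=> Phi_trp Phi_lin; have t00 := tau0.
have tautau : 0 <= tau <= tau by lra.
have zerotau : 0 <= (0 : R) <= tau by rewrite lexx ltW.
have PhiD x y : trp x -> trp y -> Phi (x + y) = Phi x + Phi y.
  by move=> tx ty; have := Phi_lin 1 x y tx ty; rewrite !scale1r.
have PhiB x y : trp x -> trp y -> Phi (x - y) = Phi x - Phi y.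
  by move=> tx ty; have := Phi_lin (-1) y x ty tx; rewrite !scaleN1r ![- _ + _]addrC.
have Phi0 : Phi 0 = 0 by have := PhiB 0 0 trp0 trp0; rewrite !subrr.
split=> [[MR [_ inj surj]] f Lf|H].
  have sw := convolution_solution Lf (MR f Lf); set w := @convolution R Reals V T f in sw.
  have w0 : w 0 = 0 by rewrite /w convolutionE bint_empty.
  have tw : trp (w tau) := trp_end hT tau0 p1 TM TD TC M0 C0 Lf sw.
  have [x tx Ex] := surj _ (Phi_trp _ tw).
  have sx := orbit_strong_solution tx.
  have su : strong_solution f (fun t => T t x + 1 *: w t).
    have := strong_solutionDZ hT tau0 p1 1 sx sw.
    by congr strong_solution; apply/funext => t; rewrite add0r scale1r.
  exists (fun t => T t x + 1 *: w t); split.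
    split; first exact: su.
    rewrite w0 scaler0 addr0 (T_id hT) scale1r PhiD//; last exact: trp_flow.
    by rewrite -Ex addrC subrK.
  move=> u' su' u'0 t tt; set u := fun t => _ in su *.
  have u0 : u 0 = Phi (u tau).
    rewrite /u w0 scaler0 addr0 (T_id hT) scale1r PhiD//; last exact: trp_flow.
    by rewrite -Ex addrC subrK.
  have D := strong_solution_diff Lf su su'.
  have t0 : trp (u 0) by apply/trpP; exists f, u.
  have t0' : trp (u' 0) by apply/trpP; exists f, u'.
  have t1 := trp_end hT tau0 p1 TM TD TC M0 C0 Lf su.
  have t1' := trp_end hT tau0 p1 TM TD TC M0 C0 Lf su'.
  (* Two solutions differ by the orbit of [u' 0 - u 0], so the boundary conditions put this
     difference into the kernel of [x |-> x - Phi (T tau x)] on the trace space. *)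
  have E : u' 0 - u 0 = 0.
    apply: inj; rewrite ?inE; [exact: trp_sub|exact: trp0|].
    by rewrite -D// (PhiB _ _ t1' t1) u'0 u0 subrr (T_0 hT (ltW tau0)) Phi0 subrr.
  by apply/eqP; rewrite -subr_eq0 D// E T_0//; lra.
have sol f : Lp f -> exists u, [/\ strong_solution f u, trp (u 0) & u 0 = Phi (u tau)].
  by move=> Lf; have [u [[su u0] _]] := H f Lf; exists u; split=> //; apply/trpP; exists f, u.
split; [|split].
- by move=> f Lf; have [u [su tu _]] := sol f Lf; exact: solution_convolution Lf su tu.
- by move=> x tx; apply: trp_sub => //; apply: Phi_trp; exact: trp_flow.
- move=> x y; rewrite !inE => tx ty E.
  have td := trp_sub tx ty.
  have E' : x - y = Phi (T tau (x - y)).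
    rewrite (T_sub hT _ _ (ltW tau0)) PhiB; [|exact: trp_flow..].
    exact: subr_swap E.
  have [u [_ uniq]] := H _ Lp0.
  (* The orbits of [x - y] and of 0 both solve the homogeneous problem with the boundary condition,
     hence start at the same point. *)
  have e1 := uniq _ (orbit_strong_solution td) _ 0 zerotau.
  have e2 := uniq _ (orbit_strong_solution trp0) _ 0 zerotau.
  apply/eqP; rewrite -subr_eq0; rewrite -(T_id hT (x - y)) e1; last by rewrite (T_id hT).
  rewrite -e2; first by rewrite (T_id hT).
  by rewrite (T_id hT) (T_0 hT (ltW tau0)) Phi0.
move=> y ty; pose f r := tau^-1 *: T r y.
have cf : cts 0 tau f.
  apply: (@cts_eq _ _ _ _ (fun t => 0 + tau^-1 *: T t y)); first by move=> t _; rewrite add0r.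
  apply: ctsDZ (cts_T hT TM y); apply: (@lip_cts _ _ _ _ _ 0) => a b _ _ _.
  by rewrite subrr normr0 mul0r.
have Lf : Lp f by exact: Lp_cts.
have [u [su tu u0]] := sol f Lf.
(* Once [T tau (u 0 + y) = u tau] is known, [Phi] sends it to [u 0], and subtracting leaves [y]. *)
exists (u 0 + y); first exact: trp_add.
have -> : T tau (u 0 + y) = u tau.
  rewrite (strong_solution_formula Lf su tautau) (T_add hT _ _ (ltW tau0)); congr (_ + _).
  rewrite (@bint_eq _ _ _ _ _ (fun=> tau^-1 *: T tau y)).
    rewrite (bint_cst _ (ltW tau0)) subr0 scalerA mulfV ?scale1r// gt_eqF//.
  move=> r rt; rewrite /f (T_scale hT); [|lra].
  by rewrite -(T_semigroup hT) ?subrK//; lra.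
by rewrite -u0 addrAC subrr add0r.
Qed.

End RealSpaces.

(** * The Cauchy estimate *)

Lemma addr_regroup_diff (V : zmodType) (a1 a2 a3 b1 b3 x : V) :
  a1 + b1 + x - a2 - (a3 - b3) = (a1 - a2 - a3) + (b1 + b3) + x.
Proof. by rewrite opprB [LHS](AC (4*2)%AC ((1*4*6)*(2*5)*3)%AC). Qed.

Lemma addr_residual (V : zmodType) (x a b : V) : x = a + b + (x - a - b).
Proof. by rewrite -[x - a - b]addrA -opprD [RHS]addrC subrK. Qed.

Lemma subr_scalerDl (R : pzRingType) (V : lmodType R) (a b : R) (x y : V) :
  x - a *: y - b *: y = x - (a + b) *: y.
Proof. by rewrite scalerDl opprD addrA. Qed.

Section ContinuousScaling.
Context {R : realType} {Y : completeNormedModType R}.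
Implicit Types (a b : R) (f g : R -> Y) (k : R -> R).

Lemma trig_expansion (x e : R) : 0 < e -> exists2 d : R, 0 < d & forall h, 0 < h < d ->
  `|sin (x + h) - sin x - h * cos x| <= e * h /\
  `|cos (x + h) - cos x + h * sin x| <= e * h.
Proof.
move=> e0.
have ds (t : R) : derivable (@sin R) t 1 by have [] := is_derive_sin t.
have dc (t : R) : derivable (@cos R) t 1 by have [] := is_derive_cos t.
have xx : x <= x < x + 1 by rewrite lexx ltrDl ltr01.
have [d1 d10 h1] := derivable_right_deriv (1 : R) ds xx e0.
have [d2 d20 h2] := derivable_right_deriv (1 : R) dc xx e0.
exists (Num.min (Num.min d1 d2) 1); first by rewrite !lt_min d10 d20 ltr01.
move=> h /andP[h0]; rewrite !lt_min => /andP[/andP[hd1 hd2] hl].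
have xh : x + h <= x + 1 by rewrite lerD2l ltW.
have := h1 h; rewrite h0 hd1 => /(_ isT xh).
have := h2 h; rewrite h0 hd2 => /(_ isT xh).
have -> : derive1 (@sin R) x = cos x by rewrite derive1E; have [_ ->] := is_derive_sin x.
have -> : derive1 (@cos R) x = - sin x by rewrite derive1E; have [_ ->] := is_derive_cos x.
have E (r : R) : r *: (1 : R) = r by rewrite [LHS]mulr1.
rewrite !E => k2 k1; split; first exact: k1.
by have -> : cos (x + h) - cos x + h * sin x = cos (x + h) - cos x - h * (- sin x) by ring.
Qed.

End ContinuousScaling.

Section ComplexStructure.
Context {R : realType} {Y : completeNormedModType R}.
Variable J : Y -> Y.
Hypotheses (JD : forall x y, J (x + y) = J x + J y) (JZ : forall (k : R) x, J (k *: x) = k *: J x).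
Hypotheses (JJ : forall x, J (J x) = - x) (Jnorm : forall x, `|J x| <= `|x|).
Implicit Types (a b c d k : R) (x y : Y).

(** Multiplication by a + ib, when [J] is multiplication by i on a space with real scalars. *)
Definition cmul a b y := a *: y + b *: J y.

Lemma cmulA a b c d y : cmul a b (cmul c d y) = cmul (a * c - b * d) (a * d + b * c) y.
Proof.
rewrite /cmul JD !JZ JJ !scalerDr !scalerA !scalerN scalerBl scalerDl.
by rewrite [in LHS](addrC ((b * c) *: _)) addrACA.
Qed.

Lemma cmulD a b x y : cmul a b (x + y) = cmul a b x + cmul a b y.
Proof. by rewrite /cmul JD !scalerDr addrACA. Qed.

Lemma cmulDl a b c d y : cmul (a + c) (b + d) y = cmul a b y + cmul c d y.
Proof. by rewrite /cmul !scalerDl addrACA. Qed.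

Lemma cmulZ k a b y : cmul a b (k *: y) = cmul (k * a) (k * b) y.
Proof. by rewrite /cmul JZ !scalerA !(mulrC k). Qed.

Lemma cmul_scale k a b y : k *: cmul a b y = cmul (k * a) (k * b) y.
Proof. by rewrite /cmul scalerDr !scalerA. Qed.

Lemma cmulN a b y : cmul a b (- y) = - cmul a b y.
Proof. by rewrite -scaleN1r cmulZ /cmul !mulN1r !scaleNr -opprD. Qed.

Lemma cmulB a b x y : cmul a b (x - y) = cmul a b x - cmul a b y.
Proof. by rewrite cmulD cmulN. Qed.

Lemma cmulBl a b c d y : cmul (a - c) (b - d) y = cmul a b y - cmul c d y.
Proof. by rewrite cmulDl; congr (_ + _); rewrite /cmul !scaleNr opprD. Qed.

Lemma cmul_real a y : cmul a 0 y = a *: y.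
Proof. by rewrite /cmul scale0r addr0. Qed.

Lemma cmul_norm a b y : `|cmul a b y| <= (`|a| + `|b|) * `|y|.
Proof.
apply: le_trans (ler_normD _ _) _; rewrite mulrDl; apply: lerD; rewrite normrZ//.
by rewrite ler_wpM2l.
Qed.

Lemma cts_cmul (s t : R) (k l : R -> R) (f : R -> Y) : continuous k -> continuous l ->
  cts s t f -> cts s t (fun r => cmul (k r) (l r) (f r)).
Proof.
move=> ck cl cf; apply: cts_add; first exact: cts_scale.
apply: cts_scale => // r rst e e0; have [d d0 hd] := cf r rst e e0; exists d => // q qst qr.
have -> : J (f q) - J (f r) = J (f q - f r).
  by rewrite JD -[- f r]scaleN1r JZ scaleN1r.
by apply: le_lt_trans (Jnorm _) _; exact: hd.
Qed.

(** [cmul (sin t) (cos t)] is multiplication by i e^(-it), and the derivative of i e^(-it) f(rho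
    e^(it)) is e^(-it) f - rho f'. With primed letters at [t + h], [x] and [y] the values of f and
    f' at angle [t], and [e] the Taylor remainder, the identity isolates what is left after the
    first-order term. *)
Lemma circle_identity rho h s c s' c' sh ch x y e : sh = s' * c - c' * s -> ch = c' * c + s' * s ->
  c' ^+ 2 + s' ^+ 2 = 1 ->
  cmul s' c' (x + cmul (rho * c' - rho * c) (rho * s' - rho * s) y + e) - cmul s c x
    - h *: (cmul c (- s) x - rho *: y) =
  cmul (s' - s - h * c) (c' - c + h * s) x + cmul (rho * (h - sh)) (rho * (1 - ch)) y + cmul s' c' e.
Proof.
move=> -> -> cs.
rewrite (cmulD s' c' (x + _) e) (cmulD s' c' x) cmulA.
rewrite [h *: (_ - _)]scalerBr [h *: cmul _ _ _]cmul_scale scalerA -(cmul_real (h * rho)).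
rewrite addr_regroup_diff -!cmulBl -cmulDl; congr (cmul _ _ _ + cmul _ _ _ + _).
- by ring.
- by ring.
- by rewrite addr0 -[X in _ = _ * (X - _)]cs; ring.
Qed.

Lemma sin_diff (t h : R) : sin h = sin (t + h) * cos t - cos (t + h) * sin t.
Proof. by rewrite -sinB; congr sin; ring. Qed.

Lemma cos_diff (t h : R) : cos h = cos (t + h) * cos t + sin (t + h) * sin t.
Proof. by rewrite -cosB; congr cos; ring. Qed.

(* A function [f] on the square [|x|, |y| <= r] of the complex plane with
   derivative [f'], in quantitative form. *)
Variables (f f' : R -> R -> Y) (r L B : R).
Hypotheses (r0 : 0 < r) (L0 : 0 <= L) (B0 : 0 <= B).
Let sq (x y : R) := (`|x| <= r) && (`|y| <= r).
Hypothesis f_lip : forall (x y x' y' : R), sq x y -> sq x' y' ->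
  `|f x' y' - f x y| <= L * (`|x' - x| + `|y' - y|).
Hypothesis f'_lip : forall (x y x' y' : R), sq x y -> sq x' y' ->
  `|f' x' y' - f' x y| <= L * (`|x' - x| + `|y' - y|).
Hypothesis f_expansion : forall (x y x' y' : R), sq x y -> sq x' y' ->
  `|f x' y' - f x y - cmul (x' - x) (y' - y) (f' x y)| <= L * (`|x' - x| + `|y' - y|) ^+ 2.
Hypothesis f_bound : forall (x y : R), sq x y -> `|f x y| <= B.

Let onc (g : R -> R -> Y) (rho phi : R) := g (rho * cos phi) (rho * sin phi).

Let onsq (rho phi : R) : 0 <= rho <= r -> sq (rho * cos phi) (rho * sin phi).
Proof.
move=> /andP[rho0 rhor]; apply/andP; split; rewrite normrM (ger0_norm rho0).
  by have := cos_max phi; have := normr_ge0 (cos phi); nra.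
by have := sin_max phi; have := normr_ge0 (sin phi); nra.
Qed.

Let onc_cts (g : R -> R -> Y) rho : 0 <= rho <= r ->
  (forall (x y x' y' : R), sq x y -> sq x' y' -> `|g x' y' - g x y| <= L * (`|x' - x| + `|y' - y|)) ->
  cts 0 (pi *+ 2) (onc g rho).
Proof.
move=> hr lip t tt e e0.
have K0 : 0 < L * (2 * r) + 1 by rewrite ltr_wpDl// !mulr_ge0// ltW.
have e1 : 0 < e / (L * (2 * r) + 1) by rewrite divr_gt0.
have /cvgrPdist_lt/(_ _ e1)/nbhs_ballP[d1 /= d10 h1] := @continuous_cos R t.
have /cvgrPdist_lt/(_ _ e1)/nbhs_ballP[d2 /= d20 h2] := @continuous_sin R t.
exists (Num.min d1 d2); first by rewrite lt_min d10.
move=> s ss; rewrite lt_min => /andP[st1 st2].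
have k1 : `|cos t - cos s| < e / (L * (2 * r) + 1) by apply: h1; rewrite /ball /= distrC.
have k2 : `|sin t - sin s| < e / (L * (2 * r) + 1) by apply: h2; rewrite /ball /= distrC.
apply: le_lt_trans (lip _ _ _ _ (onsq t hr) (onsq s hr)) _.
have /andP[rho0 rhor] := hr.
rewrite -!mulrBr !normrM (ger0_norm rho0) -mulrDr.
rewrite distrC in k1; rewrite distrC in k2.
apply: (@le_lt_trans _ _ (L * (r * (2 * (e / (L * (2 * r) + 1)))))).
  rewrite ler_wpM2l// ler_pM ?addr_ge0//; lra.
have -> : L * (r * (2 * (e / (L * (2 * r) + 1)))) = L * (2 * r) * (e / (L * (2 * r) + 1)) by ring.
rewrite mulrCA -[ltRHS]mulr1 ltr_pM2l// ltr_pdivrMr// mul1r ltrDl; exact: ltr01.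
Qed.

Let rot rho phi := cmul (cos phi) (- sin phi) (onc f rho phi).
Let I rho := bint 0 (pi *+ 2) (onc f' rho).

Let pi2_ge0 : 0 <= pi *+ 2 :> R. Proof. by rewrite mulrn_wge0// pi_ge0. Qed.

Let cts_rot rho : 0 <= rho <= r -> cts 0 (pi *+ 2) (rot rho).
Proof.
move=> hr; apply: cts_cmul (onc_cts hr f_lip); first exact: continuous_cos.
by move=> x; apply: cvgN; exact: continuous_sin.
Qed.

(** The first two terms of the bracket come from the errors of the trigonometric expansions. The
    last is the Taylor remainder: the chord has length at most [4 * rho * h] in the sum norm, whence
    [L * (4 * rho * h) ^+ 2], doubled by [|sin| + |cos| <= 2], and one factor [h] is at most [e]. *)
Let circle_derivative rho t h e : 0 <= rho <= r -> 0 < h -> 0 < e -> e <= 1 -> h <= e ->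
  `|sin (t + h) - sin t - h * cos t| <= e * h ->
  `|cos (t + h) - cos t + h * sin t| <= e * h ->
  `|h - sin h| <= e * h -> `|1 - cos h| <= e * h ->
  `|cmul (sin (t + h)) (cos (t + h)) (onc f rho (t + h)) - cmul (sin t) (cos t) (onc f rho t)
    - h *: (rot rho t - rho *: onc f' rho t)| <=
  e * h * (2 * B + 2 * rho * `|onc f' rho t| + 32 * L * rho ^+ 2).
Proof.
move=> hr h0 e0 e1 he hs hc hs0 hc0; have /andP[rho0 _] := hr.
have := f_expansion (onsq t hr) (onsq (t + h) hr).
have := f_bound (onsq t hr).
rewrite -/(onc f rho (t + h)) -/(onc f rho t) -/(onc f' rho t).
set F := onc f rho t; set D := onc f' rho t.
set u := rho * cos (t + h) - rho * cos t; set v := rho * sin (t + h) - rho * sin t.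
set E := _ - _ - cmul _ _ _ => FB Eb.
have -> : onc f rho (t + h) = F + cmul u v D + E.
  exact: addr_residual.
have -> : cmul (sin (t + h)) (cos (t + h)) (F + cmul u v D + E) - cmul (sin t) (cos t) F
    - h *: (rot rho t - rho *: D) =
  cmul (sin (t + h) - sin t - h * cos t) (cos (t + h) - cos t + h * sin t) F +
  cmul (rho * (h - sin h)) (rho * (1 - cos h)) D +
  cmul (sin (t + h)) (cos (t + h)) E.
  by apply: circle_identity; [exact: sin_diff|exact: cos_diff|exact: cos2Dsin2].
have uv : `|u| + `|v| <= 4 * rho * h.
  rewrite /u /v -!mulrBr !normrM (ger0_norm rho0).
  have cs1 := cos_max t; have sn1 := sin_max t.
  have k1 : `|cos (t + h) - cos t| <= 2 * h.
    have -> : cos (t + h) - cos t = (cos (t + h) - cos t + h * sin t) - h * sin t by ring.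
    apply: le_trans (ler_normB _ _) _; rewrite normrM (gtr0_norm h0); nra.
  have k2 : `|sin (t + h) - sin t| <= 2 * h.
    have -> : sin (t + h) - sin t = (sin (t + h) - sin t - h * cos t) + h * cos t by ring.
    apply: le_trans (ler_normD _ _) _; rewrite normrM (gtr0_norm h0); nra.
  nra.
apply: le_trans (ler_normD _ _) _.
rewrite [leRHS]mulrDr [X in _ <= X + _]mulrDr; apply: lerD.
  apply: le_trans (ler_normD _ _) _; apply: lerD.
    apply: le_trans (cmul_norm _ _ _) _; rewrite mulrA; by apply: ler_pM => //; lra.
  apply: le_trans (cmul_norm _ _ _) _; rewrite mulrA; apply: ler_wpM2r => //.
  rewrite !normrM (ger0_norm rho0); nra.
apply: le_trans (cmul_norm _ _ _) _.
have cs1 := cos_max (t + h); have sn1 := sin_max (t + h).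
apply: (@le_trans _ _ (2 * `|E|)); first by rewrite ler_wpM2r//; lra.
have uv2 : (`|u| + `|v|) ^+ 2 <= (4 * rho * h) ^+ 2.
  by rewrite ler_sqr ?nnegrE ?addr_ge0// !mulr_ge0// ltW.
apply: (@le_trans _ _ (2 * (L * (4 * rho * h) ^+ 2))).
  by rewrite ler_pM2l//; apply: le_trans Eb _; rewrite ler_wpM2l.
have -> : 2 * (L * (4 * rho * h) ^+ 2) = h * h * (32 * L * rho ^+ 2) by ring.
rewrite ler_wpM2r ?mulr_ge0 ?sqr_ge0// ler_pM2r//.
Qed.

(** [P] is i e^(-it) f on the circle; it has period 2 pi and derivative
    [rot rho t - rho *: onc f' rho t], whose integral over a period is therefore 0. *)
Let circle_integral rho : 0 <= rho <= r -> bint 0 (pi *+ 2) (rot rho) = rho *: I rho.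
Proof.
move=> hr; have /andP[rho0 _] := hr.
have If' := cts_intg (onc_cts hr f'_lip); have Ir := cts_intg (cts_rot hr).
pose P t := cmul (sin t) (cos t) (onc f rho t).
have cP : cts 0 (pi *+ 2) P.
  by apply: cts_cmul (onc_cts hr f_lip); [exact: continuous_sin|exact: continuous_cos].
have cg : cts 0 (pi *+ 2) (fun t => rot rho t - rho *: onc f' rho t).
  apply: (@cts_eq _ _ _ _ (fun t => rot rho t + - rho *: onc f' rho t)).
    by move=> t _; rewrite scaleNr.
  exact: ctsDZ (cts_rot hr) (onc_cts hr f'_lip).
have rd : right_deriv 0 (pi *+ 2) P (fun t => rot rho t - rho *: onc f' rho t).
  move=> t tt e e0; set D := `|onc f' rho t|.
  pose W := 2 * B + 2 * rho * D + 32 * L * rho ^+ 2.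
  have W0 : 0 <= W.
    have D0 : 0 <= D by exact: normr_ge0.
    rewrite /W addr_ge0//; first by rewrite addr_ge0// !mulr_ge0.
    by rewrite mulr_ge0 ?mulr_ge0 ?sqr_ge0.
  have W1 : 0 < W + 1 by rewrite ltr_wpDl.
  have [e' [e'0 e'1 e'e]] : exists e', [/\ 0 < e', e' <= 1 & e' * (W + 1) <= e].
    exists (Num.min 1 (e / (W + 1))); split.
    - by rewrite lt_min ltr01 divr_gt0.
    - by rewrite ge_min lexx.
    - by rewrite -ler_pdivlMr// ge_min lexx orbT.
  have [d1 d10 h1] := trig_expansion t e'0; have [d2 d20 h2] := trig_expansion 0 e'0.
  exists (Num.min (Num.min d1 d2) e'); first by rewrite !lt_min d10 d20 e'0.
  move=> h /andP[h0]; rewrite !lt_min => /andP[/andP[hd1 hd2] he] _.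
  have [|k1 k2] := h1 h; first by rewrite h0.
  have [|k3 k4] := h2 h; first by rewrite h0.
  rewrite add0r sin0 cos0 subr0 mulr1 in k3; rewrite add0r cos0 sin0 mulr0 addr0 in k4.
  rewrite distrC in k3; rewrite distrC in k4.
  apply: le_trans (circle_derivative hr h0 e'0 e'1 (ltW he) k1 k2 k3 k4) _.
  rewrite -/D -/W mulrAC ler_pM2r//; apply: le_trans e'e; rewrite ler_pM2l//.
  by rewrite lerDl.
have := fundamental_theorem pi2_ge0 cP cg rd.
have -> : P (pi *+ 2) = P 0.
  by rewrite /P /onc sin2pi cos2pi sin0 cos0.
have IZ : intg 0 (pi *+ 2) (fun t => rho *: onc f' rho t) by exact: intgZ.
rewrite subrr (bintB Ir IZ) (bintZ rho If') => /esym/eqP.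
by rewrite subr_eq0 => /eqP.
Qed.

(** Along a ray the factor e^(it) of the chain rule cancels e^(-it), so the radial derivative of
    [rot] is f' on the circle. The remainder is [L * (h * 2) ^+ 2], doubled by
    [|cos| + |sin| <= 2]. *)
Let radial_derivative rho h : 0 < rho -> 0 < h -> rho + h <= r ->
  `|bint 0 (pi *+ 2) (rot (rho + h)) - bint 0 (pi *+ 2) (rot rho) - h *: I rho| <=
  8 * L * h ^+ 2 * (pi *+ 2).
Proof.
move=> rho0 h0 hr'.
have hr : 0 <= rho <= r by apply/andP; split; lra.
have hh : 0 <= rho + h <= r by apply/andP; split; lra.
have If' := cts_intg (onc_cts hr f'_lip).
have Ir := cts_intg (cts_rot hr); have Irh := cts_intg (cts_rot hh).
have IZ : intg 0 (pi *+ 2) (fun t => h *: onc f' rho t) by exact: intgZ.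
have I1 := intgB Irh Ir; have I2 := intgB I1 IZ.
rewrite -(bintB Irh Ir) -(bintZ h If') -(bintB I1 IZ).
apply: le_trans (bint_norm I2) _.
rewrite -[X in _ * X]subr0; apply: (nint_bound pi2_ge0); apply: nearW => t _.
have := f_expansion (onsq t hr) (onsq t hh).
rewrite /rot -/(onc f rho t) -/(onc f (rho + h) t) -/(onc f' rho t).
have -> : (rho + h) * cos t - rho * cos t = h * cos t by ring.
have -> : (rho + h) * sin t - rho * sin t = h * sin t by ring.
set F := onc f rho t; set F' := onc f (rho + h) t; set D := onc f' rho t.
have -> : cmul (cos t) (- sin t) F' - cmul (cos t) (- sin t) F - h *: D =
   cmul (cos t) (- sin t) (F' - F - cmul (h * cos t) (h * sin t) D).
  rewrite (cmulB _ _ (F' - F)) (cmulB _ _ F' F) cmulA; congr (_ - _).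
  rewrite -cmul_real; have cs := cos2Dsin2 t; congr (cmul _ _ _); last by ring.
  by rewrite -[LHS]mulr1 -cs; ring.
move=> Eb; apply: le_trans (cmul_norm _ _ _) _.
have cs1 := cos_max t; have sn1 := sin_max t; rewrite normrN.
rewrite !normrM (gtr0_norm h0) -mulrDr in Eb.
have c0 := normr_ge0 (cos t); have s0 := normr_ge0 (sin t).
have sq2 : (h * (`|cos t| + `|sin t|)) ^+ 2 <= (h * 2) ^+ 2.
  rewrite ler_sqr ?nnegrE ?mulr_ge0 ?addr_ge0 ?(ltW h0)//.
  by rewrite ler_pM2l//; lra.
have := ler_wpM2l L0 sq2; move: Eb.
set E := `|_ - _ - _|; have E0 : 0 <= E by exact: normr_ge0.
move=> Eb Lb; apply: (@le_trans _ _ (2 * E)); first by rewrite ler_wpM2r//; lra.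
have -> : 8 * L * h ^+ 2 = 2 * (L * (h * 2) ^+ 2) by ring.
by rewrite ler_pM2l//; exact: le_trans Eb Lb.
Qed.

Let mean_lip rho h : 0 <= rho -> 0 <= h -> rho + h <= r ->
  `|I (rho + h) - I rho| <= 2 * L * h * (pi *+ 2).
Proof.
move=> rho0 h0 hr'.
have hr : 0 <= rho <= r by apply/andP; split; lra.
have hh : 0 <= rho + h <= r by apply/andP; split; lra.
have I1 := cts_intg (onc_cts hr f'_lip); have I2 := cts_intg (onc_cts hh f'_lip).
rewrite /I -(bintB I2 I1); apply: le_trans (bint_norm (intgB I2 I1)) _.
rewrite -[X in _ * X]subr0; apply: (nint_bound pi2_ge0); apply: nearW => t _.
apply: le_trans (f'_lip (onsq t hr) (onsq t hh)) _.
have -> : (rho + h) * cos t - rho * cos t = h * cos t by ring.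
have -> : (rho + h) * sin t - rho * sin t = h * sin t by ring.
have cs1 := cos_max t; have sn1 := sin_max t.
rewrite !normrM (ger0_norm h0) -mulrDr -(mulrA 2 L) (mulrC 2) -mulrA ler_wpM2l// mulrC.
by rewrite (mulrC 2) ler_wpM2l//; lra.
Qed.

Let mean_constant e : 0 < e -> e <= r -> I r = I e.
Proof.
move=> e0 er; apply/eqP; rewrite -subr_eq0 -normr_le0 -(mul0r (r - e)).
have PI0 : 0 <= pi *+ 2 :> R := pi2_ge0.
apply: mean_value_inequality => //.
  apply: (@lip_cts _ _ _ _ _ (2 * L * (pi *+ 2))) => s t es st tr.
  have := @mean_lip s (t - s); rewrite subrKC subr_ge0 => k.
  by rewrite mulrAC; apply: k; lra.
move=> t te x x0; pose W := 8 * L * (pi *+ 2) / e.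
have W0 : 0 <= W by rewrite divr_ge0 ?mulr_ge0// ltW.
have W1 : 0 < W + 1 by rewrite ltr_wpDl.
exists (x / (W + 1)); first by rewrite divr_gt0.
move=> h /andP[h0 hx] thr; have t0 : 0 < t by lra.
have hr : 0 <= t <= r by apply/andP; split; lra.
have hh : 0 <= t + h <= r by apply/andP; split; lra.
have := radial_derivative t0 h0 thr.
rewrite !circle_integral//.
(* Replacing both integrals by radius times mean leaves only the increment of [I], with factor
   [t + h >= e]. It is therefore of second order in [h], and [I] has right derivative 0 on
   [[e, r]]. *)
have -> : (t + h) *: I (t + h) - t *: I t - h *: I t = (t + h) *: (I (t + h) - I t).
  by rewrite [RHS]scalerBr; exact: subr_scalerDl.
rewrite normrZ gtr0_norm; last by lra.
move=> k; rewrite add0r.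
have k1 : e * `|I (t + h) - I t| <= 8 * L * h ^+ 2 * (pi *+ 2).
  by apply: le_trans k; rewrite ler_wpM2r//; lra.
have k2 : `|I (t + h) - I t| <= W * (h * h).
  rewrite -(ler_pM2l e0); apply: le_trans k1 _.
  by rewrite le_eqVlt; apply/orP; left; apply/eqP; rewrite /W; field; rewrite gt_eqF.
apply: le_trans k2 _; rewrite mulrA ler_pM2r//.
move: hx; rewrite ltr_pdivlMr// => hx.
by have := ltW hx; rewrite mulrDr mulr1 mulrC; have := ltW h0; lra.
Qed.

(* With [Q rho] the integral of e^(-i phi) f over the circle of radius rho and [I rho]
   that of f', one has [Q = rho I] and [Q' = I], so [I] is constant. *)
Lemma cauchy_estimate : `|f' 0 0| <= 2 * B / r.
Proof.
have PI0 : 0 < pi *+ 2 :> R by rewrite mulrn_wgt0// pi_gt0.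
have rr : 0 <= r <= r by rewrite lexx ltW.
have I0 : I 0 = (pi *+ 2) *: f' 0 0.
  rewrite /I (@bint_eq _ _ _ _ _ (fun=> f' 0 0)).
    by rewrite (bint_cst _ (ltW PI0)) subr0.
  by move=> t _; rewrite /onc !mul0r.
have Ir : I r = I 0.
  apply/eqP; rewrite -subr_eq0 -normr_le0; apply/ler_addgt0Pr => e e0; rewrite add0r.
  have K0 : 0 < 2 * L * (pi *+ 2) + 1 by rewrite ltr_wpDl// !mulr_ge0// ltW.
  (* [mean_constant] holds for positive radii; the radius 0 is reached through the Lipschitz bound
     [mean_lip]. *)
  have [h [h0 hr he]] : exists h, [/\ 0 < h, h <= r & h * (2 * L * (pi *+ 2) + 1) <= e].
    exists (Num.min r (e / (2 * L * (pi *+ 2) + 1))); split.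
    - by rewrite lt_min r0 divr_gt0.
    - by rewrite ge_min lexx.
    - by rewrite -ler_pdivlMr// ge_min lexx orbT.
  rewrite (mean_constant h0 hr) -{1}[h]add0r.
  apply: le_trans (mean_lip (lexx 0) (ltW h0) _) _; first by rewrite add0r.
  apply: le_trans he; have -> : 2 * L * h * (pi *+ 2) = h * (2 * L * (pi *+ 2)) by ring.
  by rewrite ler_wpM2l ?(ltW h0)// lerDl ler01.
have := circle_integral rr; rewrite Ir I0 scalerA => E.
(* The factor 2 is [|cos| + |sin| <= 2], since [cmul] by a number of modulus 1 is only controlled
   through its two real parts. *)
have : `|r * (pi *+ 2) *: f' 0 0| <= 2 * B * (pi *+ 2).
  rewrite -E; apply: le_trans (bint_norm (cts_intg (cts_rot rr))) _.
  rewrite -[X in _ * X]subr0; apply: nint_bound (ltW PI0) _; apply: nearW => t _.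
  apply: le_trans (cmul_norm _ _ _) _; rewrite normrN.
  have cs1 := cos_max t; have sn1 := sin_max t.
  have fbt : `|onc f r t| <= B := f_bound (onsq t rr).
  by apply: ler_pM fbt => //; lra.
rewrite normrZ (gtr0_norm (mulr_gt0 r0 PI0)) mulrAC (ler_pM2r PI0) => k.
by rewrite (ler_pdivlMr _ _ r0) mulrC; exact: k.
Qed.

End ComplexStructure.

Lemma subr_regroup4 (V : zmodType) (a b c d e : V) :
  a - (c + d) - (b - c) - (e - d) = a - b - e.
Proof.
by rewrite !opprB opprD !addrA [LHS](AC 7%AC (1*5*7*(4*2)*(6*3))%AC) /= !subrr !addr0.
Qed.

(** * Sectors and cones *)

Section Sectors.
Context {R : realType}.
Implicit Types (x y k theta e d : R).

Lemma normC_lt (z : C R) e : `|complex.Re z| + `|complex.Im z| < e -> `|z| < (Complex e 0 : C R).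
Proof.
case: z => a b /= h; rewrite ltcE /= eqxx /=; apply: le_lt_trans h.
rewrite -[leRHS]ger0_norm ?addr_ge0// -sqrtr_sqr ler_wsqrtr//.
rewrite -(real_normK (num_real a)) -(real_normK (num_real b)) sqrrD.
by rewrite -addrA (addrC (`|a| * `|b| *+ 2)) addrA lerDl mulrn_wge0// mulr_ge0.
Qed.

(** By continuity of [atan] at 0, a small slope has a small angle. Cones in Cartesian coordinates
    make membership of sums and of nearby points a linear inequality. *)
Lemma sector_cone theta : 0 < theta -> exists k, 0 < k <= 1 /\
  forall x y, 0 < x -> `|y| <= 2 * k * x -> sector theta (Complex x y : C R).
Proof.
move=> t0; have ca : {for 0, continuous (@atan R)}.
  by apply: differentiable_continuous; apply/derivable1_diffP; have [] := is_derive1_atan (0 : R).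
have /cvgrPdist_lt/(_ _ t0)/nbhs_ballP[d /= d0 hd] := ca.
exists (Num.min 1 (d / 4)); split.
  by rewrite lt_min ltr01 divr_gt0//= ge_min lexx.
move=> x y x0; set k := Num.min _ _ => yx.
have kd : k <= d / 4 by rewrite /k ge_min lexx orbT.
pose u := y / x; have xn0 : x != 0 by rewrite gt_eqF.
have ud : `|u| < d.
  rewrite /u normrM normfV (gtr0_norm x0) ltr_pdivrMr//; apply: le_lt_trans yx _.
  by rewrite ltr_pM2r//; lra.
have au : `|atan u| < theta.
  have := hd u; rewrite /ball /= sub0r normrN => /(_ ud).
  by rewrite atan0 sub0r normrN.
have u1 : 0 < 1 + u ^+ 2 by rewrite ltr_pwDl// sqr_ge0.
have s0 : 0 < Num.sqrt (1 + u ^+ 2) by rewrite sqrtr_gt0.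
exists (x * Num.sqrt (1 + u ^+ 2)), (atan u); split=> //; first exact: mulr_gt0.
have ct : cos (atan u) = (Num.sqrt (1 + u ^+ 2))^-1 by exact: cos_atan.
have st : sin (atan u) = u * cos (atan u).
  by rewrite -{2}(atanK u) /tan divfK// ct invr_eq0 gt_eqF.
rewrite st ct; congr Complex; first by rewrite mulfK// gt_eqF.
by rewrite mulrACA mulfV ?gt_eqF// mulr1 /u mulrCA mulfV// mulr1.
Qed.

Lemma sector_sub theta theta' (z : C R) : theta' <= theta -> sector theta' z -> sector theta z.
Proof.
by move=> tt [r [a [r0 a0 ->]]]; exists r, a; split=> //; exact: lt_le_trans tt.
Qed.

End Sectors.

(** * Estimates along segments of the complex plane *)

Section SegmentEstimates.
Context {R : realType} {Y : completeNormedModType R}.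
Variable J : Y -> Y.
Hypotheses (JD : forall x y, J (x + y) = J x + J y) (JZ : forall (k : R) x, J (k *: x) = k *: J x).
Hypothesis Jnorm : forall x, `|J x| <= `|x|.
Local Notation cmul := (cmul J).
Implicit Types (x y h e t : R) (d : Y) (f : R -> R -> Y).

Definition cderiv f x y d := forall e, 0 < e -> exists2 eta : R, 0 < eta & forall h1 h2 : R,
  `|h1| + `|h2| < eta -> `|f (x + h1) (y + h2) - f x y - cmul h1 h2 d| <= e * (`|h1| + `|h2|).

Lemma segment_lipschitz f x y x' y' (N : R) : 0 <= N ->
  (forall t, 0 <= t <= 1 ->
     exists2 d, cderiv f (x + t * (x' - x)) (y + t * (y' - y)) d & `|d| <= N) ->
  `|f x' y' - f x y| <= N * (`|x' - x| + `|y' - y|).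
Proof.
move=> N0 H; set D := `|x' - x| + `|y' - y|.
have D0 : 0 <= D by rewrite addr_ge0.
pose u t := f (x + t * (x' - x)) (y + t * (y' - y)).
have step t e : 0 <= t <= 1 -> 0 < e -> exists2 eta : R, 0 < eta & forall h, `|h| < eta ->
    `|u (t + h) - u t| <= (N * D + e) * `|h|.
  move=> tt e0; have D1 : 0 < D + 1 by rewrite ltr_wpDl.
  have [d cd dN] := H t tt; have [eta eta0 He] := cd _ (divr_gt0 e0 D1).
  exists (eta / (D + 1)); first by rewrite divr_gt0.
  move=> h; rewrite ltr_pdivlMr// => hh.
  have E : `|h * (x' - x)| + `|h * (y' - y)| = `|h| * D by rewrite !normrM -mulrDr.
  have h0 := normr_ge0 h.
  have := He (h * (x' - x)) (h * (y' - y)); rewrite E => /(_ _) k1.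
  have {}k1 := k1 (le_lt_trans (ler_wpM2l h0 (ler_wpDr ler01 (lexx D))) hh).
  have k2 := cmul_norm Jnorm (h * (x' - x)) (h * (y' - y)) d; rewrite E in k2.
  rewrite /u mulrDl mulrDl !addrA.
  set A := f _ _ - f _ _ in k1 *; set B := cmul _ _ _ in k1 k2.
  have k3 : `|h| * D * `|d| <= `|h| * D * N by rewrite ler_wpM2l// mulr_ge0.
  have k4 : D / (D + 1) * (e * `|h|) <= 1 * (e * `|h|).
    by rewrite ler_wpM2r ?mulr_ge0 ?(ltW e0)// ler_pdivrMr// mul1r lerDl.
  have E' : e / (D + 1) * (`|h| * D) = D / (D + 1) * (e * `|h|) by ring.
  rewrite E' in k1; have := ler_normD (A - B) B; rewrite subrK; move: k1 k2 k3 k4.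
  by move: `|A - B| `|B| `|A| (D / (D + 1)) => *; lra.
have cu : cts 0 1 u.
  move=> t tt e e0; have [eta eta0 He] := step t 1 tt ltr01.
  have ND : 0 < N * D + 1 by rewrite ltr_wpDl// mulr_ge0.
  exists (Num.min eta (e / (N * D + 1))); first by rewrite lt_min eta0 divr_gt0.
  move=> t' _; rewrite lt_min ltr_pdivlMr// => /andP[k1 k2].
  have := He _ k1; rewrite subrKC mulrC => k3; exact: le_lt_trans k3 k2.
have := @mean_value_inequality _ _ 0 1 u (N * D) ler01 cu.
rewrite /u !mul0r !mul1r !addr0 !subrKC subr0 mulr1; apply.
move=> t tt e e0; have tt' : 0 <= t <= 1 by lra.
have [eta eta0 He] := step t e tt' e0; exists eta => // h /andP[h0 hh] _.
by have := He h; rewrite gtr0_norm// => /(_ hh).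
Qed.

(** This is [segment_lipschitz] for [f] minus its affine part at the first end point, whose
    derivative along the segment is at most [L] times the length in the sum norm. *)
Lemma segment_expansion f f' x y x' y' (L : R) : 0 <= L ->
  (forall t, 0 <= t <= 1 -> cderiv f (x + t * (x' - x)) (y + t * (y' - y))
     (f' (x + t * (x' - x)) (y + t * (y' - y)))) ->
  (forall t, 0 <= t <= 1 -> `|f' (x + t * (x' - x)) (y + t * (y' - y)) - f' x y| <=
     L * (`|t * (x' - x)| + `|t * (y' - y)|)) ->
  `|f x' y' - f x y - cmul (x' - x) (y' - y) (f' x y)| <= L * (`|x' - x| + `|y' - y|) ^+ 2.
Proof.
move=> L0 cd lip; set D := `|x' - x| + `|y' - y|.
have D0 : 0 <= D by rewrite addr_ge0.
pose F p q := f p q - cmul (p - x) (q - y) (f' x y).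
have -> : f x' y' - f x y - cmul (x' - x) (y' - y) (f' x y) = F x' y' - F x y.
  by rewrite /F !subrr cmul_real scale0r subr0 addrAC.
have -> : L * D ^+ 2 = L * D * D by ring.
apply: segment_lipschitz; first exact: mulr_ge0.
move=> t tt; set p := x + _; set q := y + _.
exists (f' p q - f' x y); last first.
  apply: le_trans (lip t tt) _; rewrite ler_wpM2l// !normrM -mulrDr -/D.
  have /andP[t0 t1] := tt; rewrite (ger0_norm t0).
  by rewrite -[leRHS]mul1r ler_wpM2r.
move=> e e0; have [eta eta0 He] := cd t tt e e0; exists eta => // h1 h2 hh.
have -> : F (p + h1) (q + h2) - F p q - cmul h1 h2 (f' p q - f' x y) =
  f (p + h1) (q + h2) - f p q - cmul h1 h2 (f' p q); last exact: He.
rewrite /F (cmulB JD JZ) (_ : p + h1 - x = p - x + h1); last by ring.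
rewrite (_ : q + h2 - y = q - y + h2); last by ring.
rewrite cmulDl. exact: subr_regroup4.
Qed.

End SegmentEstimates.

(** * Holomorphic semigroups near 0 *)

Section Holomorphic.
Context {R : realType} {Y : completeNormedModType R}.
Variables (act : C R -> Y -> Y) (J : Y -> Y) (S : C R -> Y -> Y) (theta : R).
Hypotheses (JD : forall x y, J (x + y) = J x + J y) (JZ : forall (k : R) x, J (k *: x) = k *: J x).
Hypotheses (JJ : forall x, J (J x) = - x) (Jnorm : forall x, `|J x| <= `|x|).
Hypothesis actE : forall c y, act c y = cmul J (complex.Re c) (complex.Im c) y.
Hypothesis theta0 : 0 < theta.
Hypothesis S_linear : forall z, sector theta z -> continuous (S z) /\
  forall c x y, S z (act c x + y) = act c (S z x) + S z y.
Hypothesis S_semigroup : forall z w x, sector theta z -> sector theta w ->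
  S (z + w) x = S z (S w x).
Hypothesis S_derivable : forall z x, sector theta z ->
  cvg (act h^-1 (S (z + h) x - S z x) @[h --> (0 : C R)^']).
Hypothesis S_cvg0 : forall (theta' : R) x, 0 < theta' < theta ->
  S z x @[z --> within (sector theta') (nbhs (0 : C R))] --> x.
Local Notation cmul := (cmul J).
Implicit Types (v w : Y) (x y a b h e d t : R).

Let s x y v := S (Complex x y) v.

Lemma act_real a v : act (Complex a 0) v = a *: v.
Proof. by rewrite actE cmul_real. Qed.

Variable k : R.
Hypothesis k01 : 0 < k <= 1.
Hypothesis wide : forall x y, 0 < x -> `|y| <= 2 * k * x -> sector (theta / 2) (Complex x y : C R).
Let cone x y := (0 < x) && (`|y| <= k * x).
Let cone2 x y := (0 < x) && (`|y| <= 2 * k * x).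

Let cone_cone2 x y : cone x y -> cone2 x y.
Proof.
move=> /andP[x0 yx]; apply/andP; split=> //; apply: le_trans yx _.
by have /andP[k0 _] := k01; rewrite ler_pM2r//; lra.
Qed.

Let cone2_half x y : cone2 x y -> sector (theta / 2) (Complex x y : C R).
Proof. by move=> /andP[x0 yx]; exact: wide. Qed.

Let cone2_sector x y : cone2 x y -> sector theta (Complex x y : C R).
Proof. by move=> /cone2_half; apply: sector_sub; have := theta0; lra. Qed.

Let s_add x y v w : cone2 x y -> s x y (v + w) = s x y v + s x y w.
Proof.
move=> /cone2_sector/S_linear[_ /(_ 1 v w)].
have E u : act 1 u = u by rewrite (act_real 1) scale1r.
by rewrite !E.
Qed.

Let s_0 x y : cone2 x y -> s x y 0 = 0.
Proof. by move=> c; apply: (@addrI _ (s x y 0)); rewrite -s_add// !addr0. Qed.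

Let s_act x y c v : cone2 x y -> s x y (act c v) = act c (s x y v).
Proof.
move=> xy; have [_ /(_ c v 0)] := S_linear (cone2_sector xy).
by rewrite addr0 => /= E; rewrite /s E -/(s x y 0) s_0// addr0.
Qed.

Let s_scale x y a v : cone2 x y -> s x y (a *: v) = a *: s x y v.
Proof. by move=> xy; rewrite -!act_real s_act. Qed.

Let s_sub x y v w : cone2 x y -> s x y (v - w) = s x y v - s x y w.
Proof. by move=> xy; rewrite s_add// -scaleN1r s_scale// scaleN1r. Qed.

Let s_cmul x y a b v : cone2 x y -> s x y (cmul a b v) = cmul a b (s x y v).
Proof. by move=> xy; have := s_act (Complex a b) v xy; rewrite !actE. Qed.

Let s_semigroup x y x' y' v : cone2 x y -> cone2 x' y' -> s (x + x') (y + y') v = s x y (s x' y' v).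
Proof. by move=> c c'; exact: S_semigroup (cone2_sector c) (cone2_sector c'). Qed.

Let s_cvg0 v e : 0 < e -> exists2 d, 0 < d & forall x y, cone2 x y -> x < d -> `|s x y v - v| < e.
Proof.
move=> e0; have tt : 0 < theta / 2 < theta by have := theta0; lra.
have /cvgrPdist_lt/(_ _ e0) := S_cvg0 (x := v) tt.
rewrite /prop_near1 /within /= => /nbhs_ballP[[d d'] /=]; rewrite ltcE /= => /andP[/eqP -> d0] hd.
(* In the cone [|y| <= 2 * k * x <= 2 * x], so the modulus of x + iy is at most [3 * x]. *)
exists (d / 3); first by rewrite divr_gt0.
move=> x y xy xd; rewrite distrC; apply: (hd (Complex x y)); last exact: cone2_half.
suff H : `|(0 : C R) - Complex x y| < (Complex d 0 : C R) by exact: H.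
rewrite sub0r normrN; apply: normC_lt => /=.
have /andP[x0 yx] := xy; have /andP[k0 k1] := k01; rewrite gtr0_norm//.
have : 2 * k * x <= 2 * x by rewrite ler_pM2r//; lra.
lra.
Qed.

Let s_deriv x y v : cone2 x y -> exists w, cderiv J (fun p q => s p q v) x y w.
Proof.
move=> xy; have /cvg_ex[d /= cd] := @S_derivable _ v (cone2_sector xy); exists d => e e0.
move/cvgrPdist_lt : cd => /(_ _ e0) /nbhs_ballP[[eta eta'] /=]; rewrite ltcE /= => /andP[/eqP -> eta0] hd.
exists eta => // h1 h2 hh; pose h : C R := Complex h1 h2.
have [h0|hn0] := eqVneq h 0.
  have [-> ->] : h1 = 0 /\ h2 = 0 by case: h0.
  by rewrite !addr0 cmul_real scale0r subrr subr0 !normr0 addr0 mulr0.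
have bh : `|(0 : C R) - h| < (Complex eta 0 : C R) by rewrite sub0r normrN; exact: normC_lt.
have := hd h bh hn0 => /ltW.
set D := S _ v - S _ v; rewrite distrC => H.
have -> : s (x + h1) (y + h2) v - s x y v - cmul h1 h2 d = act h (act h^-1 D - d).
  have E : act h (act h^-1 D) = D.
    rewrite !actE cmulA//.
    have : h * h^-1 = 1 by rewrite mulfV.
    case: (h^-1) => p q /= [-> ->].
    by rewrite cmul_real scale1r.
  have E' : cmul h1 h2 (act h^-1 D) = D by rewrite -[RHS]E actE.
  by rewrite [RHS]actE (cmulB JD JZ) E'.
rewrite actE; apply: le_trans (cmul_norm _ _ _ _) _; first exact: Jnorm.
by rewrite mulrC ler_wpM2r// addr_ge0.
Qed.

Let s_bounded_fun x y : cone2 x y -> bounded_fun_norm (s x y) /\ linear (s x y).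
Proof.
move=> xy; split; last by move=> a v w; rewrite s_add// s_scale.
have [cS _] := S_linear (cone2_sector xy).
have /cvgrPdist_lt/(_ _ ltr01)/nbhs_ballP[d /= d0 hd] := cS 0.
move=> r; pose a := d / (`|r| + 1).
have r1 : 0 < `|r| + 1 by rewrite ltr_wpDl.
have a0 : 0 < a by rewrite divr_gt0.
exists a^-1 => v vr.
have av : `|a *: v| < d.
  rewrite normrZ gtr0_norm// /a mulrAC ltr_pdivrMr// ltr_pM2l//.
  by apply: le_lt_trans vr _; apply: le_lt_trans (ler_norm r) _; rewrite ltrDl.
have bav : ball (0 : Y) d (a *: v) by rewrite -ball_normE /= sub0r normrN.
have := hd _ bav; rewrite -/(s x y 0) -/(s x y (a *: v)) s_0// sub0r normrN s_scale//.
by rewrite normrZ gtr0_norm// => /ltW; rewrite -ler_pdivlMl// mulr1.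
Qed.

(** Uniform boundedness, by contradiction: otherwise there are points of the cone tending to 0 along
    which the operator norms are unbounded, although strong continuity at 0 bounds these operators
    on each vector. *)
Let s_uniform : exists K delta, [/\ 0 < K, 0 < delta &
  forall x y v, cone2 x y -> x < delta -> `|s x y v| <= K * `|v|].
Proof.
apply: contrapT => nK.
have H n : exists z : R * R * Y,
    [/\ cone2 z.1.1 z.1.2, z.1.1 < n.+1%:R^-1 & n.+1%:R * `|z.2| < `|s z.1.1 z.1.2 z.2|].
  apply: contrapT => nz; apply: nK; exists n.+1%:R, n.+1%:R^-1.
  split; rewrite ?invr_gt0 ?ltr0n//; move=> x y v xy xn.
  by rewrite leNgt; apply/negP => lt; apply: nz; exists (x, y, v).
have [z Hz] := choice H.
pose F := [set g : Y -> Y | exists n, g = s (z n).1.1 (z n).1.2].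
have ub : uniform_bounded F.
  apply: Banach_Steinhauss.
    by move=> _ [n ->]; have [c _ _] := Hz n; exact: s_bounded_fun.
  move=> v; have [d d0 hd] := s_cvg0 v ltr01.
  have [N Nd] : exists N : nat, N.+1%:R^-1 < d.
    by have [N _ /(_ N (leqnn N))] := near_infty_natSinv_lt (PosNum d0); exists N.
  (* From index [N] on, the values are within 1 of [v]; the sum covers the finitely many earlier
     ones. *)
  exists (`|v| + 1 + \sum_(i < N) `|s (z i).1.1 (z i).1.2 v|) => _ [n ->].
  have [nN|Nn] := ltnP n N.
    rewrite (bigD1 (Ordinal nN))//=; set q := `|s _ _ v|.
    have : 0 <= \sum_(i < N | i != Ordinal nN) `|s (z i).1.1 (z i).1.2 v| by apply: sumr_ge0.
    by have := normr_ge0 v; move: q (\sum_(i < N | _) _) => *; lra.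
  have [c zn _] := Hz n; apply: (@le_trans _ _ (`|v| + 1)); last by rewrite lerDl sumr_ge0.
  have : `|s (z n).1.1 (z n).1.2 v - v| < 1.
    apply: hd => //; apply: lt_trans zn _; apply: le_lt_trans Nd.
    by rewrite lef_pV2 ?posrE ?ltr0n// ler_nat ltnS.
  move=> k1; have := ler_normD (s (z n).1.1 (z n).1.2 v - v) v; rewrite subrK.
  by move: k1; move: `|s _ _ v - v| `|s _ _ v| => *; lra.
have [Mb HM] := ub 1.
have [n Mn] : exists n : nat, Mb < n.+1%:R.
  by exists (Num.truncn Mb); exact: truncnS_gt.
have [c _ big] := Hz n.
have v0 : 0 < `|(z n).2|.
  rewrite normr_gt0; apply/negP => /eqP v0; move: big.
  by rewrite v0 s_0// normr0 mulr0 ltxx.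
have := HM (s (z n).1.1 (z n).1.2) _ (`|(z n).2|^-1 *: (z n).2).
rewrite s_scale// !normrZ normfV normr_id mulVf ?gt_eqF// => /(_ _ (lexx _)) k1.
have {}k1 := k1 (ex_intro _ n erefl).
move: big; rewrite -ltr_pdivlMr// mulrC => big.
by have := lt_le_trans big k1; rewrite ltNge ltW.
Qed.

(** By the semigroup law, a derivative [w] at one point [a] becomes the derivative [s x y w] at [a]
    shifted by x + iy. Hence f' and its derivative near [t] are images of fixed vectors under
    uniformly bounded operators. This gives the Lipschitz and Taylor bounds that [cauchy_estimate]
    consumes, while its conclusion involves only the bound of f. *)
Lemma holomorphic_estimates : exists K C delta : R, [/\ 0 <= K, 0 <= C, 0 < delta &
  forall t v, 0 < t <= delta ->
  `|S (Complex t 0) v| <= K * `|v| /\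
  exists w, `|w| <= C / t * `|v| /\
   forall e, 0 < e -> exists2 eta : R, 0 < eta & forall h, 0 < h < eta ->
     `|S (Complex (t + h) 0) v - S (Complex t 0) v - h *: w| <= e * h].
Proof.
have [K [delta [K0 delta0 sK]]] := s_uniform.
have /andP[k0 k1] := k01.
have real_cone a : 0 < a -> cone2 a 0.
  by move=> a0; rewrite /cone2 a0 normr0 !mulr_ge0// ltW.
have shift a v w x y : 0 < a -> cone x y -> x < delta ->
    cderiv J (fun p q => s p q v) a 0 w -> cderiv J (fun p q => s p q v) (a + x) y (s x y w).
  move=> a0 xy xd cd e e0.
  have [eta eta0 He] := cd _ (divr_gt0 e0 K0).
  have xy2 := cone_cone2 xy.
  exists (Num.min eta (k * a / 2)); first by rewrite lt_min eta0 !divr_gt0// mulr_gt0.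
  move=> h1 h2; rewrite lt_min => /andP[hh hk].
  have c2 : cone2 (a + h1) h2.
    have n1 := normr_ge0 h1; have n2 := normr_ge0 h2.
    have n3 : - `|h1| <= h1 by rewrite lerNl -normrN ler_norm.
    have ka : k * a <= a by rewrite ger_pMl.
    have a2 : a / 2 <= a + h1 by lra.
    apply/andP; split; first by lra.
    have : 2 * k * (a / 2) <= 2 * k * (a + h1) by rewrite ler_pM2l// mulr_gt0.
    lra.
  have -> : a + x + h1 = x + (a + h1) by ring.
  rewrite (_ : s (a + x) y v = s x y (s a 0 v)); last first.
    by rewrite -s_semigroup ?addr0 ?(addrC a)//; exact: real_cone.
  rewrite s_semigroup// -s_cmul// -!s_sub//.
  apply: le_trans (sK _ _ _ xy2 xd) _.
  have H := He h1 h2 hh; rewrite add0r in H.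
  apply: le_trans (ler_wpM2l (ltW K0) H) _.
  by rewrite mulrA mulrCA mulfV ?gt_eqF// mulr1.
(* The square has half side [r = k * t / 8], and [2 * (K * |v|) / r] is [16 * K / k / t * |v|]. *)
pose C0 := 16 * K / k.
exists K, C0, (delta / 2); split; [exact: ltW|by rewrite divr_ge0 ?mulr_ge0// ltW|exact: divr_gt0|].
move=> t v /andP[t0 td].
have tt : t < delta by lra.
split; first by apply: sK => //; exact: real_cone.
(* Since [t = a + 3 * a], f' is carried from [a] by the operator at [3 * a]; since
   [3 * a = a + 2 * a], its own derivative is carried by the operator at [2 * a]. Both remain in the
   cone after a perturbation by at most [r]. *)
pose a := t / 4; have a0 : 0 < a by rewrite divr_gt0.
have [w cw] := s_deriv v (real_cone a a0).
have [w2 cw2] := s_deriv w (real_cone a a0).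
pose f x y := s (t + x) y v; pose f' x y := s (3 * a + x) y w.
pose r := k * t / 8; have r0 : 0 < r by rewrite divr_gt0// mulr_gt0.
have rt : r <= t / 8 by rewrite /r ler_pM2r// ger_pMl.
have sq_cone (c x y : R) : 2 * a <= c -> c <= 3 * a -> `|x| <= r -> `|y| <= r -> cone (c + x) y /\ c + x < delta.
  move=> c2 c3 xr yr.
  have n3 : - `|x| <= x by rewrite lerNl -normrN ler_norm.
  have n4 := ler_norm x.
  have cx : t / 4 <= c + x by move: c2 c3; rewrite /a; lra.
  split; last by move: c2 c3; rewrite /a; lra.
  apply/andP; split; first by lra.
  apply: le_trans yr _; have : k * (t / 4) <= k * (c + x) by rewrite ler_pM2l.
  by rewrite /r; have := mulr_gt0 k0 t0; lra.
have d1 x y : `|x| <= r -> `|y| <= r -> cderiv J (fun p q => s p q v) (t + x) y (f' x y).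
  move=> xr yr; have [||c1 c2] := sq_cone (3 * a) x y _ _ xr yr; [by lra|by lra|].
  have -> : t + x = a + (3 * a + x) by rewrite /a; field.
  exact: shift.
have d2 x y : `|x| <= r -> `|y| <= r -> cderiv J (fun p q => s p q w) (3 * a + x) y (s (2 * a + x) y w2).
  move=> xr yr; have [||c1 c2] := sq_cone (2 * a) x y _ _ xr yr; [by lra|by lra|].
  have -> : 3 * a + x = a + (2 * a + x) by ring.
  exact: shift.
have b1 x y : `|x| <= r -> `|y| <= r -> `|f' x y| <= K * `|w|.
  move=> xr yr; have [||c1 c2] := sq_cone (3 * a) x y _ _ xr yr; [by lra|by lra|].
  by apply: sK => //; exact: cone_cone2.
have b2 x y : `|x| <= r -> `|y| <= r -> `|s (2 * a + x) y w2| <= K * `|w2|.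
  move=> xr yr; have [||c1 c2] := sq_cone (2 * a) x y _ _ xr yr; [by lra|by lra|].
  by apply: sK => //; exact: cone_cone2.
have b0 x y : `|x| <= r -> `|y| <= r -> `|f x y| <= K * `|v|.
  move=> xr yr.
  have n3 : - `|x| <= x by rewrite lerNl -normrN ler_norm.
  have n4 := ler_norm x.
  apply: sK; last by lra.
  apply/andP; split; first by lra.
  have : 2 * k * (t / 2) <= 2 * k * (t + x) by rewrite ler_pM2l ?mulr_gt0//; lra.
  by move: yr; rewrite /r; have := mulr_gt0 k0 t0; lra.
have seg (x y u : R) : `|x| <= r -> `|y| <= r -> 0 <= u <= 1 -> `|x + u * (y - x)| <= r.
  rewrite !ler_norml => /andP[x1 x2] /andP[y1 y2] /andP[u0 u1].
  by apply/andP; split; nra.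
pose L := K * `|w| + K * `|w2|.
have L0 : 0 <= L by rewrite addr_ge0// mulr_ge0// ltW.
have Kw : 0 <= K * `|w| by rewrite mulr_ge0// ltW.
have Kw2 : 0 <= K * `|w2| by rewrite mulr_ge0// ltW.
have Kv : 0 <= K * `|v| by rewrite mulr_ge0// ltW.
have flip x y x' y' : (`|x| <= r) && (`|y| <= r) -> (`|x'| <= r) && (`|y'| <= r) ->
    `|f x' y' - f x y| <= L * (`|x' - x| + `|y' - y|).
  move=> /andP[xr yr] /andP[xr' yr'].
  apply: (@segment_lipschitz _ _ _ Jnorm f) => // u uu; exists (f' (x + u * (x' - x)) (y + u * (y' - y))).
    move=> e e0; have [eta eta0 He] := d1 _ _ (seg _ _ _ xr xr' uu) (seg _ _ _ yr yr' uu) e e0.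
    by exists eta => // h1 h2 hh; rewrite /f !addrA; have := He h1 h2 hh; rewrite !addrA.
  apply: le_trans (b1 _ _ (seg _ _ _ xr xr' uu) (seg _ _ _ yr yr' uu)) _.
  by rewrite /L lerDl.
have f'lip x y x' y' : (`|x| <= r) && (`|y| <= r) -> (`|x'| <= r) && (`|y'| <= r) ->
    `|f' x' y' - f' x y| <= L * (`|x' - x| + `|y' - y|).
  move=> /andP[xr yr] /andP[xr' yr'].
  apply: (@segment_lipschitz _ _ _ Jnorm f') => // u uu.
  exists (s (2 * a + (x + u * (x' - x))) (y + u * (y' - y)) w2).
    move=> e e0; have [eta eta0 He] := d2 _ _ (seg _ _ _ xr xr' uu) (seg _ _ _ yr yr' uu) e e0.
    by exists eta => // h1 h2 hh; rewrite /f' !addrA; have := He h1 h2 hh; rewrite !addrA.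
  apply: le_trans (b2 _ _ (seg _ _ _ xr xr' uu) (seg _ _ _ yr yr' uu)) _.
  by rewrite /L lerDr.
have fexp x y x' y' : (`|x| <= r) && (`|y| <= r) -> (`|x'| <= r) && (`|y'| <= r) ->
    `|f x' y' - f x y - cmul (x' - x) (y' - y) (f' x y)| <= L * (`|x' - x| + `|y' - y|) ^+ 2.
  move=> xy xy'; have /andP[xr yr] := xy; have /andP[xr' yr'] := xy'.
  apply: (segment_expansion JD JZ Jnorm L0).
    move=> u uu e e0; have [eta eta0 He] := d1 _ _ (seg _ _ _ xr xr' uu) (seg _ _ _ yr yr' uu) e e0.
    by exists eta => // h1 h2 hh; rewrite /f !addrA; have := He h1 h2 hh; rewrite !addrA.
  move=> u uu; have := @f'lip x y (x + u * (x' - x)) (y + u * (y' - y)) xy.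
  rewrite (seg _ _ _ xr xr' uu) (seg _ _ _ yr yr' uu) => /(_ isT).
  by rewrite !(addrAC _ _ (- _)) !subrr !add0r.
have fb x y : (`|x| <= r) && (`|y| <= r) -> `|f x y| <= K * `|v|.
  by move=> /andP[]; exact: b0.
have ce := cauchy_estimate JD JZ JJ Jnorm r0 L0 Kv flip f'lip fexp fb.
exists (f' 0 0); split.
  apply: le_trans ce _; rewrite /C0 /r le_eqVlt; apply/orP; left; apply/eqP.
  by field; rewrite !gt_eqF.
have n0 : `|(0 : R)| <= r by rewrite normr0 ltW.
move=> e e0; have [eta eta0 He] := d1 0 0 n0 n0 e e0; exists eta => // h /andP[h0 hh].
have := He h 0; rewrite !addr0 !normr0 !addr0 gtr0_norm// => /(_ hh).
by rewrite cmul_real.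
Qed.

End Holomorphic.

(** * Real and complex scalars *)

Section RestrictScalars.
Context {R : realType}.

(** An alias that can carry real structures beside the complex ones of [X]. Its norm unfolds to
    [rnorm] and its scaling to that by [Complex r 0], so the notions for [X] over [Complexes] and
    for [realify X] over [Reals] agree by conversion. *)
Definition realify (X : completeNormedModType (C R)) : Type := X.

Variable X : completeNormedModType (C R).
Notation XR := (realify X).

HB.instance Definition _ := GRing.Zmodule.copy XR X.
HB.instance Definition _ := Complete.copy XR X.

Definition rscale (r : R) (x : XR) : XR := (Complex r 0 : C R) *: (x : X).

Lemma rscaleA (a b : R) (v : XR) : rscale a (rscale b v) = rscale (a * b) v.
Proof.
rewrite /rscale scalerA; congr (_ *: _).
by rewrite /GRing.mul /= !(mulr0, mul0r, subr0, addr0).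
Qed.
Lemma rscale1 : left_id 1 rscale.
Proof. by move=> x; rewrite /rscale [X in X *: _](_ : _ = 1) ?scale1r. Qed.
Lemma rscaleDr : right_distributive rscale +%R.
Proof. by move=> a x y; rewrite /rscale scalerDr. Qed.
Lemma rscaleDl (v : XR) : {morph rscale^~ v : a b / a + b}.
Proof.
move=> a b; rewrite /rscale -scalerDl; congr (_ *: _).
by rewrite /GRing.add /= addr0.
Qed.
HB.instance Definition _ := GRing.Zmodule_isLmodule.Build R XR rscaleA rscale1 rscaleDr rscaleDl.

Definition rball (x : XR) (e : R) (y : XR) : Prop := complex.Re `|(x : X) - y| < e.

Lemma Re_normD (x y : X) : complex.Re `|x + y| <= complex.Re `|x| + complex.Re `|y|.
Proof.
have := ler_normD x y; rewrite lecE => /andP[_ /le_trans]; apply.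
by case: `|x| `|y| => a b [].
Qed.

Lemma norm_Re (x : X) : `|x| = Complex (complex.Re `|x|) 0.
Proof.
by have := normr_ge0 x; rewrite lecE; case: (`|x|) => a b /= /andP[/eqP-> _].
Qed.

Lemma rball_center x (e : R) : 0 < e -> rball x e x.
Proof. by rewrite /rball subrr normr0. Qed.
Lemma rball_sym x y e : rball x e y -> rball y e x.
Proof. by rewrite /rball distrC. Qed.
Lemma rball_triangle x y z e1 e2 : rball x e1 y -> rball y e2 z -> rball x (e1 + e2) z.
Proof.
rewrite /rball => xy yz; rewrite -(subrKA y).
exact: le_lt_trans (Re_normD _ _) (ltrD xy yz).
Qed.

Lemma rballE x e y : rball x e y = ball (x : X) (Complex e 0 : C R) (y : X).
Proof.
by rewrite -ball_normE /ball_ /= norm_Re ltcE /= eqxx.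
Qed.

(** In the order of the complex numbers a positive radius has imaginary part 0, so real and complex
    radii give the same balls. *)
Lemma rentourageE : entourage = entourage_ rball.
Proof.
rewrite (_ : @entourage XR = @entourage X)// -(@entourage_ballE (C R) X).
apply/seteqP; split=> A [e /= e0 eA]; last first.
  exists (Complex e 0); first by rewrite /= ltcE /= eqxx.
  by move=> [x y] /= xy; apply: eA => /=; rewrite rballE.
move: e0; rewrite ltcE; case: e eA => a b eA /= /andP[/eqP b0 a0].
exists a => // -[x y] /= xy; apply: eA => /=; rewrite b0.
by rewrite rballE in xy.
Qed.

HB.instance Definition _ := Uniform_isPseudoMetric.Build R XR
  rball_center rball_sym rball_triangle rentourageE.

Lemma rnormD (x y : XR) : @rnorm R Complexes X (x + y) <= @rnorm R Complexes X x + @rnorm R Complexes X y.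
Proof. exact: Re_normD. Qed.
Lemma rnorm_eq0 (x : XR) : @rnorm R Complexes X x = 0 -> x = 0.
Proof. by rewrite /rnorm /= => x0; apply/normr0_eq0; rewrite (@norm_Re x) x0. Qed.
Lemma rnormMn (x : XR) n : @rnorm R Complexes X (x *+ n) = @rnorm R Complexes X x *+ n.
Proof.
rewrite /rnorm /= normrMn; elim: n => [|n IH] //.
by rewrite !mulrS -IH; case: (_ *+ n) => ? ?; case: `|_|.
Qed.
Lemma rnormN (x : XR) : @rnorm R Complexes X (- x) = @rnorm R Complexes X x.
Proof. by rewrite /rnorm /= normrN. Qed.
HB.instance Definition _ := Num.Zmodule_isNormed.Build R XR rnormD rnorm_eq0 rnormMn rnormN.
Lemma rball_norm : @ball R XR = ball_ (fun x : XR => `|x|).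
Proof. by []. Qed.
HB.instance Definition _ := NormedZmod_PseudoMetric_eq.Build R XR rball_norm.
Lemma rnormZ (l : R) (x : XR) : `|l *: x| = `|l| * `|x|.
Proof.
rewrite /Num.norm /= /rnorm /= normrZ [in LHS](@norm_Re x) /=.
by rewrite !mulr0 subr0 expr0n /= addr0 sqrtr_sqr.
Qed.
HB.instance Definition _ := PseudoMetricNormedZmod_Lmodule_isNormedModule.Build R XR rnormZ.

End RestrictScalars.

Section ProductCompleteness.
Context {R : realType}.

(* The library does not infer a pointed uniform structure on the bare product. *)
Definition square (X : completeNormedModType R) : Type := (X * X)%type.

Variable X : completeNormedModType R.
HB.instance Definition _ := NormedModule.copy (square X) (X * X)%type.

Lemma square_cauchy_cvg (F : set_system (square X)) : ProperFilter F -> cauchy F -> cvg F.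
Proof.
move=> PF /cauchyP cF.
have c1 : cauchy (fst @ F).
  apply: cauchy_exP => e e0; have [z Fz] := cF e e0; exists z.1.
  suff : F [set w : square X | ball z.1 e w.1] by [].
  by apply: filterS Fz => w H; have [] : ball z.1 e w.1 /\ ball z.2 e w.2 := H.
have c2 : cauchy (snd @ F).
  apply: cauchy_exP => e e0; have [z Fz] := cF e e0; exists z.2.
  suff : F [set w : square X | ball z.2 e w.2] by [].
  by apply: filterS Fz => w H; have [] : ball z.1 e w.1 /\ ball z.2 e w.2 := H.
have /cvg_ex[a ca] : cvg (fst @ F) by apply: cauchy_cvg.
have /cvg_ex[b cb] : cvg (snd @ F) by apply: cauchy_cvg.
apply/cvg_ex; exists (a, b); apply/cvg_ballP => e e0.
move/cvg_ballP : ca => /(_ e e0) ca; move/cvg_ballP : cb => /(_ e e0) cb.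
by near=> z; split; near: z.
Unshelve. all: by end_near. Qed.

HB.instance Definition _ := Uniform_isComplete.Build (square X) square_cauchy_cvg.

End ProductCompleteness.

(** * Extension of the bounds from small times to [[0, tau]] *)

Section RealBounds.
Context {R : realType} {V : completeNormedModType R}.
Variables (T : R -> V -> V) (K C delta tau : R).
Hypothesis (hT : @C0_semigroup R Reals V T) (tau0 : 0 < tau).
Hypotheses (K0 : 0 <= K) (C0 : 0 <= C) (delta0 : 0 < delta).
Hypothesis TK : forall t x, 0 < t <= delta -> `|T t x| <= K * `|x|.
Hypothesis TG : forall t x, 0 < t <= delta -> exists w, `|w| <= C / t * `|x| /\ gen T (T t x) w.
Local Notation domA := (@domA R Reals V T).
Local Notation opA := (@opA R Reals V T).

Lemma semigroup_bounds : exists M C', [/\ 0 <= M, 0 <= C',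
  forall t x, 0 <= t <= tau -> `|T t x| <= M * `|x|,
  forall t x, 0 < t <= tau -> domA (T t x) &
  forall t x, 0 < t <= tau -> `|opA (T t x)| <= C' / t * `|x|].
Proof.
have d0 := delta0; have t00 := tau0.
(* A constant at least 1 covers the time 0, where [T] is the identity, and makes its powers increase
   with the number of steps of length [delta]. *)
pose K1 := K + 1; have K10 : 0 <= K1 by rewrite addr_ge0.
have K11 : 1 <= K1 by rewrite lerDr.
have small t x : 0 <= t <= delta -> `|T t x| <= K1 * `|x|.
  move=> /andP[]; rewrite le_eqVlt => /predU1P[<- _|t0 td].
    by rewrite (T_id hT) ler_peMl.
  have tt : 0 < t <= delta by rewrite t0.
  by apply: le_trans (TK x tt) _; rewrite ler_wpM2r// lerDl.
have pow n : forall t x, 0 <= t <= n%:R * delta -> `|T t x| <= K1 ^+ n * `|x|.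
  elim: n => [|n IH] t x.
    by rewrite mul0r expr0 mul1r -eq_le => /eqP <-; rewrite (T_id hT).
  rewrite -natr1 mulrDl mul1r => tt.
  have [td|dt] := leP t delta.
    apply: le_trans (small t x _) _; first by lra.
    by rewrite ler_wpM2r// exprS ler_peMr// exprn_ege1.
  have -> : T t x = T (t - delta) (T delta x).
    by rewrite -(T_semigroup hT) ?subrK//; lra.
  have nt : 0 <= t - delta <= n%:R * delta by lra.
  apply: le_trans (IH _ _ nt) _; rewrite exprSr -mulrA ler_wpM2l ?exprn_ge0//.
  by apply: small; rewrite lexx ltW.
have [n nt] : exists n : nat, tau <= n%:R * delta.
  exists (Num.truncn (tau / delta)).+1; rewrite -ler_pdivrMr//.
  by apply: ltW; exact: truncnS_gt.
pose M := K1 ^+ n; have M0 : 0 <= M by rewrite exprn_ge0.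
have TM t x : 0 <= t <= tau -> `|T t x| <= M * `|x|.
  by move=> tt; apply: pow; lra.
(* Beyond [delta], [A T(t) = T(t - delta) A T(delta)] is bounded by [M * (C / delta)], which is at
   most [M * (C / delta) * tau / t] as [t <= tau]. *)
pose C' := C + M * (C / delta) * tau.
have Cd : 0 <= C / delta by rewrite divr_ge0// ltW.
have MC : 0 <= M * (C / delta) * tau by exact: mulr_ge0 (mulr_ge0 M0 Cd) (ltW t00).
have H t x : 0 < t <= tau -> domA (T t x) /\ `|opA (T t x)| <= C' / t * `|x|.
  move=> tt; have t0 : 0 < t by lra.
  have [td|dt] := leP t delta.
    have tt' : 0 < t <= delta by rewrite t0.
    have [w [wb /gen_opA[d ->]]] := TG x tt'; split=> //.
    rewrite normrN; apply: le_trans wb _; rewrite ler_wpM2r// ler_pM2r ?invr_gt0//.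
    by rewrite /C' lerDl.
  have -> : T t x = T (t - delta) (T delta x).
    by rewrite -(T_semigroup hT) ?subrK//; lra.
  have dd : 0 < delta <= delta by rewrite d0 lexx.
  have td : 0 <= t - delta <= tau by lra.
  have [w [wb /gen_opA[d E]]] := TG x dd.
  have [d' ->] := domA_T hT TM td d; split=> //.
  apply: le_trans (TM _ _ td) _; rewrite E normrN.
  apply: le_trans (ler_wpM2l M0 wb) _; rewrite mulrA ler_wpM2r//.
  rewrite ler_pdivlMr//; apply: (@le_trans _ _ (M * (C / delta) * tau)).
    by have /andP[_ tl] := tt; exact: ler_wpM2l (mulr_ge0 M0 Cd) _ _ tl.
  by rewrite /C' lerDr.
exists M, C'; split; [exact: M0|exact: addr_ge0|exact: TM| |].
- by move=> t x /(H t x)[].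
- by move=> t x /(H t x)[].
Qed.

End RealBounds.

(** * Reduction to real scalars *)

Section HolomorphicEquivalence.
Context {R : realType} {V Y : completeNormedModType R}.
Variables (T : R -> V -> V) (act : C R -> Y -> Y) (J : Y -> Y) (U : R -> Y -> Y)
  (inj : V -> Y) (proj : Y -> V) (tau p : R).
Hypotheses (hT : @C0_semigroup R Reals V T) (tau0 : 0 < tau) (p1 : 1 < p).
Hypotheses (JD : forall x y, J (x + y) = J x + J y) (JZ : forall (k : R) x, J (k *: x) = k *: J x).
Hypotheses (JJ : forall x, J (J x) = - x) (Jnorm : forall x, `|J x| <= `|x|).
Hypothesis actE : forall c y, act c y = cmul J (complex.Re c) (complex.Im c) y.
Hypothesis hol : @has_holomorphic_extension R R Y act U.
Hypotheses (projD : forall x y, proj (x + y) = proj x + proj y)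
  (projZ : forall (k : R) x, proj (k *: x) = k *: proj x)
  (proj_norm : forall y, `|proj y| <= `|y|) (inj_norm : forall x, `|inj x| <= `|x|).
Hypothesis TU : forall t x, T t x = proj (U t (inj x)).

(** [T] is the compression by [inj] and [proj] of a semigroup [U] with a holomorphic extension, and
    the bounds for [U] descend because [proj] is real linear and both maps are contractive. On a
    real space [U] is the complexified semigroup on pairs; on a complex space both maps are the
    identity. *)
Lemma holomorphic_equivalence (Phi : V -> V) :
  (forall x, @trp R Reals V T p tau x -> @trp R Reals V T p tau (Phi x)) ->
  (forall (a : R) x y, @trp R Reals V T p tau x -> @trp R Reals V T p tau y ->
     Phi (a *: x + y) = a *: Phi x + Phi y) ->
  (@maximal_regularity R Reals V T p tau /\
   set_bij (@trp R Reals V T p tau) (@trp R Reals V T p tau) (fun x => x - Phi (T tau x)))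
  <-> @maximal_Lp_regularity R Reals V T p tau Phi.
Proof.
have [theta [S [theta0 [SU Slin Ssg Sder Scvg]]]] := hol.
have th0 : 0 < theta by case/andP: theta0.
have th2 : 0 < theta / 2 by rewrite divr_gt0.
have [k [k01 wide]] := sector_cone th2.
have [K [C1 [delta [K0 C10 delta0 est]]]] :=
  holomorphic_estimates JD JZ JJ Jnorm actE th0 Slin Ssg Sder Scvg k01 wide.
have projB x y : proj (x - y) = proj x - proj y.
  by rewrite projD -scaleN1r projZ scaleN1r.
have [||M [C' [M0 C0 TM TD TC]]] := @semigroup_bounds R V T K C1 delta tau hT tau0 K0 C10 delta0.
- move=> t x tt; rewrite TU -SU; last by case/andP: tt.
  have [b _] := est t (inj x) tt; apply: le_trans (proj_norm _) _; apply: le_trans b _.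
  by rewrite ler_wpM2l.
- move=> t x tt; have [_ [w [wb wd]]] := est t (inj x) tt; have /andP[t0 _] := tt.
  exists (proj w); split.
    apply: le_trans (proj_norm _) _; apply: le_trans wb _.
    by rewrite ler_wpM2l// divr_ge0// ltW.
  move=> e e0; have [eta eta0 He] := wd e e0; exists eta => // h hh; have /andP[h0 _] := hh.
  rewrite -(T_semigroup hT) ?(ltW h0) ?(ltW t0)// (addrC h) !TU -projB -projZ -projB.
  apply: le_trans (proj_norm _) _.
  by rewrite -!SU ?addr_gt0//; exact: He.
exact: (period_map_equivalence hT tau0 p1 TM TD TC M0 C0).
Qed.

End HolomorphicEquivalence.

Lemma equivalence_real (R : realType) (X : completeNormedModType R) (T : R -> X -> X)
  (tau p : R) (Phi : X -> X)
  (hT : @C0_semigroup R Reals X T) (hol : @holomorphic_semigroup R Reals X T)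
  (htau : 0 < tau) (hp : 1 < p)
  (Phi_trp : forall x, @trp R Reals X T p tau x -> @trp R Reals X T p tau (Phi x))
  (Phi_lin : forall (a : R) (x y : X),
     @trp R Reals X T p tau x -> @trp R Reals X T p tau y -> Phi (a *: x + y) = a *: Phi x + Phi y) :
  (@maximal_regularity R Reals X T p tau /\
   set_bij (@trp R Reals X T p tau) (@trp R Reals X T p tau) (fun x => x - Phi (T tau x)))
  <-> @maximal_Lp_regularity R Reals X T p tau Phi.
Proof.
(* Multiplication by i on the complexification. The maximum norm of pairs is homogeneous for real
   scalars only, but [J] preserves it, which is what the Cauchy estimate asks of the norm. *)
pose J (x : square X) : square X := (- x.2, x.1).
have norm2 (x : square X) : `|x| = Num.max `|x.1| `|x.2| by [].
have J_norm x : `|J x| <= `|x|.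
  by rewrite !norm2 /= normrN maxC.
have actE c (y : square X) : cplx_act c y = cmul J (complex.Re c) (complex.Im c) y.
  by congr pair; rewrite /= ?scalerN// addrC.
apply: (@holomorphic_equivalence R X (square X) T (@cplx_act R X) J
  (fun t x => (T t x.1, T t x.2)) (fun x => (x, 0)) (fun x => x.1) tau p hT htau hp).
- by move=> x y; congr pair; rewrite /= opprD.
- by move=> k x; congr pair; rewrite /= scalerN.
- by move=> x; congr pair.
- exact: J_norm.
- exact: actE.
- exact: hol.
- by [].
- by [].
- by move=> y; rewrite norm2 le_max lexx.
- by move=> x; rewrite norm2 normr0 ge_max lexx normr_ge0.
- by [].
- exact: Phi_trp.
- exact: Phi_lin.
Qed.

Lemma equivalence_complex (R : realType) (X : completeNormedModType (C R)) (T : R -> X -> X)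
  (tau p : R) (Phi : X -> X)
  (hT : @C0_semigroup R Complexes X T) (hol : @holomorphic_semigroup R Complexes X T)
  (htau : 0 < tau) (hp : 1 < p)
  (Phi_trp : forall x, @trp R Complexes X T p tau x -> @trp R Complexes X T p tau (Phi x))
  (Phi_lin : forall (a : C R) (x y : X),
     @trp R Complexes X T p tau x -> @trp R Complexes X T p tau y -> Phi (a *: x + y) = a *: Phi x + Phi y) :
  (@maximal_regularity R Complexes X T p tau /\
   set_bij (@trp R Complexes X T p tau) (@trp R Complexes X T p tau) (fun x => x - Phi (T tau x)))
  <-> @maximal_Lp_regularity R Complexes X T p tau Phi.
Proof.
pose XR : completeNormedModType R := realify X.
have hT' : @C0_semigroup R Reals XR T.
  have [h1 h2 h3 h4] := hT; split; [|exact: h2|exact: h3|exact: h4].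
  move=> t t0; have [l c] := h1 t t0; split; last exact: c.
  by move=> a x y; exact: (l (Complex a 0)).
pose J (x : XR) : XR := (Complex 0 1 : C R) *: (x : X).
have actE (c : C R) (y : XR) : (c *: (y : X) : XR) = cmul J (complex.Re c) (complex.Im c) y.
  have -> : cmul J (complex.Re c) (complex.Im c) y = (Complex (complex.Re c) 0 : C R) *: (y : X) + (Complex (complex.Im c) 0 : C R) *: ((Complex 0 1 : C R) *: (y : X)) by [].
  have {1}-> : c = (Complex (complex.Re c) 0 : C R) + (Complex (complex.Im c) 0 : C R) * (Complex 0 1 : C R).
    case: c => a b; rewrite /GRing.mul /GRing.add /=.
    by congr Complex; ring.
  by rewrite scalerA -scalerDl.
apply: (@holomorphic_equivalence R XR XR T (fun (c : C R) (x : X) => c *: x) J T id id tau p hT' htau hp).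
- by move=> x y; exact: (@scalerDr (C R) X (Complex 0 1) x y).
- move=> k x; have E : (Complex 0 1 : C R) *: ((Complex k 0 : C R) *: (x : X)) = (Complex k 0 : C R) *: ((Complex 0 1 : C R) *: (x : X)).
    by rewrite !scalerA mulrC.
  exact: E.
- move=> x; have E : (Complex 0 1 : C R) *: ((Complex 0 1 : C R) *: (x : X)) = - (x : X).
    have ii : (Complex 0 1 : C R) * Complex 0 1 = - 1.
      by rewrite /GRing.mul /GRing.opp /=; congr Complex; ring.
    by rewrite scalerA ii scaleN1r.
  exact: E.
- move=> x.
  have E : `|(Complex 0 1 : C R) *: (x : X)| = `|x : X|.
    rewrite normrZ; have -> : `|Complex 0 1 : C R| = 1; last by rewrite mul1r.
    have -> : `|Complex 0 1 : C R| = Complex (Num.sqrt ((0 : R) ^+ 2 + 1 ^+ 2)) 0 by [].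
    by rewrite expr0n add0r expr1n sqrtr1.
  have E' : `|J x| = `|x| by rewrite /Num.norm /= /rnorm E.
  by rewrite E'.
- exact: actE.
- exact: hol.
- by [].
- by [].
- by move=> y; exact: lexx.
- by move=> y; exact: lexx.
- by [].
- exact: Phi_trp.
by move=> a x y; exact: (Phi_lin (Complex a 0)).
Qed.

Theorem proposition2p10 (R : realType) (s : scalars)
  (X : completeNormedModType (field_of R s)) (T : R -> X -> X)
  (tau p : R) (Phi : X -> X)
  (hT : C0_semigroup T) (hol : holomorphic_semigroup T)
  (htau : 0 < tau) (hp : 1 < p)
  (Phi_trp : forall x, trp T p tau x -> trp T p tau (Phi x))
  (Phi_lin : forall (a : field_of R s) (x y : X),
     trp T p tau x -> trp T p tau y -> Phi (a *: x + y) = a *: Phi x + Phi y) :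
  (maximal_regularity T p tau /\
   set_bij (trp T p tau) (trp T p tau) (fun x => x - Phi (T tau x)))
  <-> maximal_Lp_regularity T p tau Phi.
Proof.
case: s X T Phi hT hol Phi_trp Phi_lin => X T Phi hT hol Phi_trp Phi_lin.
  exact: equivalence_real.
exact: equivalence_complex.
Qed.
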